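(* Let $\alpha>0$, let $\Omega,\Omega'\subset G^2_\alpha$ be open and assume that $g\in HW^{1,\frac{2(\alpha+1)}{\alpha}}(\Omega,\Omega')$ is an orientation preserving conformal map. Fix a curve $\gamma=(\gamma_1,\gamma_2):[a,b]\to\Omega$, absolutely continuous in the Euclidean metric, such that $\gamma_1\neq 0$ a.e. in $[a,b]$. Then $\gamma$ is admissible if and only if $g(\gamma)=g\circ\gamma$ is admissible.
   Context: Fix $\alpha>0$. The Grushin plane $G^2_\alpha$ is $\mathbb{R}^2$ with the Carnot--Carath\'eodory metric induced by the vector fields $X=\partial_x$, $Y_\alpha=|x|^\alpha\partial_y$. ''A.e.'' in the plane and $L^p(\Omega)$ refer to Lebesgue measure on $\mathbb{R}^2$; homeomorphisms are from $\Omega$ onto $\Omega'$. Sobolev spaces. For $\Omega\subset G^2_\alpha$ open and $p\ge 1$, $HW^{1,p}(\Omega)$ is the space of $u\in L^p(\Omega)$ whose first weak partial derivatives exist and whose horizontal gradient $\nabla_H u=(Xu,Y_\alpha u)$ is in $L^p(\Omega)$. A map $g=(g_1,g_2):\Omega\to\Omega'$ is in $HW^{1,p}(\Omega,\Omega')$ if $g_1,g_2\in HW^{1,p}(\Omega)$, and in $HW^{1,p}_{\mathrm{loc}}(\Omega,\Omega')$ if $g\in HW^{1,p}(U,\Omega')$ for every $U\subset\subset\Omega$ (closures in the Euclidean topology). Partial derivatives are the usual Euclidean ones, which exist a.e. Orientation preserving. $g\in HW^{1,1}_{\mathrm{loc}}(\Omega,\Omega')$ is orientation preserving if $J_g=X(g_1)Y_\alpha(g_2)-X(g_2)Y_\alpha(g_1)>0$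 a.e. in $\Omega$. Conformal. Let $S_g=\{(x,y)\in\Omega \mid x=0\ \text{or}\ g_1(x,y)=0\}$ and $R_g=\Omega\setminus S_g$. A homeomorphism $g=(g_1,g_2)\in HW^{1,2}_{\mathrm{loc}}(\Omega,\Omega')$ is conformal in $\Omega$ if: (1) the matrix $$D_\alpha g=\begin{bmatrix}X(g_1)&Y_\alpha(g_1)\\ \frac{X(g_2)}{|g_1|^\alpha}&\frac{Y_\alpha(g_2)}{|g_1|^\alpha}\end{bmatrix}$$ is equal, almost everywhere in $R_g$, to an orthogonal matrix multiplied by some positive function in $R_g$; and (2) for all points $(x_0,y_0)\in S_g$ the limit $\lim_{R_g\ni(x,y)\to(x_0,y_0)}D_\alpha g(x,y)$ is defined, finite and non-zero. Admissible curves. A curve $\gamma=(\gamma_1,\gamma_2):[a,b]\to G^2_\alpha$ is admissible if it is absolutely continuous (in the Euclidean metric) and there exist $u_1,u_2\in L^1([a,b])$ such that $\gamma'(t)=u_1(t)X(\gamma(t))+u_2(t)Y_\alpha(\gamma(t))$ for a.e. $t\in[a,b]$; this is equivalent to $\gamma_1',\ \frac{\gamma_2'}{|\gamma_1|^\alpha}\in L^1([a,b])$. *)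

(* Defs.v *)
From HB Require Import structures.
From mathcomp Require Import all_boot all_order all_algebra.
From mathcomp Require Import all_classical all_reals all_analysis.

Set Implicit Arguments.
Unset Strict Implicit.
Unset Printing Implicit Defensive.

Import Order.TTheory GRing.Theory Num.Theory.
Import numFieldNormedType.Exports.

Local Open Scope classical_set_scope.
Local Open Scope ring_scope.

Definition plane_measure (R : realType) : 
    {measure set (measurableTypeR R * measurableTypeR R) -> \bar R} :=
  (@lebesgue_measure R \x @lebesgue_measure R)%E.
Arguments plane_measure R : clear implicits.

Section Grushin.
Context {R : realType}.
Implicit Types (Om U K : set (R * R)) (u v : R * R -> R).
Implicit Types (g : R * R -> R * R) (gam : R -> R * R) (z : R * R).

Local Notation mu2 := (plane_measure R).

Definition e1 : R * R := (1, 0).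
Definition e2 : R * R := (0, 1).

Definition fieldX z : R * R := e1.
Definition fieldY (alpha : R) z : R * R := (0, `|z.1| `^ alpha).

(* u \_ Om extends u by 0 outside Om.  [Lfun] requires Borel measurability:
   this is no restriction on weak derivatives, which are determined only up to
   null sets. *)
Definition in_Lp Om (p : R) u : Prop := u \_ Om \in Lfun mu2 p%:E.

Definition in_L1loc Om u : Prop :=
  forall K, compact K -> K `<=` Om -> mu2.-integrable K (EFin \o u).

Fixpoint C_n (n : nat) (phi : R * R -> R) : Prop :=
  continuous phi /\
  if n is m.+1 then
    [/\ forall z, derivable phi z e1 /\ derivable phi z e2,
        C_n m ('D_e1 phi) & C_n m ('D_e2 phi)]
  else True.

Definition test_function Om (phi : R * R -> R) : Prop :=
  let supp := closure [set z | phi z != 0] in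
  [/\ forall n, C_n n phi, compact supp & supp `<=` Om].

Definition weak_partial Om (e : R * R) u v : Prop :=
  [/\ in_L1loc Om u, in_L1loc Om v &
   forall phi, test_function Om phi ->
     \int[mu2]_(z in Om) (u z * 'D_e phi z) =
     - \int[mu2]_(z in Om) (v z * phi z)].

Definition HW_fun (alpha p : R) Om u : Prop :=
  in_Lp Om p u /\
  exists ux uy : R * R -> R,
    [/\ weak_partial Om e1 u ux, weak_partial Om e2 u uy,
        in_Lp Om p ux & in_Lp Om p (fun z => `|z.1| `^ alpha * uy z)].

(* Maps Om -> Om' are represented by total maps of the plane; only their
   values on Om matter. *)
Definition HW (alpha p : R) Om (Om' : set (R * R)) g : Prop :=
  [/\ g @` Om `<=` Om', HW_fun alpha p Om (fun z => (g z).1) &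
      HW_fun alpha p Om (fun z => (g z).2)].

Definition HW_loc (alpha p : R) Om (Om' : set (R * R)) g : Prop :=
  forall U, open U -> compact (closure U) -> closure U `<=` Om ->
    HW alpha p U Om' g.

(* ['D_e u z] is a total operator, so the existence of the classical partial
   derivatives of g at z is recorded separately by [has_partials]. *)

Definition derX u z : R := 'D_e1 u z.
Definition derY (alpha : R) u z : R := `|z.1| `^ alpha * 'D_e2 u z.

Definition has_partials g z : Prop :=
  [/\ derivable (fun w => (g w).1) z e1, derivable (fun w => (g w).1) z e2,
      derivable (fun w => (g w).2) z e1 & derivable (fun w => (g w).2) z e2].

Definition jacobian (alpha : R) g z : R :=
  derX (fun w => (g w).1) z * derY alpha (fun w => (g w).2) z -
  derX (fun w => (g w).2) z * derY alpha (fun w => (g w).1) z.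

Definition orientation_preserving (alpha : R) Om Om' g : Prop :=
  HW_loc alpha 1 Om Om' g /\
  {ae mu2, forall z, Om z -> has_partials g z /\ 0 < jacobian alpha g z}.

Definition homeomorphism_onto Om (Om' : set (R * R)) g : Prop :=
  set_bij Om Om' g /\
  exists h : R * R -> R * R,
    [/\ {in Om, cancel g h}, {within Om, continuous g} &
        {within Om', continuous h}].

Definition singular_set Om g : set (R * R) :=
  [set z | Om z /\ (z.1 = 0 \/ (g z).1 = 0)].

Definition regular_set Om g : set (R * R) := Om `\` singular_set Om g.

Definition mx2 (a b c d : R) : 'M[R]_2 :=
  \matrix_(i, j) (if i == 0 then if j == 0 then a else b
                  else if j == 0 then c else d).

Definition Dmx (alpha : R) g z : 'M[R]_2 :=
  let g1 := fun w => (g w).1 in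
  let g2 := fun w => (g w).2 in
  mx2 (derX g1 z)                          (derY alpha g1 z)
      (derX g2 z / `|(g z).1| `^ alpha) (derY alpha g2 z / `|(g z).1| `^ alpha).

Definition orthogonal_mx (A : 'M[R]_2) : Prop := A *m A^T = 1%:M.

(* The limit in the last clause runs over the points of the regular set where
   [Dmx] is defined, i.e. where the four partial derivatives exist. *)
Definition conformal (alpha : R) Om Om' g : Prop :=
  [/\ homeomorphism_onto Om Om' g,
      HW_loc alpha 2 Om Om' g,
      exists lam : R * R -> R,
        (forall z, regular_set Om g z -> 0 < lam z) /\
        {ae mu2, forall z, regular_set Om g z ->
           has_partials g z /\
           exists2 A : 'M[R]_2, orthogonal_mx A & Dmx alpha g z = lam z *: A} &
      forall z0, singular_set Om g z0 ->
        exists2 L : 'M[R]_2, L != 0 &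
          Dmx alpha g z @[z --> within
            (regular_set Om g `&` [set z | has_partials g z]) (nbhs z0)] --> L].

(* The norm of the product type [R * R] is the sup norm, hence this explicit
   Euclidean distance. *)
Definition eucl_dist z (w : R * R) : R :=
  Num.sqrt ((z.1 - w.1) ^+ 2 + (z.2 - w.2) ^+ 2).

Definition absolutely_continuous (a b : R) gam : Prop :=
  forall eps : R, 0 < eps -> exists2 delta : R, 0 < delta &
    forall (n : nat) (s t : 'I_n -> R),
      (forall i, a <= s i /\ s i <= t i /\ t i <= b) ->
      trivIset [set: 'I_n] (fun i => [set x | s i < x < t i]) ->
      \sum_(i < n) (t i - s i) < delta ->
      \sum_(i < n) eucl_dist (gam (s i)) (gam (t i)) < eps.

Definition admissible (alpha a b : R) gam : Prop :=
  absolutely_continuous a b gam /\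
  exists u1 u2 : R -> R,
    [/\ (@lebesgue_measure R).-integrable `[a, b] (EFin \o u1),
        (@lebesgue_measure R).-integrable `[a, b] (EFin \o u2) &
        {ae @lebesgue_measure R, forall t, t \in `[a, b] ->
          is_derive t (1 : R) gam
            (u1 t *: fieldX (gam t) + u2 t *: fieldY alpha (gam t))}].

End Grushin.

(* Main.v *)
Require Import Defs.
From HB Require Import structures.
From mathcomp Require Import all_boot all_order all_algebra.
From mathcomp Require Import all_classical all_reals all_analysis.
From mathcomp Require Import measurable_realfun.
From mathcomp Require Import ring lra.

Set Implicit Arguments.
Unset Strict Implicit.
Unset Printing Implicit Defensive.

Import Order.TTheory GRing.Theory Num.Theory.
Import numFieldNormedType.Exports.

Local Open Scope classical_set_scope.
Local Open Scope ring_scope.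


(** Write [wt t = |t|^alpha] for the weight of the Grushin plane and
    [straighten t = t |t|^alpha / (alpha + 1)] for its antiderivative. The proof
    has three ingredients.

    Regularity. At almost every regular point the differential of [g], written
    in the frames X, Y, is a positive multiple of a rotation, with entries
    [p, -q; q, p]. So the pair (straighten g1, g2) satisfies the Cauchy-Riemann
    equations in the coordinates (straighten x, y): first almost everywhere,
    then weakly, because Sobolev functions that are continuous are absolutely
    continuous on almost every line and may be integrated by parts
    ([weak_CR_of_ae]). The integral of a weak solution against a radial kernel
    does not depend on the radius ([profile_integral_invariant]), so the
    solution is a quotient of integrals against C^1 kernels, and itself C^1
    ([weyl_regularity]). Hence [g] is differentiable at every regular point and
    [p], [q] are continuous there ([regular_partials]).

    The axis. Near a singular point the matrices converge to a nonzero limit,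
    so [p] and [q] are bounded and one of them stays away from 0
    ([near_singular_entries]). If a point of the axis were mapped off the axis,
    a vertical derivative of a component of [g] would be at least a constant
    over [wt x] near it, and the component would be unbounded
    ([vertical_blow_up]); the same argument applies to the inverse map. So [g]
    maps exactly the axis to the axis ([axis_to_axis], [axis_from_axis]), the
    ratio |g1| / |x| is locally bounded ([axis_linear]) and [g2] is locally
    Lipschitz ([second_locally_lipschitz]), although [g1] need not be.

    Curves. Absolutely continuous functions on an interval are the indefinite
    integrals of their derivatives ([AC_chain_primitive]): the total variation
    reduces this to monotone functions, whose Stieltjes measures are dominated
    by Lebesgue measure. At almost every time the curve is off the axis, hence
    at a regular point, and the chain rule gives the coefficients of the image
    velocity, [v1 = p u1 - q u2] and [v2 = q u1 + p u2], from those of the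
    curve. Boundedness of [p] and [q] along the curve makes [v1] and [v2]
    integrable when [u1] and [u2] are ([admissible_image]). Conversely, [u1] is
    integrable by absolute continuity, and [u2] is bounded by a multiple of
    |v1| + |v2| near the axis, where the matrix is uniformly invertible, and by
    a multiple of |gamma2'| away from it ([admissible_preimage]). *)


(** * Smooth functions of one variable *)

Section SmoothFunctions.
Context {R : realType}.
Implicit Types f g : R -> R.

Fixpoint smooth_upto (n : nat) f : Prop :=
  if n is m.+1 then
    exists f', (forall x, is_derive x (1 : R) f (f' x)) /\ smooth_upto m f'
  else continuous f.

Definition smooth f := forall n, smooth_upto n f.

Lemma is_derive_continuous f (f' : R -> R) :
  (forall x, is_derive x (1 : R) f (f' x)) -> continuous f.
Proof.
move=> df x; apply: differentiable_continuous.
by apply/derivable1_diffP; case: (df x).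
Qed.

Lemma smooth_continuous f : smooth f -> continuous f.
Proof. by move=> /(_ 0%N). Qed.

Lemma smooth_uptoW n f : smooth_upto n.+1 f -> smooth_upto n f.
Proof.
elim: n f => [f [f' [/is_derive_continuous //]]|n IH f [f' [df' Hf']]].
by exists f'; split=> //; exact: IH.
Qed.

Lemma smooth_derivative f : smooth f ->
  exists f', smooth f' /\ forall x, is_derive x (1 : R) f (f' x).
Proof.
move=> sf; case: (sf 1%N) => f' [df' _]; exists f'; split=> // n.
case: (sf n.+1) => g [dg sg]; suff -> : f' = g by [].
by apply/funext => x; rewrite -(@derive_val _ _ _ _ _ _ _ (df' x)) derive_val.
Qed.

Lemma smooth_upto_cst n (c : R) : smooth_upto n (fun=> c).
Proof.
elim: n c => [c x|n IH c]; first exact: cvg_cst.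
by exists (fun=> 0); split=> // x; exact: is_derive_cst.
Qed.

Lemma smooth_uptoD n f g :
  smooth_upto n f -> smooth_upto n g -> smooth_upto n (fun x => f x + g x).
Proof.
elim: n f g => [f g cf cg x|n IH f g [f' [df sf]] [g' [dg sg]]].
  by apply: cvgD; [exact: cf|exact: cg].
exists (fun x => f' x + g' x); split; last exact: IH.
by move=> x; have := is_deriveD (df x) (dg x).
Qed.

Lemma smooth_uptoM n f g :
  smooth_upto n f -> smooth_upto n g -> smooth_upto n (fun x => f x * g x).
Proof.
elim: n f g => [f g cf cg x|n IH f g sf sg].
  by apply: cvgM; [exact: cf|exact: cg].
case: (sf) => f' [df sf']; case: (sg) => g' [dg sg'].
exists (fun x => f x * g' x + g x * f' x); split; last first.
  by apply: smooth_uptoD; apply: IH => //; exact: smooth_uptoW.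
by move=> x; have := is_deriveM (df x) (dg x).
Qed.

Lemma smooth_upto_affine n f (a b : R) :
  smooth_upto n f -> smooth_upto n (fun x => f (a * x + b)).
Proof.
have daff (x : R) : is_derive x (1 : R) (fun x => a * x + b) a.
  have H1 : is_derive x (1 : R) (fun x : R => a * x) a.
    have := is_deriveZ a (is_derive_id x (1 : R)).
    by rewrite /GRing.scale /= mulr1.
  by have := is_deriveD H1 (is_derive_cst b x 1); rewrite addr0.
elim: n f => [f cf|n IH f [f' [df sf]]].
  move=> x; apply: (@continuous_comp _ _ _ (fun x => a * x + b) f).
    exact: (is_derive_continuous daff).
  exact: cf.
exists (fun x => f' (a * x + b) * a); split.
  by move=> x; exact: (is_derive1_comp (df _) (daff x)).
by apply: smooth_uptoM; [exact: IH|exact: smooth_upto_cst].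
Qed.

(** Dividing exp(-1/t) by powers of t gives a family that is closed under
    differentiation, which is what makes its members smooth at 0. *)
Definition flat (k : nat) (t : R) : R :=
  if 0 < t then expR (- t^-1) / t ^+ k else 0.

Lemma flat_ge0 k t : 0 <= flat k t.
Proof.
rewrite /flat; case: ifPn => // t0.
by rewrite divr_ge0 ?expR_ge0// exprn_ge0// ltW.
Qed.

(** This bound makes all the functions of the family differentiable at 0. *)
Lemma flat_quadratic k : exists C : R, forall t, flat k t <= C * t ^+ 2.
Proof.
exists (k.+2%:R ^+ k.+2) => t; rewrite /flat; case: ifPn => t0; last first.
  by rewrite mulr_ge0 ?sqr_ge0 ?exprn_ge0 ?ler0n.
have tk : 0 < t^-1 / k.+2%:R by rewrite divr_gt0 ?invr_gt0.
have H : (t^-1 / k.+2%:R) ^+ k.+2 <= expR t^-1.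
  have -> : expR t^-1 = expR (t^-1 / k.+2%:R) ^+ k.+2.
    by rewrite -expRM_natr mulrVK// unitfE pnatr_eq0.
  rewrite ler_pXn2r ?nnegrE ?expR_ge0// ?(ltW tk)//.
  by apply: le_trans (expR_ge1Dx _); rewrite lerDr.
rewrite expRN ler_pdivrMr ?exprn_gt0// -mulrA -exprD -lef_pV2; last 2 first.
- by rewrite posrE mulr_gt0 ?exprn_gt0.
- by rewrite posrE invr_gt0 expR_gt0.
rewrite invrK; apply: le_trans H.
by rewrite expr_div_n exprVn invfM mulrC add2n lexx.
Qed.

Lemma is_derive_flat k x :
  is_derive x (1 : R) (flat k) (flat k.+2 x - k%:R * flat k.+1 x).
Proof.
have [x0|x0|<-] := ltgtP 0 x.
- have Dinv : is_derive x (1 : R) (fun y : R => - y^-1) (x ^- 2).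
    have := is_deriveN (@is_deriveV _ id x 1 1 _ (is_derive_id x (1:R))).
    rewrite gt_eqF// => /(_ isT) H; apply: is_derive_eq H _.
    by rewrite scaleNr opprK /GRing.scale /= mulr1.
  have Dexp := @is_derive1_comp R expR (fun y => - y^-1) x _ _ (is_derive_expR _) Dinv.
  have Dpow : is_derive x (1 : R) (fun y : R => (y ^+ k)^-1)
      (- (x ^+ k) ^- 2 * (k%:R * x ^+ k.-1)).
    have Dp : is_derive x (1 : R) (fun y : R => y ^+ k) (k%:R * x ^+ k.-1).
      have := is_deriveX k (is_derive_id x (1:R)).
      rewrite /GRing.scale /= mulr1 => H; apply: near_eq_is_derive H.
      by near=> y; rewrite /= fctE.
    have := @is_deriveV _ _ _ _ _ _ Dp; apply.
    by rewrite expf_neq0// gt_eqF.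
  have D := is_deriveM Dexp Dpow.
  have E : \forall y \near x, (expR \o (fun y : R => - y^-1)) y *
      (fun y : R => (y ^+ k)^-1) y = flat k y.
    near=> y; have y0 : 0 < y by near: y; exact: lt_nbhsr.
    by rewrite /flat y0 /=.
  apply: is_derive_eq (near_eq_is_derive E D) _.
  rewrite /flat x0 /GRing.scale /=.
  case: k {D E Dpow} => [|k].
    by rewrite !mul0r !mulr0 subr0 add0r expr0 /=; field; rewrite gt_eqF.
  have xn : x != 0 by rewrite gt_eqF.
  rewrite !exprS; field; rewrite xn expf_neq0//.
- have E : \forall y \near x, (cst (0 : R)) y = flat k y.
    near=> y; have y0 : y < 0 by near: y; exact: lt_nbhsl.
    by rewrite /flat /= ltNge (ltW y0).
  apply: is_derive_eq (near_eq_is_derive E (is_derive_cst (0:R) x 1)) _.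
  by rewrite /flat ltNge (ltW x0)/= mulr0 subr0.
- have [C HC] := flat_quadratic k.
  apply/is_derive1_caratheodory.
  exists (fun z => flat k z / z); split.
  + move=> z; rewrite subr0 /flat ltxx subr0.
    by have [->|z0] := eqVneq z 0; rewrite ?ltxx ?mulr0// divfK.
  + suff : flat k z / z @[z --> (0 : R)] --> (0 : R).
      by rewrite /prop_for /continuous_at invr0 mulr0.
    apply/cvgrPdist_le => /= e e0.
    have C0 : 0 < `|C| + 1 by rewrite ltr_wpDl.
    near=> z; rewrite sub0r normrN.
    have [->|z0] := eqVneq z 0; first by rewrite invr0 mulr0 normr0 ltW.
    rewrite normrM normfV ler_pdivrMr ?normr_gt0// ger0_norm ?flat_ge0//.
    apply: (le_trans (HC z)).
    apply: (@le_trans _ _ ((`|C| + 1) * `|z| ^+ 2)).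
      rewrite real_normK ?num_real// ler_wpM2r ?sqr_ge0//.
      by rewrite (le_trans (ler_norm _))// lerDl.
    rewrite expr2 mulrA ler_wpM2r// mulrC -ler_pdivlMr//.
    near: z; exists (e / (`|C| + 1)); rewrite /= ?divr_gt0// => z /=.
    by rewrite sub0r normrN => /ltW.
  + by rewrite /flat ltxx mul0r mulr0 subr0.
Unshelve. all: by end_near. Qed.

Lemma smooth_flat k : smooth (flat k).
Proof.
move=> n; elim: n k => [|n IH] k.
  exact: (is_derive_continuous (is_derive_flat k)).
exists (fun x => flat k.+2 x + (- k%:R) * flat k.+1 x); split.
  by move=> x; apply: is_derive_eq (is_derive_flat k x) _; rewrite mulNr.
apply: smooth_uptoD => //; apply: smooth_uptoM => //; exact: smooth_upto_cst.
Qed.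

End SmoothFunctions.

Section SmoothStep.
Context {R : realType}.
Implicit Types f g : R -> R.

Lemma MVT_everywhere f f' (a b : R) : a < b ->
  (forall x, is_derive x (1 : R) f (f' x)) ->
  exists2 c, a < c < b & f b - f a = f' c * (b - a).
Proof.
move=> ab df; have [|c cab ->] := @MVT R f f' a b ab (fun x _ => df x).
  exact: continuous_subspaceT (is_derive_continuous df).
by exists c => //; move: cab; rewrite in_itv.
Qed.

Lemma antiderivative f : continuous f -> (forall x, x <= 0 -> f x = 0) ->
  exists F, (forall x, is_derive x (1 : R) F (f x)) /\
            (forall x, x <= 0 -> F x = 0).
Proof.
move=> cf f0.
pose F x := (\int[lebesgue_measure]_(t in `[-1, x]) f t)%R.
have F0 x : x <= 0 -> F x = 0.
  move=> x0; rewrite /F (@eq_Rintegral _ _ _ _ _ (cst 0)); last first.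
    by move=> t; rewrite inE /= in_itv/= => /andP[_ tx]; apply: f0; exact: le_trans x0.
  by rewrite Rintegral_cst// mul0r.
exists F; split=> // x; have [x0|x0] := ltP x 0.
  have E : \forall y \near x, (cst (0 : R)) y = F y.
    near=> y; rewrite F0//; apply: ltW; near: y; exact: lt_nbhsl.
  apply: is_derive_eq (near_eq_is_derive E (is_derive_cst (0:R) x 1)) _.
  by rewrite f0// ltW.
have fint : lebesgue_measure.-integrable `[-1, x + 1] (EFin \o f).
  apply: continuous_compact_integrable; first exact: segment_compact.
  exact: continuous_subspaceT.
have x1 : x < x + 1 by rewrite ltrDl.
have x2 : -1 < x by rewrite (lt_le_trans _ x0).
have [dF eF] := continuous_FTC1_closed x1 fint x2 (cf x).
by rewrite -eF derive1E; exact: DeriveDef.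
Unshelve. all: by end_near. Qed.

(** The derivative is recorded together with the step because the test
    functions below are built from both. *)
Definition is_smooth_step (S s : R -> R) :=
  [/\ smooth S, smooth s, forall x, is_derive x (1 : R) S (s x),
      forall x, 0 <= s x
    & [/\ forall x, x <= 0 -> S x = 0, forall x, 1 <= x -> S x = 1,
          forall x, x <= 0 -> s x = 0 & forall x, 1 <= x -> s x = 0]].

(** Normalise an antiderivative of the bump [flat 0 x * flat 0 (1 - x)]. *)
Lemma smooth_step_exists : exists S s : R -> R, is_smooth_step S s.
Proof.
pose b (x : R) := flat 0 x * flat 0 (-1 * x + 1).
have sb : smooth b.
  move=> n; apply: smooth_uptoM; first exact: smooth_flat.
  exact/smooth_upto_affine/smooth_flat.
have b0 x : x <= 0 -> b x = 0.
  by move=> x0; rewrite /b {1}/flat ltNge x0 mul0r.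
have b1 x : 1 <= x -> b x = 0.
  by move=> x1; rewrite /b {2}/flat mulN1r addrC subr_gt0 ltNge x1 mulr0.
have bge0 x : 0 <= b x by rewrite mulr_ge0// flat_ge0.
have bgt0 x : 0 < x < 1 -> 0 < b x.
  case/andP=> x0 x1; rewrite /b /flat x0 mulN1r addrC subr_gt0 x1.
  by rewrite !expr0 !divr1 mulr_gt0// expR_gt0.
have [F [dF F0]] := antiderivative (smooth_continuous sb) b0.
have F1 : 0 < F 1.
  have [c c01] := MVT_everywhere ltr01 dF.
  by rewrite (F0 0)// !subr0 mulr1 => ->; exact: bgt0.
have sF : smooth F.
  by case=> [|n]; [exact: is_derive_continuous dF|exists b; split].
have F1' x : 1 <= x -> F x = F 1.
  rewrite le_eqVlt => /predU1P[<-//|x1].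
  have [c /andP[c1 _] /eqP] := MVT_everywhere x1 dF.
  by rewrite b1 ?mul0r ?subr_eq0 ?(ltW c1)// => /eqP.
exists (fun x => (F 1)^-1 * F x), (fun x => (F 1)^-1 * b x); split.
- by move=> n; apply: smooth_uptoM => //; exact: smooth_upto_cst.
- by move=> n; apply: smooth_uptoM => //; exact: smooth_upto_cst.
- by move=> x; exact: (is_deriveZ _ (dF x)).
- by move=> x; rewrite mulr_ge0// invr_ge0 ltW.
split=> x hx.
- by rewrite (F0 x)// mulr0.
- by rewrite (F1' x)// mulVf// gt_eqF.
- by rewrite (b0 x)// mulr0.
- by rewrite (b1 x)// mulr0.
Qed.

Lemma smooth_step_bounds S s : is_smooth_step S s -> forall x, 0 <= S x <= 1.
Proof.
case=> _ _ dS s0 [S0 S1 _ _] x.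
have ndS y z : y < z -> S y <= S z.
  move=> yz; have [c _] := MVT_everywhere yz dS.
  by rewrite -subr_ge0 => ->; rewrite mulr_ge0// subr_ge0 ltW.
have [x0|x0] := leP x 0; first by rewrite S0// lexx ler01.
have [x1|x1] := leP 1 x; first by rewrite S1// lexx ler01.
by rewrite -(S0 _ (lexx 0)) ndS//= -(S1 _ (lexx 1)) ndS.
Qed.

End SmoothStep.

(** * Partial derivatives and product test functions *)

Section PlaneSlices.
Context {R : realType}.

Let is_derive_quotient (V W : normedModType R) (f : V -> R) (a v : V)
    (g : W -> R) (b w : W) (d : R) :
  (fun h : R => h^-1 *: ((f \o shift a) (h *: v) - f a)) =
  (fun h : R => h^-1 *: ((g \o shift b) (h *: w) - g b)) ->
  is_derive a v f d -> is_derive b w g d.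
Proof.
move=> E [cf ef]; split; first by move: cf; rewrite /derivable E.
by rewrite -ef /derive E.
Qed.

Lemma is_derive_slice1 (u : R * R -> R) (z : R * R) (d : R) :
  is_derive z (e1 : R * R) u d <-> is_derive z.1 (1 : R) (fun x => u (x, z.2)) d.
Proof.
have E : (fun h : R => h^-1 *: ((u \o shift z) (h *: (e1 : R * R)) - u z)) =
    (fun h : R => h^-1 *: (((fun x => u (x, z.2)) \o shift z.1) (h *: (1 : R))
       - u (z.1, z.2))).
  apply/funext => h; congr (_ *: (_ - _)); last by case: z.
  rewrite /=; congr u; apply: injective_projections => //=.
  by rewrite scaler0 add0r.
split; apply: is_derive_quotient; rewrite E; by case: (z).
Qed.

Lemma is_derive_slice2 (u : R * R -> R) (z : R * R) (d : R) :
  is_derive z (e2 : R * R) u d <-> is_derive z.2 (1 : R) (fun y => u (z.1, y)) d.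
Proof.
have E : (fun h : R => h^-1 *: ((u \o shift z) (h *: (e2 : R * R)) - u z)) =
    (fun h : R => h^-1 *: (((fun y => u (z.1, y)) \o shift z.2) (h *: (1 : R))
       - u (z.1, z.2))).
  apply/funext => h; congr (_ *: (_ - _)); last by case: z.
  rewrite /=; congr u; apply: injective_projections => //=.
  by rewrite scaler0 add0r.
split; apply: is_derive_quotient; rewrite E; by case: (z).
Qed.

Lemma is_derive_tensor (f f' g g' : R -> R) (z : R * R) :
  (forall x, is_derive x (1 : R) f (f' x)) ->
  (forall x, is_derive x (1 : R) g (g' x)) ->
  is_derive z (e1 : R * R) (fun w => f w.1 * g w.2) (f' z.1 * g z.2) /\
  is_derive z (e2 : R * R) (fun w => f w.1 * g w.2) (f z.1 * g' z.2).
Proof.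
move=> df dg; split.
  apply/is_derive_slice1 => /=.
  have := is_deriveM (df z.1) (is_derive_cst (g z.2) z.1 1).
  by move=> H; apply: is_derive_eq H _; rewrite scaler0 add0r /GRing.scale/= mulrC.
apply/is_derive_slice2 => /=.
have := is_deriveM (is_derive_cst (f z.1) z.2 1) (dg z.2).
by move=> H; apply: is_derive_eq H _; rewrite scaler0 addr0.
Qed.

Lemma continuous_tensor (f g : R -> R) : continuous f -> continuous g ->
  continuous (fun z : R * R => f z.1 * g z.2).
Proof.
move=> cf cg z; apply: cvgM.
  apply: (@continuous_comp _ _ _ fst f); [exact: cvg_fst|exact: cf].
apply: (@continuous_comp _ _ _ snd g); [exact: cvg_snd|exact: cg].
Qed.

Lemma C_n_tensor n (f g : R -> R) : smooth f -> smooth g ->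
  C_n n (fun z : R * R => f z.1 * g z.2).
Proof.
elim: n f g => [|n IH] f g sf sg; split=> //;
  try by apply: continuous_tensor; exact: smooth_continuous.
have [f' [sf' df]] := smooth_derivative sf.
have [g' [sg' dg]] := smooth_derivative sg.
have D z := is_derive_tensor z df dg.
split.
- by move=> z; have [[? ?] [? ?]] := D z; split.
- rewrite (_ : 'D_ _ _ = fun z => f' z.1 * g z.2); first exact: IH.
  by apply/funext => z; have [[_ <-] _] := D z.
- rewrite (_ : 'D_ _ _ = fun z => f z.1 * g' z.2); first exact: IH.
  by apply/funext => z; have [_ [_ <-]] := D z.
Qed.

(** Products of functions of one variable are all the test functions needed:
    they separate the variables in the Fubini arguments below. *)
Lemma test_function_tensor (Om : set (R * R)) (f g : R -> R) (a b c d : R) :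
  smooth f -> smooth g ->
  (forall x, ~~ (a <= x <= b) -> f x = 0) ->
  (forall y, ~~ (c <= y <= d) -> g y = 0) ->
  `[a, b]%classic `*` `[c, d]%classic `<=` Om ->
  test_function Om (fun z => f z.1 * g z.2).
Proof.
move=> sf sg f0 g0 BOm.
have cB : compact (`[a, b]%classic `*` `[c, d]%classic).
  by apply: compact_setX; exact: segment_compact.
have sB : closure [set z : R * R | f z.1 * g z.2 != 0]
    `<=` `[a, b]%classic `*` `[c, d]%classic.
  rewrite closureEbigcap; apply: bigcap_inf; split.
    by apply: compact_closed => //; exact: norm_hausdorff.
  move=> [x y] /=; rewrite mulf_eq0 negb_or => /andP[fx gy].
  rewrite !in_itv /=; split.
    by apply/negPn/negP => /f0 /eqP; rewrite (negbTE fx).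
  by apply/negPn/negP => /g0 /eqP; rewrite (negbTE gy).
split; first by move=> n; exact: C_n_tensor.
  by apply: subclosed_compact sB => //; exact: closed_closure.
exact: subset_trans sB BOm.
Qed.

End PlaneSlices.

(** * Integrals on the line *)

Section AlmostEverywhere.
Context d {T : measurableType d} {R : realType}.
Variable mu : {measure set T -> \bar R}.
Implicit Types P Q S : T -> Prop.

Lemma aeS P Q : (forall x, P x -> Q x) ->
  {ae mu, forall x, P x} -> {ae mu, forall x, Q x}.
Proof. by move=> PQ; apply: filterS => //; exact: ae_filter_ringOfSetsType. Qed.

Lemma aeS2 P Q S : (forall x, P x -> Q x -> S x) ->
  {ae mu, forall x, P x} -> {ae mu, forall x, Q x} -> {ae mu, forall x, S x}.
Proof. by move=> PQ; apply: filterS2 => //; exact: ae_filter_ringOfSetsType. Qed.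

End AlmostEverywhere.

Section LineIntegrals.
Context {R : realType}.
Local Notation mu := (@lebesgue_measure R).
Implicit Types (f g v : R -> R) (a b c d p q : R).

Lemma integrable_patch (A : set R) f : measurable A ->
  mu.-integrable A (EFin \o f) -> mu.-integrable setT (EFin \o (f \_ A)).
Proof. by move=> mA; rewrite integrable_mkcond// restrict_EFin. Qed.

Lemma integrable_sub_itv a b f (i : interval R) :
  mu.-integrable `[a, b] (EFin \o f) -> [set` i] `<=` `[a, b]%classic ->
  mu.-integrable [set` i] (EFin \o f).
Proof. by move=> fi iab; apply: integrableS fi. Qed.

Lemma ae_derive_integral a b f : mu.-integrable `[a, b] (EFin \o f) ->
  {ae mu, forall x, x \in `]a, b[ ->
    is_derive x (1 : R) (fun x => \int[mu]_(t in `[a, x]) f t) (f x)}.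
Proof.
move=> fi; pose g := f \_ `[a, b].
have gi : mu.-integrable setT (EFin \o g) by exact: integrable_patch.
have lg : locally_integrable setT g.
  by apply: open_integrable_locally => //; exact: openT.
have giS y : mu.-integrable [set` Interval (BLeft a) (BRight y)] (EFin \o g).
  exact: integrableS gi.
apply: aeS (FTC1 giS lg) => x H; rewrite in_itv/= => /andP[ax xb].
have [|dg eg] := H _; first by rewrite lte_fin.
have <- : g x = f x by rewrite /g patchE ifT// inE/= in_itv/= !ltW.
rewrite -eg derive1E.
apply: near_eq_is_derive (DeriveDef dg (erefl _)).
near=> y; apply: eq_Rintegral => t; rewrite inE/= in_itv/= => /andP[at_ ty].
rewrite /g patchE ifT// inE/= in_itv/= at_ (le_trans ty)// ltW//.
by near: y; exact: lt_nbhsl.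
Unshelve. all: by end_near. Qed.

Lemma Rintegral_itv_diff a b f p q : mu.-integrable `[a, b] (EFin \o f) ->
  a <= p -> p <= q -> q <= b ->
  \int[mu]_(t in `[a, q]) f t - \int[mu]_(t in `[a, p]) f t
  = \int[mu]_(t in `]p, q]) f t.
Proof.
move=> fi ap pq qb; apply: Rintegral_itvB; rewrite ?bnd_simp//.
by apply: integrable_sub_itv fi _; apply: subset_itvl; rewrite bnd_simp.
Qed.

(** The indefinite integral is locally constant, and it has the integrand as
    its derivative almost everywhere. *)
Lemma ae_eq0_of_integral_itv a b f : mu.-integrable `[a, b] (EFin \o f) ->
  (forall p q, a < p -> p < q -> q < b -> \int[mu]_(t in `]p, q]) f t = 0) ->
  {ae mu, forall x, x \in `]a, b[ -> f x = 0}.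
Proof.
move=> fi f0; apply: aeS (ae_derive_integral fi) => x H xab.
have := H xab; move: xab; rewrite in_itv/= => /andP[ax xb] Df.
have E : \forall y \near x, (cst (\int[mu]_(t in `[a, x]) f t)) y =
    \int[mu]_(t in `[a, y]) f t.
  near=> y => /=; have ay : a < y by near: y; exact: lt_nbhsr.
  have yb : y < b by near: y; exact: lt_nbhsl.
  apply/eqP; rewrite -subr_eq0; have [xy|xy|->] := ltgtP x y.
  - by rewrite -opprB (@Rintegral_itv_diff a b)// ?ltW// f0// oppr0.
  - by rewrite (@Rintegral_itv_diff a b)// ?ltW// f0.
  - by rewrite subrr.
have [_ <-] := Df.
by have [_ <-] := near_eq_is_derive E (is_derive_cst _ x 1).
Unshelve. all: by end_near. Qed.

End LineIntegrals.

Section RealIntegrals.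
Context d {T : measurableType d} {R : realType}.
Variable mu : {measure set T -> \bar R}.
Implicit Types (A : set T) (f g h : T -> R).

Lemma integrable_measurable A f :
  mu.-integrable A (EFin \o f) -> measurable_fun A f.
Proof. by move/measurable_int => /measurable_EFinP. Qed.

Lemma integrable_mul_bounded A f h (M : R) : measurable A ->
  mu.-integrable A (EFin \o f) -> measurable_fun A h ->
  (forall x, A x -> `|h x| <= M) ->
  mu.-integrable A (EFin \o (fun x => f x * h x)).
Proof.
move=> mA fi mh hM.
apply: eq_integrable (integrableMl mA fi mh _) => //.
exists M; split; first exact: num_real.
by move=> y My x Ax /=; rewrite (le_trans (hM x Ax))// ltW.
Qed.

Lemma integrable_dominated A f h : measurable A -> measurable_fun A f ->
  mu.-integrable A (EFin \o h) -> (forall x, A x -> `|f x| <= h x) ->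
  mu.-integrable A (EFin \o f).
Proof.
move=> mA mf hi fh; apply: le_integrable hi => //; first exact/measurable_EFinP.
by move=> x Ax /=; rewrite lee_fin (le_trans (fh x Ax))// ler_norm.
Qed.

Lemma integrable_add A f g : measurable A ->
  mu.-integrable A (EFin \o f) -> mu.-integrable A (EFin \o g) ->
  mu.-integrable A (EFin \o (fun x => f x + g x)).
Proof. by move=> mA fi gi; have := integrableD mA fi gi. Qed.

Lemma integrable_sub A f g : measurable A ->
  mu.-integrable A (EFin \o f) -> mu.-integrable A (EFin \o g) ->
  mu.-integrable A (EFin \o (fun x => f x - g x)).
Proof. by move=> mA fi gi; have := integrableB mA fi gi. Qed.

Lemma integrable_scale A f (r : R) : measurable A ->
  mu.-integrable A (EFin \o f) -> mu.-integrable A (EFin \o (fun x => r * f x)).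
Proof. by move=> mA fi; have := integrableZl mA r fi. Qed.

Lemma RintegralN A f : measurable A -> mu.-integrable A (EFin \o f) ->
  \int[mu]_(x in A) - f x = - \int[mu]_(x in A) f x.
Proof.
move=> mA fi; under eq_Rintegral do rewrite -mulN1r.
by rewrite RintegralZl// mulN1r.
Qed.

Lemma Rintegral_mul_le A f h (e : R) : measurable A ->
  mu.-integrable A (EFin \o f) -> measurable_fun A h ->
  (forall x, A x -> `|h x| <= e) ->
  `|\int[mu]_(x in A) (f x * h x)| <= e * \int[mu]_(x in A) `|f x|.
Proof.
move=> mA fi mh he.
have fni : mu.-integrable A (EFin \o (fun x => `|f x|)) by exact: integrable_norm.
have fhi := integrable_mul_bounded mA fi mh he.
apply: le_trans (le_normr_Rintegral mA fhi) _.
rewrite -RintegralZl//; apply: le_Rintegral => //.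
- exact: integrable_norm.
- exact: (integrableZl mA e fni).
- by move=> x Ax; rewrite normrM mulrC ler_wpM2r// he.
Qed.

Lemma Rdominated_cvg A (f_ : nat -> T -> R) f g : measurable A ->
  (forall n, measurable_fun A (f_ n)) ->
  (forall x, A x -> f_ n x @[n --> \oo] --> f x) ->
  mu.-integrable A (EFin \o g) ->
  (forall n x, A x -> `|f_ n x| <= g x) ->
  \int[mu]_(x in A) f_ n x @[n --> \oo] --> \int[mu]_(x in A) f x.
Proof.
move=> mA mf ff gi fg; apply: fine_cvg.
have mflim : measurable_fun A f.
  exact: (@measurable_fun_cvg _ _ _ A f_).
have fi : mu.-integrable A (EFin \o f).
  apply: (integrable_dominated mA mflim gi) => x Ax.
  have H : `|f_ n x| @[n --> \oo] --> `|f x| by apply: cvg_norm; exact: ff.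
  rewrite -(cvg_lim _ H)//.
  by apply: limr_le; [exact: cvgP H|apply: nearW => n; exact: fg].
rewrite fineK; last exact: integrable_fin_num.
apply: (@dominated_cvg _ _ _ mu A mA (fun n => EFin \o f_ n) (EFin \o f) (EFin \o g)) => //.
- by move=> n; apply/measurable_EFinP.
- by move=> x Ax; apply: cvg_EFin; [exact: nearW|exact: ff].
Qed.

Lemma eq_Rintegral_ae A f g : measurable A ->
  mu.-integrable A (EFin \o f) -> mu.-integrable A (EFin \o g) ->
  {ae mu, forall x, A x -> f x = g x} ->
  \int[mu]_(x in A) f x = \int[mu]_(x in A) g x.
Proof.
move=> mA fi gi fg; congr fine; apply: ae_eq_integral => //.
- by move/measurable_int : fi.
- by move/measurable_int : gi.
- by apply: aeS fg => x H Ax; congr EFin; exact: H.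
Qed.

End RealIntegrals.

(** * Approximate unit masses and indicator functions *)

Section Cutoffs.
Context {R : realType}.
Local Notation mu := (@lebesgue_measure R).
Implicit Types (f g u v : R -> R) (a b c d p q : R).

Lemma continuous_integrable_itv a b f : {within `[a, b], continuous f} ->
  mu.-integrable `[a, b] (EFin \o f).
Proof. by move=> cf; apply: continuous_compact_integrable => //; exact: segment_compact. Qed.

Lemma eq_Rintegral_line (A : set R) g f : (forall x, A x -> f x = g x) ->
  \int[mu]_(x in A) f x = \int[mu]_(x in A) g x.
Proof. by move=> fg; apply: eq_Rintegral => x; rewrite inE; exact: fg. Qed.

Lemma Rintegral_FTC2 F f a b : a <= b -> (forall x, is_derive x (1 : R) F (f x)) ->
  continuous f -> \int[mu]_(x in `[a, b]) f x = F b - F a.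
Proof.
rewrite le_eqVlt => /predU1P[-> _ _|ab dF cf].
  by rewrite set_itv1 Rintegral_set1 subrr.
have cF := is_derive_continuous dF.
rewrite /Rintegral (@continuous_FTC2 _ f F)//.
- exact: continuous_subspaceT.
- split.
  + by move=> x _; case: (dF x).
  + exact/cvg_at_right_filter/cF.
  + exact/cvg_at_left_filter/cF.
- by move=> x _; rewrite derive1E; case: (dF x).
Qed.

Lemma is_derive_affine_comp f f' (k p : R) :
  (forall x, is_derive x (1 : R) f (f' x)) ->
  forall x, is_derive x (1 : R) (fun x => f (k * (x - p))) (k * f' (k * (x - p))).
Proof.
move=> df x.
have D : is_derive x (1 : R) (fun x => k * (x - p)) k.
  have H := is_deriveB (is_derive_id x (1 : R)) (is_derive_cst p x 1).
  have := is_deriveZ k H; rewrite subr0 /GRing.scale /= mulr1; exact.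
by have := is_derive1_comp (df _) D; rewrite mulrC.
Qed.

Lemma smooth_affine_comp f (k p : R) : smooth f -> smooth (fun x => f (k * (x - p))).
Proof.
move=> sf n; rewrite (_ : (fun _ => _) = fun x => f (k * x + - (k * p))).
  exact: smooth_upto_affine.
by apply/funext => x; rewrite mulrBr.
Qed.

Lemma smooth_affine_measurable f (k p : R) (A : set R) : smooth f ->
  measurable_fun A (fun x => f (k * (x - p))).
Proof.
move=> sf; apply: measurable_funTS; apply: continuous_measurable_fun.
exact: smooth_continuous (smooth_affine_comp k p sf).
Qed.

Variables (S s : R -> R).
Hypothesis Ss : is_smooth_step S s.

(** The derivative of a steep step at [p] is an approximate unit mass. *)
Lemma cvg_steep_step a b p u : {within `[a, b], continuous u} -> a < p < b ->
  \int[mu]_(x in `[a, b]) (u x * (n.+1%:R * s (n.+1%:R * (x - p))))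
    @[n --> \oo] --> u p.
Proof.
case: Ss => sS ss dS s0 [S0 S1 s0' s1'] cu /andP[ap pb].
apply/cvgrPdist_le => /= e e0.
have pab : p \in `]a, b[ by rewrite in_itv/= ap.
have cup : {for p, continuous u}.
  have ab : a < b by exact: lt_trans pb.
  by have [H _ _] := (continuous_within_itvP u ab).1 cu; exact: H.
have /cvgrPdist_le /(_ _ e0) [r /= r0 Hr] : u x @[x --> p] --> u p by exact: cup.
have bp : 0 < b - p by rewrite subr_gt0.
near=> n; set k := n.+1%:R.
have k0 : 0 < k by rewrite ltr0n.
have kr : k^-1 < r.
  by rewrite /k; near: n; exact: (near_infty_natSinv_lt (PosNum r0)).
have kb : k^-1 < b - p.
  by rewrite /k; near: n; exact: (near_infty_natSinv_lt (PosNum bp)).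
have csk : continuous (fun x => k * s (k * (x - p))).
  apply: smooth_continuous => m; apply: smooth_uptoM; first exact: smooth_upto_cst.
  exact: smooth_affine_comp.
have mass : \int[mu]_(x in `[a, b]) (k * s (k * (x - p))) = 1.
  have ab : a <= b by rewrite ltW// (lt_trans ap).
  rewrite (Rintegral_FTC2 ab (is_derive_affine_comp k p dS) csk).
  rewrite S1 ?S0 ?subr0//; first by rewrite pmulr_rle0// subr_le0 ltW.
  by rewrite mulrC -ler_pdivrMr// mul1r ltW.
have isk := continuous_integrable_itv (continuous_subspaceT csk : {within `[a, b], continuous _}).
have iu := continuous_integrable_itv cu.
have mcu := integrable_measurable iu.
have H1 : mu.-integrable `[a, b] (EFin \o (fun x => u x * (k * s (k * (x - p))))).
  apply: continuous_integrable_itv => x; apply: cvgM; [exact: cu|].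
  exact: (continuous_subspaceT csk).
have -> : u p - \int[mu]_(x in `[a, b]) (u x * (k * s (k * (x - p)))) =
    \int[mu]_(x in `[a, b]) ((u p - u x) * (k * s (k * (x - p)))).
  rewrite -[X in X - _]mulr1 -mass -RintegralZl// -RintegralB//; last first.
    exact: (integrableZl _ (u p) isk).
  by apply: eq_Rintegral => x _; rewrite mulrBl.
pose h x := if s (k * (x - p)) == 0 then 0 else u p - u x.
have mh : measurable_fun `[a, b] h.
  apply: measurable_fun_if => //.
  - by apply: measurable_fun_eqr => //; exact: smooth_affine_measurable.
  - apply: measurable_funB => //; exact: measurable_funS mcu.
rewrite (@eq_Rintegral_line _ (fun x => (k * s (k * (x - p))) * h x)); last first.
  by move=> x _; rewrite /h mulrC; case: eqP => // ->; rewrite mulr0 !mul0r.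
apply: le_trans (Rintegral_mul_le _ isk mh (_ : forall x, _ -> `|h x| <= e)) _ => //.
  move=> x _; rewrite /h; case: eqP => [_|/eqP sx]; first by rewrite normr0 ltW.
  apply: Hr => /=; have x0 : 0 < x - p.
    by rewrite ltNge; apply: contraNN sx => x0; rewrite s0'// pmulr_rle0.
  have x1 : k * (x - p) < 1.
    by rewrite ltNge; apply: contraNN sx => x1; rewrite s1'.
  rewrite distrC gtr0_norm// (lt_trans _ kr)//.
  by rewrite -(@ltr_pM2l _ k)// mulfV// gt_eqF.
rewrite (@eq_Rintegral_line _ (fun x => k * s (k * (x - p)))) ?mass ?mulr1//.
by move=> x _; rewrite ger0_norm// mulr_ge0// ltW.
Unshelve. all: by end_near. Qed.

Lemma cvg_step_indic p x : S (n.+1%:R * (x - p)) @[n --> \oo] -->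
  (if p < x then 1 else 0 : R).
Proof.
case: Ss => _ _ _ _ [S0 S1 _ _]; case: ifPn => [px|]; last first.
  rewrite -leNgt => xp; rewrite (_ : (fun _ => _) = cst 0); first exact: cvg_cst.
  by apply/funext => n; rewrite S0// mulr_ge0_le0// subr_le0.
have xp : 0 < x - p by rewrite subr_gt0.
apply: cvg_near_cst; near=> n; apply: S1.
rewrite mulrC -ler_pdivrMr// mul1r ltW//.
by near: n; exact: (near_infty_natSinv_lt (PosNum xp)).
Unshelve. all: by end_near. Qed.

(** The differences of steep steps converge boundedly to the indicator
    function of ]p, q]. *)
Lemma cvg_plateau a b p q v : mu.-integrable `[a, b] (EFin \o v) ->
  a <= p -> p <= q -> q <= b ->
  \int[mu]_(x in `[a, b])
     (v x * (S (n.+1%:R * (x - p)) - S (n.+1%:R * (x - q))))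
    @[n --> \oo] --> \int[mu]_(x in `]p, q]) v x.
Proof.
move=> vi ap pq qb; have SB := smooth_step_bounds Ss.
case: (Ss) => sS _ _ _ _.
have -> : \int[mu]_(x in `]p, q]) v x =
    \int[mu]_(x in `[a, b]) (v x * ((if p < x then 1 else 0) - (if q < x then 1 else 0))).
  rewrite (_ : `]p, q] = `[a, b] `&` `]p, q])%classic; last first.
    rewrite setIidr//; apply: subset_itv; rewrite bnd_simp//.
  rewrite Rintegral_mkcondr; apply: eq_Rintegral => x _.
  rewrite patchE; case: ifPn; rewrite ?inE ?notin_setE /= in_itv/=.
    by move=> /andP[-> xq]; rewrite ltNge xq/= subr0 mulr1.
  move=> /negP; rewrite negb_and -leNgt -ltNge => /orP[xp|qx].
    by rewrite ltNge xp/= ltNge (le_trans xp pq)/= subr0 mulr0.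
  by rewrite qx (le_lt_trans pq qx) subrr mulr0.
have mS (k r : R) : measurable_fun `[a, b] (fun x => S (k * (x - r))).
  exact: smooth_affine_measurable.
have mv := integrable_measurable vi.
apply: (@Rdominated_cvg _ _ R mu `[a, b]
  (fun n (x : R) => v x * (S (n.+1%:R * (x - p)) - S (n.+1%:R * (x - q))))
  (fun x : R => v x * ((if p < x then 1 else 0) - (if q < x then 1 else 0)))
  (fun x : R => `|v x|)) => //.
- by move=> n; apply: (measurable_funM mv (measurable_funB (mS _ _) (mS _ _))).
- move=> x _; apply: cvgM; first exact: cvg_cst.
  by apply: cvgB; exact: cvg_step_indic.
- exact: integrable_norm.
- move=> n x _; rewrite normrM ler_piMr// ler_norml.
  have /andP[? ?] := SB (n.+1%:R * (x - p)).
  have /andP[? ?] := SB (n.+1%:R * (x - q)).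
  by apply/andP; split; lra.
Qed.

End Cutoffs.

(** * Measurability and Fubini in the plane *)

Section PlaneMeasure.
Context {R : realType}.
Local Notation mu := (@lebesgue_measure R).
Local Notation mu2 := (plane_measure R).
Implicit Types (u v F : R * R -> R) (z : R * R).

Definition box (a b c d : R) : set (R * R) := `[a, b]%classic `*` `[c, d]%classic.

Definition swap_plane z : R * R := (z.2, z.1).

Lemma boxP (a b c d : R) z : box a b c d z <-> a <= z.1 <= b /\ c <= z.2 <= d.
Proof. by rewrite /box /= !in_itv. Qed.

Lemma compact_box (a b c d : R) : compact (box a b c d).
Proof. by apply: compact_setX; exact: segment_compact. Qed.

Lemma measurable_box (a b c d : R) :
  measurable (box a b c d : set (measurableTypeR R * measurableTypeR R)).
Proof. by apply: measurableX; exact: measurable_itv. Qed.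

Lemma open_plane_measurable (V : set (R * R)) : open V ->
  measurable (V : set (measurableTypeR R * measurableTypeR R)).
Proof.
move=> oV.
pose Q (q : rat * rat * (rat * rat)) : set (R * R) :=
  `]ratr q.1.1, ratr q.1.2[%classic `*` `]ratr q.2.1, ratr q.2.2[%classic.
pose F q := if `[< Q q `<=` V >] then Q q else set0.
have -> : V = \bigcup_q F q.
  apply/seteqP; split=> [[x y] Vxy|z [q _]]; last first.
    by rewrite /F; case: asboolP => // H; exact: H.
  have [e /= e0 He] : exists2 e : R, 0 < e & ball (x, y) e `<=` V.
    have /nbhs_ballP[e /= e0 H] : nbhs (x, y) V by exact: open_nbhs_nbhs.
    by exists e.
  have rats (t : R) : exists q : rat * rat,
      [/\ t - e < ratr q.1, ratr q.1 < t, t < ratr q.2 & ratr q.2 < t + e].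
    have [|q1] := @rat_in_itvoo R (t - e) t; first by rewrite ltrBlDr ltrDl.
    have [|q2] := @rat_in_itvoo R t (t + e); first by rewrite ltrDl.
    by rewrite !in_itv/= => /andP[? ?] /andP[? ?]; exists (q1, q2).
  have [[q1 q2] /= [q11 q12 q21 q22]] := rats x.
  have [[r1 r2] /= [r11 r12 r21 r22]] := rats y.
  have QV : Q ((q1, q2), (r1, r2)) `<=` V; last first.
    exists ((q1, q2), (r1, r2)) => //; rewrite /F; case: asboolP => // _.
    by rewrite /Q /= !in_itv/= q12 q21 r12.
  move=> [s t]; rewrite /Q /= !in_itv/= => -[/andP[s1 s2] /andP[t1 t2]].
  apply: He; split; rewrite /= /ball/= ltr_norml; apply/andP; split; lra.
apply: countable_bigcupT_measurable; first exact: countableP.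
move=> q; rewrite /F; case: asboolP => // _.
by apply: measurableX; exact: measurable_itv.
Qed.

Lemma continuous_plane_measurable (A : set (R * R)) u :
  measurable (A : set (measurableTypeR R * measurableTypeR R)) ->
  (forall z, A z -> {for z, continuous u}) ->
  measurable_fun (A : set (measurableTypeR R * measurableTypeR R)) u.
Proof.
move=> mA cu; apply: (measurability _ (RGenOpens.measurableE R)) => _ [_ [p [q ->] <-]].
set V := `]p, q[%classic; have oV : open V by exact: itv_open.
rewrite (_ : _ `&` _ = A `&` (u @^-1` V)°).
  by apply: measurableI => //; apply: open_plane_measurable; exact: open_interior.
apply/seteqP; split=> z [Az Vz]; split=> //; last exact: interior_subset.
by apply: (cu z Az); exact: open_nbhs_nbhs.
Qed.

Lemma continuous_slice2 u (x y : R) :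
  {for (x, y), continuous u} -> {for y, continuous (fun y => u (x, y))}.
Proof.
move=> cu; apply: (@continuous_comp _ _ _ (fun y => (x, y)) u) => //.
rewrite /prop_for /continuous_at; exact: (cvg_pair (cvg_cst x) cvg_id).
Qed.

End PlaneMeasure.

Section Fubini.
Context {R : realType}.
Local Notation mu := (@lebesgue_measure R).
Local Notation mu2 := (plane_measure R).
Implicit Types (u v F : R * R -> R) (z : R * R).

Lemma integrable_ae_eq d (T : measurableType d) (nu : {measure set T -> \bar R})
    (f g : T -> \bar R) :
  nu.-integrable setT f -> measurable_fun setT g ->
  {ae nu, forall x, f x = g x} -> nu.-integrable setT g.
Proof.
move=> fi mg fg; apply/integrableP; split=> //.
have mf := measurable_int _ fi.
rewrite (_ : (\int[nu]_(x in _) `|g x|)%E = (\int[nu]_(x in setT) `|f x|)%E).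
  by case/integrableP : fi.
apply: ge0_ae_eq_integral => //; [exact: measurableT_comp|exact: measurableT_comp|].
by apply: aeS fg => x -> _.
Qed.

Lemma plane_integrable_swap F : mu2.-integrable setT (EFin \o F) ->
  mu2.-integrable setT (EFin \o (F \o swap_plane)).
Proof.
move=> iF; have mF := measurable_int _ iF.
have mFs : measurable_fun [set: measurableTypeR R * measurableTypeR R]
    (EFin \o (F \o swap_plane)).
  by rewrite (_ : EFin \o _ = (EFin \o F) \o swap_plane)//;
    exact: (measurableT_comp mF (@measurable_swap _ _ (measurableTypeR R) (measurableTypeR R))).
apply/(integrable12ltyP _ _ mFs).
by have /(integrable21ltyP _ _ mF) := iF.
Qed.

Lemma plane_integral_swap F : mu2.-integrable setT (EFin \o F) ->
  \int[mu2]_z F (swap_plane z) = \int[mu2]_z F z.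
Proof.
move=> iF; congr fine.
have := integral12_prod_meas1 (plane_integrable_swap iF) => <-.
by have := integral21_prod_meas1 iF => <-.
Qed.

Lemma plane_fubini F : mu2.-integrable setT (EFin \o F) ->
  [/\ {ae mu, forall x, mu.-integrable setT (EFin \o (fun y => F (x, y)))},
      mu.-integrable setT (EFin \o (fun x => \int[mu]_y F (x, y))) &
      \int[mu2]_z F z = \int[mu]_x \int[mu]_y F (x, y)].
Proof.
move=> iF; have aeF := ae_integrable1 iF.
have iI := integrable_fubini_F iF.
have fin : {ae mu, forall x, fubini_F mu (EFin \o F) x =
    (\int[mu]_y F (x, y))%:E}.
  apply: aeS aeF => x ix; rewrite /fubini_F /Rintegral fineK//.
  exact: integrable_fin_num.
have iI' : mu.-integrable setT (EFin \o (fun x => \int[mu]_y F (x, y))).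
  apply: (integrable_ae_eq iI) fin; apply/measurable_EFinP.
  exact: measurableT_comp (measurable_fubini_F iF).
split=> //.
rewrite /Rintegral -(integral12_prod_meas1 iF); congr fine.
apply: ae_eq_integral => //.
- exact: measurable_int iI.
- exact: measurable_int iI'.
- by apply: aeS fin => x Hx _.
Qed.

Lemma ae_swap (P : R * R -> Prop) : {ae mu2, forall z, P z} ->
  {ae mu2, forall z, P (swap_plane z)}.
Proof.
move=> [N [mN N0 PN]].
have msw := @measurable_swap _ _ (measurableTypeR R) (measurableTypeR R).
have mNs : measurable (swap_plane @^-1` N : set (measurableTypeR R * measurableTypeR R)).
  by rewrite -[X in measurable X]setTI; exact: msw.
have E (A : set (measurableTypeR R * measurableTypeR R)) : measurable A ->
    mu2 A = (\int[mu2]_z (\1_A z)%:E)%E.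
  by move=> mA; rewrite integral_indic// setIT.
have mI (A : set (measurableTypeR R * measurableTypeR R)) : measurable A ->
    measurable_fun setT (fun z => (\1_A z)%:E : \bar R).
  by move=> mA; apply/measurable_EFinP; exact: measurable_indic.
exists (swap_plane @^-1` N); split=> //.
- rewrite -[RHS]N0 !E// /plane_measure.
  have pos (A : set (measurableTypeR R * measurableTypeR R)) z :
    (0 <= (\1_A z)%:E :> \bar R)%E by rewrite lee_fin.
  have := @fubini_tonelli2 _ _ _ _ R mu mu _ (mI _ mNs) (pos _).
  by have := @fubini_tonelli1 _ _ _ _ R mu mu _ (mI _ mN) (pos _) => -> ->.
- by move=> z; apply: (PN (swap_plane z)).
Qed.

Lemma ae_countable d (T : measurableType d) (nu : {measure set T -> \bar R})
    (I : countType) (P : I -> T -> Prop) :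
  (forall i, {ae nu, forall x, P i x}) -> {ae nu, forall x, forall i, P i x}.
Proof.
move=> HP; have : {ae nu, forall x, forall n : nat,
    if unpickle n is Some i then P i x else True}.
  apply: ae_foralln => n; case: unpickle => [i|]; first exact: HP.
  exact: aeW.
by apply: aeS => x H i; have := H (pickle i); rewrite pickleK.
Qed.

End Fubini.

(** * Weak derivatives and absolute continuity on lines *)

Section LineReconstruction.
Context {R : realType}.
Local Notation mu := (@lebesgue_measure R).
Implicit Types (f g u v : R -> R) (a b c d p q : R).

Lemma within_continuous_eps (A : set R) f (t e : R) :
  {within A, continuous f} -> A t -> 0 < e ->
  exists2 r : R, 0 < r & forall t', A t' -> `|t - t'| < r -> `|f t - f t'| < e.
Proof.
move=> cf At e0; have := cf t.
move/cvgrPdist_lt => /(_ e e0).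
rewrite /prop_near1 /nbhs /= -(nbhs_subspace_in At).
by case=> r /= r0 H; exists r => // t' At' tt'; exact: H.
Qed.

Lemma continuous_itv_within a b f : (forall x, a <= x <= b -> {for x, continuous f}) ->
  {within `[a, b], continuous f}.
Proof.
move=> cf; apply: continuous_in_subspaceT => x; rewrite inE /= in_itv /=.
exact: cf.
Qed.

(** Rational endpoints suffice for a continuous function; they keep the
    exceptional sets below countable in number. *)
Lemma eq_const_of_rat c d f : c < d -> {within `[c, d], continuous f} ->
  (forall p q : rat, c < ratr p -> ratr p < ratr q :> R -> ratr q < d ->
     f (ratr p) = f (ratr q)) ->
  forall p q, c <= p <= d -> c <= q <= d -> f p = f q.
Proof.
move=> cd cf fE; have [r0] := rat_in_itvoo cd; rewrite in_itv/= => /andP[cr0 r0d].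
suff H p : c <= p <= d -> f p = f (ratr r0) by move=> p q /H -> /H ->.
move=> /andP[cp pd]; apply/eqP; rewrite -subr_eq0 -normr_eq0; apply/negPn/negP => ne.
have e0 : 0 < `|f p - f (ratr r0)| by rewrite lt_neqAle eq_sym ne normr_ge0.
have pcd : `[c, d]%classic p by rewrite /= in_itv/= cp.
have [r rpos Hr] := within_continuous_eps cf pcd e0.
have [q] : exists q : rat, (ratr q : R) \in `](Num.max c (p - r)), (Num.min d (p + r))[.
  apply: rat_in_itvoo; rewrite gt_max !lt_min; lra.
rewrite in_itv/= gt_max lt_min => /andP[/andP[cq pq] /andP[qd qp]].
have qcd : `[c, d]%classic (ratr q) by rewrite /= in_itv/= !ltW.
have := Hr _ qcd; have -> : f (ratr q) = f (ratr r0).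
  have [qr|qr|->//] := ltgtP (ratr q : R) (ratr r0); first exact: fE.
  by apply/esym/fE.
rewrite ltxx => /(_ _) F; suff: false by []; apply: F.
by rewrite ltr_norml; apply/andP; split; lra.
Qed.

Variables (S s : R -> R).
Hypothesis Ss : is_smooth_step S s.

Definition plateau n p q y := S (n.+1%:R * (y - p)) - S (n.+1%:R * (y - q)).
Definition plateau' n p q y :=
  n.+1%:R * s (n.+1%:R * (y - p)) - n.+1%:R * s (n.+1%:R * (y - q)).

Lemma smooth_plateau n p q : smooth (plateau n p q).
Proof.
case: Ss => sS _ _ _ _ k.
rewrite (_ : plateau n p q =
    fun y => S (n.+1%:R * (y - p)) + (-1) * S (n.+1%:R * (y - q))).
  by apply: smooth_uptoD; [|apply: smooth_uptoM; [exact: smooth_upto_cst|]];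
    exact: smooth_affine_comp.
by apply/funext => y; rewrite mulN1r.
Qed.

Lemma smooth_plateau' n p q : smooth (plateau' n p q).
Proof.
case: Ss => _ ss _ _ _ k.
rewrite (_ : plateau' n p q =
    fun y => n.+1%:R * s (n.+1%:R * (y - p)) + (- n.+1%:R) * s (n.+1%:R * (y - q))).
  by apply: smooth_uptoD; apply: smooth_uptoM; first exact: smooth_upto_cst;
    try (exact: smooth_affine_comp); exact: smooth_upto_cst.
by apply/funext => y; rewrite mulNr.
Qed.

Lemma is_derive_plateau n p q y :
  is_derive y (1 : R) (plateau n p q) (plateau' n p q y).
Proof.
case: Ss => _ _ dS _ _.
by have := is_deriveB (is_derive_affine_comp n.+1%:R p dS y)
                      (is_derive_affine_comp n.+1%:R q dS y).
Qed.

Lemma plateau_support n p q c d y : c <= p -> p <= q -> q + n.+1%:R^-1 <= d ->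
  ~~ (c <= y <= d) -> plateau n p q y = 0.
Proof.
case: Ss => _ _ _ _ [S0 S1 _ _] cp pq qd.
have n0 : 0 < n.+1%:R :> R by rewrite ltr0n.
rewrite negb_and -!ltNge => /orP[yc|dy]; rewrite /plateau.
  rewrite !S0 ?subrr// pmulr_rle0// subr_le0; last exact/ltW/(lt_le_trans yc).
  by apply/ltW/(lt_le_trans yc)/(le_trans cp).
have H t : t <= q -> 1 <= n.+1%:R * (y - t).
  move=> tq; rewrite mulrC -ler_pdivrMr// mul1r lerBrDl.
  by rewrite (le_trans _ (ltW dy))// (le_trans _ qd)// lerD2r.
by rewrite !S1 ?subrr//; exact: H.
Qed.

Lemma plateau_bound n p q y : `|plateau n p q y| <= 1.
Proof.
have SB := smooth_step_bounds Ss.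
have /andP[? ?] := SB (n.+1%:R * (y - p)).
have /andP[? ?] := SB (n.+1%:R * (y - q)).
by rewrite /plateau ler_norml; apply/andP; split; lra.
Qed.

(** The derivatives of the plateaus converge to the difference of the unit
    masses at [p] and [q], and the plateaus to the indicator of ]p, q]. *)
Lemma integral_of_weak_derivative c d p q u v :
  (forall y, c <= y <= d -> {for y, continuous u}) ->
  mu.-integrable `[c, d] (EFin \o v) -> c < p -> p < q -> q < d ->
  (forall n, q + n.+1%:R^-1 <= d ->
    \int[mu]_(y in `[c, d]) (u y * plateau' n p q y + v y * plateau n p q y) = 0) ->
  u q - u p = \int[mu]_(y in `]p, q]) v y.
Proof.
move=> cu vi cp pq qd H.
have cuw := continuous_itv_within cu.
have pcd : c < p < d by rewrite cp (lt_trans pq).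
have qcd : c < q < d by rewrite qd (lt_trans cp).
have Lp := cvg_steep_step Ss cuw pcd.
have Lq := cvg_steep_step Ss cuw qcd.
have Lv := cvg_plateau Ss vi (ltW cp) (ltW pq) (ltW qd).
have fltr : Filter (\oo : set_system nat) by exact: eventually_filter.
have L := cvgD (cvgB Lp Lq) Lv.
have csk n t : {within `[c, d], continuous (fun x => u x * (n.+1%:R * s (n.+1%:R * (x - t))))}.
  have cst : continuous (fun x => n.+1%:R * s (n.+1%:R * (x - t))).
    case: Ss => _ ss _ _ _.
    apply: smooth_continuous => m; apply: smooth_uptoM; first exact: smooth_upto_cst.
    exact: smooth_affine_comp.
  by move=> x; apply: cvgM; [exact: cuw|exact: (continuous_subspaceT cst)].
have Z : 0 = u p - u q + \int[mu]_(x in `]p, q]) v x.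
  rewrite -(cvg_lim (@norm_hausdorff _ _) (L fltr fltr)); apply/esym/cvg_lim => //.
  apply: cvg_near_cst; have dq : 0 < d - q by rewrite subr_gt0.
  near=> n.
  have nq : q + n.+1%:R^-1 <= d.
    rewrite -lerBrDl ltW//; near: n; exact: (near_infty_natSinv_lt (PosNum dq)).
  rewrite -[RHS](H n nq) !fctE.
  rewrite -RintegralB//; [|exact: continuous_integrable_itv..].
  rewrite -RintegralD//.
  - by apply: eq_Rintegral_line => x _; rewrite (mulrBr (u x)).
  - apply: continuous_integrable_itv => x.
    by apply: cvgB; exact: csk.
  - apply: (integrable_mul_bounded (M := 1)) => //.
      apply: measurable_funTS; apply: continuous_measurable_fun.
      exact: smooth_continuous (smooth_plateau n p q).
    by move=> x _; exact: plateau_bound.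
lra.
Unshelve. all: by end_near. Qed.

End LineReconstruction.

Section AbsoluteContinuityOnLines.
Context {R : realType}.
Local Notation mu := (@lebesgue_measure R).
Local Notation mu2 := (plane_measure R).
Implicit Types (u v F : R * R -> R) (z : R * R) (a b c d : R).

Lemma box_measure_lty a b c d : (mu2 (box a b c d) < +oo)%E.
Proof.
have -> : mu2 (box a b c d) = (mu `[a, b]%classic * mu `[c, d]%classic)%E.
  exact: product_measure1E.
by rewrite !lebesgue_measure_itv /=; do 2 case: ifP => _;
  rewrite ?mul0e ?mule0// -!EFinD -EFinM ltry.
Qed.

Lemma continuous_bounded_on (T : topologicalType) (K : set T) (h : T -> R) :
  compact K -> (forall t, K t -> {for t, continuous h}) ->
  exists2 M : R, 0 < M & forall t, K t -> `|h t| <= M.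
Proof.
move=> cK ch.
have ch' : {within K, continuous h}.
  by apply: continuous_in_subspaceT => z; rewrite inE; exact: ch.
have [M [_ HM]] := compact_bounded (continuous_compact ch' cK).
exists (`|M| + 1); first by rewrite ltr_wpDl.
move=> z Kz; apply: (HM (`|M| + 1)); last by exists z.
by rewrite (le_lt_trans (ler_norm _))// ltrDl.
Qed.

Lemma continuous_box_integrable a b c d u :
  (forall z, box a b c d z -> {for z, continuous u}) ->
  mu2.-integrable (box a b c d) (EFin \o u).
Proof.
move=> cu; have [M _ HM] := continuous_bounded_on (@compact_box R a b c d) cu.
have mB := @measurable_box R a b c d.
apply: measurable_bounded_integrable => //.
- exact: box_measure_lty.
- exact: continuous_plane_measurable.
- exists M; split; first exact: num_real.
  by move=> y My z Bz /=; rewrite (le_trans (HM z Bz))// ltW.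
Qed.

Lemma plane_integrable_patch (A : set (R * R)) F :
  measurable (A : set (measurableTypeR R * measurableTypeR R)) ->
  mu2.-integrable A (EFin \o F) <-> mu2.-integrable setT (EFin \o (F \_ A)).
Proof. by move=> mA; rewrite integrable_mkcond// restrict_EFin. Qed.

Lemma box_fubini a b c d F : mu2.-integrable (box a b c d) (EFin \o F) ->
  [/\ {ae mu, forall x, x \in `[a, b] ->
         mu.-integrable `[c, d] (EFin \o (fun y => F (x, y)))},
      mu.-integrable `[a, b] (EFin \o (fun x => \int[mu]_(y in `[c, d]) F (x, y))) &
      \int[mu2]_(z in box a b c d) F z =
        \int[mu]_(x in `[a, b]) \int[mu]_(y in `[c, d]) F (x, y)].
Proof.
have mB := @measurable_box R a b c d.
move=> /(plane_integrable_patch _ mB) iF.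
have [aeF iI FE] := plane_fubini iF.
have E1 x : x \in `[a, b] -> (fun y => (F \_ (box a b c d)) (x, y)) =
    (fun y => F (x, y)) \_ `[c, d].
  move=> xab; apply/funext => y; rewrite !patchE; congr (if _ then _ else _).
  apply/idP/idP; rewrite !inE; first by case.
  by move=> ycd; split.
have E2 : (fun x => \int[mu]_y (F \_ (box a b c d)) (x, y)) =
    (fun x => \int[mu]_(y in `[c, d]) F (x, y)) \_ `[a, b].
  apply/funext => x; rewrite patchE; case: ifPn; rewrite ?inE ?notin_setE => xab.
    by rewrite [RHS]Rintegral_mkcond -E1.
  rewrite (@eq_Rintegral_line _ _ (cst 0)); first by rewrite Rintegral_cst// mul0r.
  move=> y _; rewrite patchE ifF//; apply/negbTE; rewrite notin_setE.
  by case.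
split.
- apply: aeS aeF => x + xab; rewrite E1// -restrict_EFin.
  by rewrite -integrable_mkcond.
- by move: iI; rewrite E2 -restrict_EFin -integrable_mkcond.
- by rewrite Rintegral_mkcond FE [RHS]Rintegral_mkcond E2.
Qed.

(** Weak differentiability tested on products only, the form in which one
    variable can be frozen. *)
Definition weak_d2_on_box u v a b c d := forall f g g' : R -> R,
  smooth f -> smooth g -> smooth g' -> (forall y, is_derive y (1 : R) g (g' y)) ->
  (forall x, ~~ (a <= x <= b) -> f x = 0) ->
  (forall y, ~~ (c <= y <= d) -> g y = 0) ->
  \int[mu2]_(z in box a b c d) (u z * (f z.1 * g' z.2) + v z * (f z.1 * g z.2)) = 0.

Lemma measurable_fst_comp (f : R -> R) (A : set (R * R)) : continuous f ->
  measurable (A : set (measurableTypeR R * measurableTypeR R)) ->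
  measurable_fun (A : set (measurableTypeR R * measurableTypeR R)) (fun z => f z.1).
Proof.
move=> cf mA; apply: continuous_plane_measurable => // z _.
by apply: continuous_comp; [exact: cvg_fst|exact: cf].
Qed.

Lemma measurable_snd_comp (f : R -> R) (A : set (R * R)) : continuous f ->
  measurable (A : set (measurableTypeR R * measurableTypeR R)) ->
  measurable_fun (A : set (measurableTypeR R * measurableTypeR R)) (fun z => f z.2).
Proof.
move=> cf mA; apply: continuous_plane_measurable => // z _.
by apply: continuous_comp; [exact: cvg_snd|exact: cf].
Qed.


Section WithStep.
Variables (S s : R -> R).
Hypothesis Ss : is_smooth_step S s.

Let ae_section_weak a b c d u v n p q : a < b ->
  (forall z, box a b c d z -> {for z, continuous u}) ->
  mu2.-integrable (box a b c d) (EFin \o v) ->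
  weak_d2_on_box u v a b c d ->
  c < p -> p < q -> q + n.+1%:R^-1 <= d ->
  {ae mu, forall x, x \in `]a, b[ ->
    \int[mu]_(y in `[c, d]) (u (x, y) * plateau' s n p q y
                             + v (x, y) * plateau S n p q y) = 0}.
Proof.
move=> ab cu vi weak cp pq qd.
pose F z := u z * plateau' s n p q z.2 + v z * plateau S n p q z.2.
have mB := @measurable_box R a b c d.
have cp' := smooth_continuous (smooth_plateau' Ss n p q).
have cp0 := smooth_continuous (smooth_plateau Ss n p q).
have iF : mu2.-integrable (box a b c d) (EFin \o F).
  apply: (integrable_add mB).
    apply: continuous_box_integrable => z Bz; apply: cvgM; first exact: cu.
    by apply: continuous_comp; [exact: cvg_snd|exact: cp'].
  apply: (integrable_mul_bounded (M := 1) mB vi).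
    exact: measurable_snd_comp.
  by move=> z _; exact: (plateau_bound Ss).
have [_ iw _] := box_fubini iF.
apply: (ae_eq0_of_integral_itv iw) => p' q' ap' pq' qb'.
have L := cvg_plateau Ss iw (ltW ap') (ltW pq') (ltW qb').
rewrite -(cvg_lim (@norm_hausdorff _ _) L); apply/cvg_lim => //.
apply: cvg_near_cst; have bq : 0 < b - q' by rewrite subr_gt0.
near=> m.
have mq : q' + m.+1%:R^-1 <= b.
  rewrite -lerBrDl ltW//; near: m; exact: (near_infty_natSinv_lt (PosNum bq)).
have cf := smooth_continuous (smooth_plateau Ss m p' q').
have iFf : mu2.-integrable (box a b c d) (EFin \o (fun z => F z * plateau S m p' q' z.1)).
  apply: (integrable_mul_bounded (M := 1) mB iF); first exact: measurable_fst_comp.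
  by move=> z _; exact: (plateau_bound Ss).
have [_ _ FE] := box_fubini iFf.
have := weak _ _ _ (smooth_plateau Ss m p' q') (smooth_plateau Ss n p q)
  (smooth_plateau' Ss n p q) (is_derive_plateau Ss n p q)
  (fun x => plateau_support Ss (ltW ap') (ltW pq') mq)
  (fun x => plateau_support Ss (ltW cp) (ltW pq) qd).
rewrite (_ : Rintegral _ _ _ =
    \int[mu2]_(z in box a b c d) (F z * plateau S m p' q' z.1)); last first.
  apply: eq_Rintegral => z _; rewrite /F; ring.
rewrite FE => <-.
have [aeF _ _] := box_fubini iF.
have [_ iw' _] := box_fubini iFf.
apply: (@eq_Rintegral_ae _ _ _ mu) => //.
  apply: (integrable_mul_bounded (M := 1) _ iw) => //.
    apply: measurable_funTS; exact: continuous_measurable_fun.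
  by move=> x _; exact: (plateau_bound Ss).
apply: aeS aeF => x iFx xab /=.
by rewrite RintegralZr//; exact: iFx.
Unshelve. all: by end_near. Qed.

(** Testing with a plateau over a rational interval in [y] times an arbitrary
    plateau in [x] gives the fundamental theorem between rational ordinates for
    almost every [x]; continuity extends it to all ordinates. *)
Lemma absolutely_continuous_on_lines a b c d u v : a < b -> c < d ->
  (forall z, box a b c d z -> {for z, continuous u}) ->
  mu2.-integrable (box a b c d) (EFin \o v) ->
  weak_d2_on_box u v a b c d ->
  {ae mu, forall x, x \in `]a, b[ ->
    mu.-integrable `[c, d] (EFin \o (fun y => v (x, y))) /\
    forall p q, c <= p -> p <= q -> q <= d ->
      u (x, q) - u (x, p) = \int[mu]_(y in `]p, q]) v (x, y)}.
Proof.
move=> ab cd cu vi weak.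
have [aev _ _] := box_fubini vi.
have W : {ae mu, forall x, forall i : nat * (rat * rat), x \in `]a, b[ ->
    c < ratr i.2.1 -> ratr i.2.1 < ratr i.2.2 :> R ->
    ratr i.2.2 + i.1.+1%:R^-1 <= d ->
    \int[mu]_(y in `[c, d]) (u (x, y) * plateau' s i.1 (ratr i.2.1) (ratr i.2.2) y
       + v (x, y) * plateau S i.1 (ratr i.2.1) (ratr i.2.2) y) = 0}.
  apply: ae_countable => -[n [p q]] /=.
  have [cp|_] := ltP c (ratr p); last by apply: aeW.
  have [pq|_] := ltP (ratr p : R) (ratr q); last by apply: aeW.
  have [qd|_] := leP (ratr q + n.+1%:R^-1) d; last by apply: aeW.
  by apply: aeS (ae_section_weak ab cu vi weak cp pq qd) => x H xab _ _ _; exact: H.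
apply: aeS2 aev W => x ivx Wx xab.
have xab' : x \in `[a, b] by move: xab; rewrite !in_itv/= => /andP[? ?]; rewrite !ltW.
have {}ivx := ivx xab'; split=> // p q cp pq qd.
have cux y : c <= y <= d -> {for y, continuous (fun y => u (x, y))}.
  move=> ycd; apply: continuous_slice2; apply: cu; apply/boxP; split=> //=.
have cV := parameterized_integral_continuous (ltW cd) ivx.
pose f y := u (x, y) - \int[mu]_(t in `[c, y]) v (x, t).
have cf : {within `[c, d], continuous f}.
  move=> y; apply: cvgB; last exact: cV.
  exact: (continuous_itv_within cux).
have fE : f p = f q.
  apply: (eq_const_of_rat cd cf); last 2 first.
  - by rewrite cp (le_trans pq).
  - by rewrite qd (le_trans cp).
  move=> r1 r2 cr1 r12 r2d; rewrite /f.
  have := integral_of_weak_derivative Ss cux ivx cr1 r12 r2d (fun n nd =>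
    Wx (n, (r1, r2)) xab cr1 r12 nd).
  by rewrite -(Rintegral_itv_diff ivx (ltW cr1) (ltW r12) (ltW r2d)); lra.
move: fE; rewrite /f -(Rintegral_itv_diff ivx cp pq qd); lra.
Qed.

End WithStep.

End AbsoluteContinuityOnLines.

Section SobolevOnLines.
Context {R : realType}.
Local Notation mu := (@lebesgue_measure R).
Local Notation mu2 := (plane_measure R).
Implicit Types (u v F : R * R -> R) (z : R * R) (a b c d : R) (Om : set (R * R)).

Lemma null_of_slices (A : set (measurableTypeR R * measurableTypeR R)) :
  measurable A ->
  {ae mu, forall x, {ae mu, forall y, ~ A (x, y)}} -> mu2 A = 0%E.
Proof.
move=> mA Ax; rewrite /plane_measure /= /product_measure1.
rewrite (_ : integral _ _ _ = (\int[mu]_x (cst 0%E x))%E); last first.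
  apply: ge0_ae_eq_integral => //.
    exact: measurable_fun_xsection.
  apply: aeS Ax => x [N [mN N0 AN]] _ /=.
  apply/eqP; rewrite eq_le measure_ge0 andbT -N0.
  apply: le_measure; rewrite ?inE//; first exact: measurable_xsection.
  by move=> y; rewrite /xsection /= inE => Axy; apply: AN => /=; apply.
by rewrite integral_cst// mul0e.
Qed.

Lemma derivative_zero_off (f f' : R -> R) (a b : R) :
  (forall x, is_derive x (1 : R) f (f' x)) ->
  (forall x, ~~ (a <= x <= b) -> f x = 0) ->
  forall x, ~~ (a <= x <= b) -> f' x = 0.
Proof.
move=> df f0 x xab.
have E : \forall y \near x, (cst (0 : R)) y = f y.
  move: xab; rewrite negb_and -!ltNge => /orP[xa|bx].
    near=> y; rewrite f0//; apply/nandP; left; rewrite -ltNge.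
    by near: y; exact: lt_nbhsl.
  near=> y; rewrite f0//; apply/nandP; right; rewrite -ltNge.
  by near: y; exact: lt_nbhsr.
have [_ <-] := df x.
by have [_ <-] := near_eq_is_derive E (is_derive_cst _ x 1).
Unshelve. all: by end_near. Qed.

Lemma Rintegral_support (A B : set (R * R)) F : B `<=` A ->
  (forall z, ~ B z -> F z = 0) ->
  \int[mu2]_(z in A) F z = \int[mu2]_(z in B) F z.
Proof.
move=> BA F0; rewrite Rintegral_mkcond [RHS]Rintegral_mkcond; congr Rintegral.
apply/funext => z; rewrite !patchE.
case: ifPn => Az; case: ifPn => // Bz; move: Az Bz; rewrite ?inE ?notin_setE => Az Bz.
- exact: F0.
- by have := BA _ Bz.
Qed.

Lemma weak_partial_box2 Om u v a b c d : box a b c d `<=` Om ->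
  (forall z, Om z -> {for z, continuous u}) ->
  weak_partial Om e2 u v ->
  mu2.-integrable (box a b c d) (EFin \o v) /\ weak_d2_on_box u v a b c d.
Proof.
move=> BOm cu [_ Lv W]; have iv := Lv _ (@compact_box R a b c d) BOm.
split=> // f g g' sf sg sg' dg f0 g0.
have g'0 := derivative_zero_off dg g0.
have := W _ (test_function_tensor sf sg f0 g0 BOm).
have [f' [_ df]] := smooth_derivative sf.
have DE z : 'D_e2 (fun z : R * R => f z.1 * g z.2) z = f z.1 * g' z.2.
  by have [_ [_ <-]] := is_derive_tensor z df dg.
have off z (h : R -> R) : (forall y, ~~ (c <= y <= d) -> h y = 0) ->
    ~ box a b c d z -> f z.1 * h z.2 = 0.
  move=> h0 /boxP nz; have [za|za] := boolP (a <= z.1 <= b); last by rewrite f0// mul0r.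
  have [zc|zc] := boolP (c <= z.2 <= d); last by rewrite h0// mulr0.
  by case: nz.
rewrite (@Rintegral_support Om (box a b c d)) //; last first.
  by move=> z nz; rewrite DE (off z g')// mulr0.
rewrite (@Rintegral_support Om (box a b c d)) //; last first.
  by move=> z nz; rewrite (off z g)// mulr0.
move=> H; have mB := @measurable_box R a b c d.
rewrite RintegralD//.
- rewrite -[X in _ + X]opprK -H; apply/eqP; rewrite subr_eq0; apply/eqP.
  by apply: eq_Rintegral => z _; rewrite DE.
- apply: continuous_box_integrable => z Bz; apply: cvgM; first exact/cu/BOm.
  exact: (continuous_tensor (smooth_continuous sf) (smooth_continuous sg')).
- have cfg := continuous_tensor (smooth_continuous sf) (smooth_continuous sg).
  have [M _ HM] := continuous_bounded_on (@compact_box R a b c d) (fun z _ => cfg z).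
  apply: (integrable_mul_bounded mB iv _ HM).
  by apply: continuous_plane_measurable => // z _; exact: cfg.
Qed.

Lemma box_swap a b c d z : box c d a b (swap_plane z) <-> box a b c d z.
Proof. by rewrite !boxP /=; split=> -[]. Qed.

Lemma integrable_box_swap a b c d F :
  mu2.-integrable (box a b c d) (EFin \o F) ->
  mu2.-integrable (box c d a b) (EFin \o (F \o swap_plane)) /\
  \int[mu2]_(z in box c d a b) F (swap_plane z) = \int[mu2]_(z in box a b c d) F z.
Proof.
have mB p q r s := @measurable_box R p q r s.
move=> /(plane_integrable_patch _ (mB _ _ _ _)) iF.
have E : (F \_ (box a b c d)) \o swap_plane = (F \o swap_plane) \_ (box c d a b).
  apply/funext => z; rewrite /= !patchE; congr (if _ then _ else _).
  by apply/idP/idP; rewrite !inE => /box_swap.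
split.
  apply/(plane_integrable_patch _ (mB _ _ _ _)); rewrite -E.
  exact: plane_integrable_swap.
rewrite Rintegral_mkcond [RHS]Rintegral_mkcond -(plane_integral_swap iF).
by rewrite -[in LHS]E.
Qed.

Lemma continuous_swap_plane u z : {for swap_plane z, continuous u} ->
  {for z, continuous (u \o swap_plane)}.
Proof.
move=> cu; apply: continuous_comp => //.
rewrite /prop_for /continuous_at; exact: (cvg_pair cvg_snd cvg_fst).
Qed.

(** Reduction to [weak_partial_box2] by exchanging the variables. *)
Lemma weak_partial_box1 Om u v a b c d : box a b c d `<=` Om ->
  (forall z, Om z -> {for z, continuous u}) ->
  weak_partial Om e1 u v ->
  mu2.-integrable (box c d a b) (EFin \o (v \o swap_plane)) /\
  weak_d2_on_box (u \o swap_plane) (v \o swap_plane) c d a b.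
Proof.
move=> BOm cu [_ Lv W]; have iv := Lv _ (@compact_box R a b c d) BOm.
have [iv' _] := integrable_box_swap iv.
split=> // f g g' sf sg sg' dg f0 g0.
have g'0 := derivative_zero_off dg g0.
have := W _ (test_function_tensor sg sf g0 f0 BOm).
have [f' [_ df]] := smooth_derivative sf.
have DE z : 'D_e1 (fun z : R * R => g z.1 * f z.2) z = g' z.1 * f z.2.
  by have [[_ <-] _] := is_derive_tensor z dg df.
have off z (h : R -> R) : (forall y, ~~ (a <= y <= b) -> h y = 0) ->
    ~ box a b c d z -> h z.1 * f z.2 = 0.
  move=> h0 /boxP nz; have [za|za] := boolP (a <= z.1 <= b); last by rewrite h0// mul0r.
  have [zc|zc] := boolP (c <= z.2 <= d); last by rewrite f0// mulr0.
  by case: nz.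
rewrite (@Rintegral_support Om (box a b c d)) //; last first.
  by move=> z nz; rewrite DE (off z g')// mulr0.
rewrite (@Rintegral_support Om (box a b c d)) //; last first.
  by move=> z nz; rewrite (off z g)// mulr0.
move=> H; have mB := @measurable_box R a b c d.
have i1 : mu2.-integrable (box a b c d) (EFin \o (fun z => u z * (f z.2 * g' z.1))).
  apply: continuous_box_integrable => z Bz; apply: cvgM; first exact/cu/BOm.
  have := continuous_tensor (smooth_continuous sg') (smooth_continuous sf).
  by under [X in continuous X -> _]eq_fun do rewrite mulrC; apply.
have i2 : mu2.-integrable (box a b c d) (EFin \o (fun z => v z * (f z.2 * g z.1))).
  have cfg : continuous (fun z : R * R => f z.2 * g z.1).
    have := continuous_tensor (smooth_continuous sg) (smooth_continuous sf).
    by under [X in continuous X -> _]eq_fun do rewrite mulrC; apply.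
  have [M _ HM] := continuous_bounded_on (@compact_box R a b c d) (fun z _ => cfg z).
  apply: (integrable_mul_bounded mB iv _ HM).
  by apply: continuous_plane_measurable => // z _; exact: cfg.
have [_ S12] := integrable_box_swap (integrable_add mB i1 i2).
rewrite [LHS]S12 RintegralD//.
rewrite -[X in _ + X]opprK (_ : \int[mu2]_(z in box a b c d) (v z * _) =
  \int[mu2]_(z in box a b c d) (v z * (g z.1 * f z.2))); last first.
  by apply: eq_Rintegral => z _; rewrite (mulrC (f z.2)).
rewrite -H; apply/eqP; rewrite subr_eq0; apply/eqP.
by apply: eq_Rintegral => z _; rewrite DE (mulrC (f z.2)).
Qed.

End SobolevOnLines.

(** * Weak and classical partial derivatives *)

Section ClassicalPartials.
Context {R : realType}.
Local Notation mu := (@lebesgue_measure R).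
Local Notation mu2 := (plane_measure R).
Implicit Types (u v F : R * R -> R) (z : R * R) (a b c d : R) (Om : set (R * R)).

Definition ac_on_vertical_lines u v a b c d :=
  {ae mu, forall x, x \in `]a, b[ ->
    mu.-integrable `[c, d] (EFin \o (fun y => v (x, y))) /\
    forall p q, c <= p -> p <= q -> q <= d ->
      u (x, q) - u (x, p) = \int[mu]_(y in `]p, q]) v (x, y)}.

Lemma weak_partial_ac2 Om u v a b c d : a < b -> c < d -> box a b c d `<=` Om ->
  (forall z, Om z -> {for z, continuous u}) -> weak_partial Om e2 u v ->
  ac_on_vertical_lines u v a b c d.
Proof.
move=> ab cd BOm cu W; have [S [s Ss]] := @smooth_step_exists R.
have [iv W'] := weak_partial_box2 BOm cu W.
by apply: (absolutely_continuous_on_lines Ss) => // z Bz; apply/cu/BOm.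
Qed.

Lemma weak_partial_ac1 Om u v a b c d : a < b -> c < d -> box a b c d `<=` Om ->
  (forall z, Om z -> {for z, continuous u}) -> weak_partial Om e1 u v ->
  ac_on_vertical_lines (u \o swap_plane) (v \o swap_plane) c d a b.
Proof.
move=> ab cd BOm cu W; have [S [s Ss]] := @smooth_step_exists R.
have [iv W'] := weak_partial_box1 BOm cu W.
apply: (absolutely_continuous_on_lines Ss) => // z Bz.
by apply/continuous_swap_plane/cu/BOm/box_swap.
Qed.

Lemma is_derive_quotient_cvg (f : R -> R) (y l : R) : is_derive y (1 : R) f l ->
  n.+1%:R * (f (y + n.+1%:R^-1) - f y) @[n --> \oo] --> l.
Proof.
case; rewrite /derivable => /cvg_ex[/= l' Hl'] <-.
rewrite [X in _ --> X](_ : _ = l'); last first.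
  by apply: cvg_lim Hl'; exact: norm_hausdorff.
have e0 : n.+1%:R^-1 @[n --> \oo] --> (0 : R)^'.
  move=> A [r /= r0 HA].
  have : \forall n \near \oo, A n.+1%:R^-1; last by [].
  near=> n; apply: HA => //=.
  rewrite sub0r normrN gtr0_norm//.
  by near: n; exact: (near_infty_natSinv_lt (PosNum r0)).
have := cvg_comp _ _ e0 Hl'; apply: cvg_trans; apply: near_eq_cvg.
by apply: nearW => n /=; rewrite invrK /GRing.scale /= mulr1 (addrC y).
Unshelve. all: by end_near. Qed.

(** The difference quotients of [u] are jointly measurable, so the bad set
    where they do not converge to [v] is null as soon as almost all its
    vertical sections are. *)
Lemma ae_derive_vertical u v a b c d :
  (forall z, box a b c d z -> {for z, continuous u}) ->
  mu2.-integrable (box a b c d) (EFin \o v) ->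
  ac_on_vertical_lines u v a b c d ->
  {ae mu2, forall z, a < z.1 < b -> c < z.2 < d ->
    forall l, is_derive z (e2 : R * R) u l -> l = v z}.
Proof.
move=> cu iv AC; have mB := @measurable_box R a b c d.
pose uB := u \_ (box a b c d); pose vB := v \_ (box a b c d).
have muB : measurable_fun setT uB.
  have := (plane_integrable_patch u mB).1 (continuous_box_integrable cu).
  exact: integrable_measurable.
have mvB : measurable_fun setT vB.
  by have := (plane_integrable_patch v mB).1 iv; exact: integrable_measurable.
pose sh (n : nat) z := (z.1, z.2 + n.+1%:R^-1).
have msh n : measurable_fun setT (sh n : measurableTypeR R * measurableTypeR R -> measurableTypeR R * measurableTypeR R).
  apply: measurable_fun_pair; first exact: measurable_fst.
  by apply: measurable_funD; [exact: measurable_snd|exact: measurable_cst].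
pose h n z := `|n.+1%:R * (uB (sh n z) - uB z) - vB z|.
have mh n : measurable_fun setT (h n).
  apply: measurableT_comp => //; apply: measurable_funB => //.
  apply: measurable_funM => //; apply: measurable_funB => //.
  exact: (measurableT_comp muB (msh n)).
pose H z := limn_esup (fun n => (h n z)%:E).
have mH : measurable_fun setT H.
  apply: (@measurable_fun_limn_esup _ _ _ _ (fun n z => (h n z)%:E)) => n.
  exact/measurable_EFinP.
pose O : set (R * R) := `]a, b[%classic `*` `]c, d[%classic.
have mO : measurable (O : set (measurableTypeR R * measurableTypeR R)).
  by apply: measurableX; exact: measurable_itv.
have near0 z l : O z -> is_derive z (e2 : R * R) u l -> h n z @[n --> \oo] --> `|l - v z|.
  case: z => x y; rewrite /O /= !in_itv /= => -[/andP[ax xb] /andP[cy yd]].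
  move/is_derive_slice2 => /= dyu.
  have L := is_derive_quotient_cvg dyu.
  have E : \forall n \near \oo, `|n.+1%:R * (u (x, y + n.+1%:R^-1) - u (x, y)) - v (x, y)|
      = h n (x, y).
    have dy : 0 < d - y by rewrite subr_gt0.
    have B0 : box a b c d (x, y) by apply/boxP; rewrite /= !ltW.
    near=> n; have B1 : box a b c d (sh n (x, y)).
      apply/boxP; rewrite /= (ltW ax) (ltW xb); split=> //; apply/andP; split.
        by apply: ler_wpDr => //; exact: ltW.
      rewrite -lerBrDl ltW//; near: n; exact: (near_infty_natSinv_lt (PosNum dy)).
    by rewrite /h /uB /vB !patchE !mem_set.
  apply: cvg_trans (near_eq_cvg E) _; apply: cvg_norm; apply: cvgB => //.
  exact: cvg_cst.
pose A : set (R * R) := O `&` [set z | H z <> 0%E].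
have mA : measurable (A : set (measurableTypeR R * measurableTypeR R)).
  apply: measurableI => //.
  rewrite (_ : [set z | H z <> 0%E] = setT `&` H @^-1` (~` [set 0%E])).
    by apply: mH => //; apply: measurableC; exact: emeasurable_set1.
  by rewrite setTI.
have A0 : mu2 A = 0%E.
  apply: null_of_slices => //; apply: aeS AC => x Hx.
  have [xab|xab] := boolP (x \in `]a, b[); last first.
    by apply: aeW => y [[/= xab' _] _]; rewrite xab' in xab.
  have [ivx ux] := Hx xab.
  apply: aeS (ae_derive_integral ivx) => y Hy [[/= _ ycd] /=]; apply.
  have Hd : is_derive ((x, y) : R * R) (e2 : R * R) u (v (x, y)).
    apply/is_derive_slice2 => /=.
    have := is_deriveD (Hy ycd) (is_derive_cst (u (x, c)) y 1).
    rewrite addr0; apply: near_eq_is_derive.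
    near=> t; rewrite fctE.
    have ct : c <= t by apply: ltW; near: t; apply: lt_nbhsr; move: ycd; rewrite in_itv => /andP[].
    have td : t <= d by apply: ltW; near: t; apply: lt_nbhsl; move: ycd; rewrite in_itv => /andP[].
    have := ux _ _ (lexx c) ct td; rewrite -(Rintegral_itv_diff ivx)//.
    by rewrite set_itv1 Rintegral_set1 subr0 => <-; rewrite subrK.
  have Oxy : O (x, y) by split.
  have Lh : (h n (x, y))%:E @[n --> \oo] --> (0 : \bar R).
    have -> : 0%E = `|v (x, y) - v (x, y)|%:E by rewrite subrr normr0.
    by apply: cvg_EFin; [exact: nearW|exact: near0 Oxy Hd].
  by rewrite /H (cvg_limn_einf_sup Lh).2.
exists A; split=> // z /= /not_implyP[za /not_implyP[zc]].
move=> /existsNP[l /not_implyP[Dl lv]]; split.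
  by rewrite /O /= !in_itv /= za zc.
move=> /= Hz; apply: lv; have Oz : O z by rewrite /O /= !in_itv /= za zc.
have L1 := near0 z l Oz Dl.
have L0 : h n z @[n --> \oo] --> (0 : R).
  have H0 : (limn_esup (fun n => (h n z)%:E) <= 0)%E by rewrite -/(H z) Hz.
  have := limn_esup_le_cvg H0 (fun n => _).
  by move=> /(_ _)/fine_cvg; apply => n; rewrite lee_fin normr_ge0.
have : `|l - v z| = 0.
  by rewrite -(cvg_lim (@norm_hausdorff _ _) L1) (cvg_lim (@norm_hausdorff _ _) L0).
by move/eqP; rewrite normr_eq0 subr_eq0 => /eqP.
Unshelve. all: by end_near. Qed.

End ClassicalPartials.

(** * Calculus of indefinite integrals *)

Section AbsolutelyContinuousCalculus.
Context {R : realType}.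
Local Notation mu := (@lebesgue_measure R).
Implicit Types (f g u v w k : R -> R) (a b c d p q : R).

(** The compactness principle used for every uniform estimate along a curve:
    the constant may be enlarged, so finitely many local constants give one. *)
Lemma lebesgue_number a b (Q : R -> R -> R -> Prop) :
  (forall M M' s t, M <= M' -> Q M s t -> Q M' s t) ->
  (forall x, a <= x <= b -> exists2 r : R, 0 < r & exists M : R, forall s t : R,
     a <= s <= b -> a <= t <= b -> `|s - x| < r -> `|t - x| < r -> Q M s t) ->
  exists2 r : R, 0 < r & exists M : R, forall s t : R,
     a <= s <= b -> a <= t <= b -> `|s - t| < r -> Q M s t.
Proof.
move=> Qmono loc.
pose P (r x : R) := forall s t, a <= s <= b -> a <= t <= b ->
  `|s - x| < r -> `|t - x| < r -> Q r^-1 s t.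
have := @segment_compact R a b => /compact_near_coveringP.
move=> /(_ R (0^'+) P _) H.
have : \forall r \near 0^'+, `[a, b]%classic `<=` P r.
  apply: H => x; rewrite /= in_itv/= => xab.
  have [r0 r00 [M HM]] := loc x xab.
  have r02 : 0 < r0 / 2 by rewrite divr_gt0.
  exists (ball x (r0 / 2), [set r | 0 < r < Num.min (r0 / 2) (`|M| + 1)^-1]).
    split; first exact: nbhsx_ballx.
    have m0 : 0 < Num.min (r0 / 2) (`|M| + 1)^-1.
      by rewrite lt_min r02 invr_gt0 ltr_wpDl.
    exists (Num.min (r0 / 2) (`|M| + 1)^-1) => //= r.
    rewrite /ball_/= sub0r normrN => rm rpos; rewrite rpos.
    exact: le_lt_trans (ler_norm r) rm.
  move=> [x' r] /= [xx' /andP[rpos]]; rewrite lt_min => /andP[rr0 rM] s t sab tab sx tx.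
  apply: (@Qmono M).
    rewrite (le_trans (ler_norm M))// (@le_trans _ _ (`|M| + 1)) ?lerDl//.
    by rewrite -[leLHS]invrK ltW// ltf_pV2// posrE ?invr_gt0// ltr_wpDl.
  move: xx'; rewrite /ball /= => xx'.
  apply: HM => //; rewrite (le_lt_trans (ler_distD x' _ _))// (splitr r0) ltrD//.
  - exact: lt_trans rr0.
  - by rewrite distrC.
  - exact: lt_trans rr0.
  - by rewrite distrC.
move=> [r /= r0 Hr]; have r20 : 0 < r / 2 by rewrite divr_gt0.
have Pr : `[a, b]%classic `<=` P (r / 2).
  by apply: Hr => //=; rewrite sub0r normrN gtr0_norm// ltr_pdivrMr// mulr_natr mulr2n ltrDl.
exists (r / 2) => //; exists (r / 2)^-1 => s t sab tab st.
have tI : `[a, b]%classic t by rewrite /= in_itv.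
by apply: (Pr t tI) => //; rewrite subrr normr0.
Unshelve. all: by end_near. Qed.

Lemma uniformly_continuous_itv a b f e : {within `[a, b], continuous f} -> 0 < e ->
  exists2 r : R, 0 < r & forall s t, a <= s <= b -> a <= t <= b -> `|s - t| < r ->
    `|f s - f t| < e.
Proof.
move=> cf e0.
have [//|x xab|r r0 [_ H]] := @lebesgue_number a b (fun _ s t => `|f s - f t| < e).
  have e20 : 0 < e / 2 by rewrite divr_gt0.
  have xI : `[a, b]%classic x by rewrite /= in_itv.
  have [r r0 Hr] := within_continuous_eps cf xI e20.
  exists r => //; exists 0 => s t sab tab sx tx.
  rewrite (le_lt_trans (ler_distD (f x) _ _))// (splitr e) ltrD//.
  - by rewrite distrC; apply: Hr; rewrite /= ?in_itv//= distrC.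
  - by apply: Hr; rewrite /= ?in_itv//= distrC.
by exists r.
Qed.

(** A function whose increments over short intervals are negligible compared
    with those of a fixed function is constant. *)
Lemma constant_of_small_increments f w a b : a <= b ->
  (forall e : R, 0 < e -> exists2 r : R, 0 < r & forall s t, a <= s -> s <= t -> t <= b ->
     t - s < r -> `|f t - f s| <= e * (w t - w s)) ->
  f b = f a.
Proof.
move=> ab H.
have K e : 0 < e -> `|f b - f a| <= e * (w b - w a).
  move=> e0; have [r r0 Hr] := H e e0.
  pose h (N : nat) := (b - a) / N.+1%:R.
  have [N hN] : exists N, h N < r.
    have L : h n @[n --> \oo] --> (b - a) * 0.
      by apply: cvgM; [exact: cvg_cst|exact: cvg_harmonic].
    move: L; rewrite mulr0 => /cvgrPdist_lt/(_ r r0)[N _ HN].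
    exists N; have := HN N (leqnn N); rewrite /= sub0r normrN ger0_norm//.
    by rewrite divr_ge0// subr_ge0.
  have h0 : 0 <= h N by rewrite divr_ge0// subr_ge0.
  have hNb : N.+1%:R * h N = b - a by rewrite /h mulrC divfK.
  have I (i : nat) : (i <= N.+1)%N -> `|f (a + i%:R * h N) - f a| <=
      e * (w (a + i%:R * h N) - w a).
    elim: i => [_|i IH iN]; first by rewrite mul0r addr0 !subrr normr0 mulr0.
    rewrite (le_trans (ler_distD (f (a + i%:R * h N)) _ _))//.
    rewrite -(subrK (w (a + i%:R * h N)) (w (a + _))) -addrA mulrDr lerD//.
      apply: Hr.
      - by rewrite lerDl mulr_ge0.
      - by rewrite lerD2l ler_wpM2r// ler_nat.
      - rewrite -lerBrDl -hNb ler_wpM2r// ler_nat//.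
      - by rewrite opprD addrACA subrr add0r -mulrBl -natrB// subSnn mul1r.
    by apply: IH; exact: ltnW.
  by have := I N.+1 (leqnn _); rewrite hNb subrKC.
apply/eqP; rewrite -subr_eq0 -normr_eq0; apply/negPn/negP => ne.
have e0 : 0 < `|f b - f a| by rewrite lt_neqAle eq_sym ne normr_ge0.
have D1 := K _ ltr01; rewrite mul1r in D1.
have D0 : 0 < w b - w a by exact: lt_le_trans D1.
have := K (`|f b - f a| / (w b - w a) / 2).
rewrite !divr_gt0// => /(_ isT).
by rewrite mulrAC divfK ?gt_eqF//; lra.
Qed.

(** The integral form of absolute continuity. *)
Definition is_primitive a b u v :=
  mu.-integrable `[a, b] (EFin \o v) /\
  forall p q, a <= p -> p <= q -> q <= b -> u q - u p = \int[mu]_(t in `]p, q]) v t.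

Lemma is_primitive_of_small_increments a b f k w :
  mu.-integrable `[a, b] (EFin \o k) -> mu.-integrable `[a, b] (EFin \o w) ->
  (forall e : R, 0 < e -> exists2 r : R, 0 < r & forall s t, a <= s -> s <= t -> t <= b ->
     t - s < r ->
     `|f t - f s - \int[mu]_(x in `]s, t]) k x| <= e * \int[mu]_(x in `]s, t]) w x) ->
  is_primitive a b f k.
Proof.
move=> ik iw H; split=> // p q ap pq qb.
pose J t := f t - \int[mu]_(x in `[a, t]) k x.
have : J q = J p.
  apply: (@constant_of_small_increments _ (fun t => \int[mu]_(x in `[a, t]) w x) _ _ pq).
  move=> e e0; have [r r0 Hr] := H e e0; exists r => // s t ps st tq str.
  have as_ := le_trans ap ps; have tb := le_trans tq qb.
  have := Hr s t as_ st tb str.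
  rewrite -(Rintegral_itv_diff ik)// -(Rintegral_itv_diff iw)//.
  apply: le_trans; rewrite /J le_eqVlt; apply/orP; left; apply/eqP; congr `|_|; ring.
rewrite /J -(Rintegral_itv_diff ik)//; lra.
Qed.

Lemma is_primitive_continuous a b u v : is_primitive a b u v ->
  {within `[a, b], continuous u}.
Proof.
move=> [iv H]; have [ab|ba] := leP a b; last first.
  rewrite set_itv_ge ?bnd_simp -?ltNge//; exact: continuous_subspace0.
have cV := parameterized_integral_continuous ab iv.
have E : {in `[a, b]%classic, (fun t => u a + parameterized_integral mu a t v) =1 u}.
  move=> t; rewrite inE/= in_itv/= => /andP[at_ tb].
  rewrite /parameterized_integral -(subrK (u a) (u t)) (H a t)// addrC; congr (_ + _).
  by rewrite -(Rintegral_itv_diff iv)// set_itv1 Rintegral_set1 subr0.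
apply: (subspace_eq_continuous E).
by move=> t; apply: cvgD; [exact: cvg_cst|exact: cV].
Qed.

Lemma is_primitive_smooth a b f f' : (forall x, is_derive x (1 : R) f (f' x)) ->
  continuous f' -> is_primitive a b f f'.
Proof.
move=> df cf'; split; first exact/continuous_integrable_itv/continuous_subspaceT.
move=> p q ap pq qb; rewrite -(Rintegral_FTC2 pq df cf') Rintegral_itv_obnd_cbnd//.
have : mu.-integrable `[p, q] (EFin \o f').
  exact/continuous_integrable_itv/continuous_subspaceT.
by move=> ip; apply: integrable_sub_itv ip _; apply: subset_itv; rewrite bnd_simp.
Qed.

(** Both rules compare an integrand with its value at a nearby point, which
    uniform continuity makes small against the total density. *)
Lemma is_primitive_mul a b u v f f' : a <= b -> is_primitive a b u v ->
  (forall x, is_derive x (1 : R) f (f' x)) -> continuous f' ->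
  is_primitive a b (fun x => u x * f x) (fun x => v x * f x + u x * f' x).
Proof.
move=> ab Puv df cf'; have [iv H] := Puv.
have cu := is_primitive_continuous Puv.
have cf := is_derive_continuous df.
have cfw : {within `[a, b], continuous f} by exact: continuous_subspaceT.
have [if' H'] := is_primitive_smooth a b df cf'.
have ivf : mu.-integrable `[a, b] (EFin \o (fun x => v x * f x)).
  have [|M _ HM] := @continuous_bounded_on R _ `[a, b]%classic f (@segment_compact _ _ _).
    by move=> t _; exact: cf.
  apply: (integrable_mul_bounded _ iv _ HM) => //.
  exact: integrable_measurable (continuous_integrable_itv cfw).
have iuf : mu.-integrable `[a, b] (EFin \o (fun x => u x * f' x)).
  apply: continuous_integrable_itv => x; apply: cvgM; first exact: cu.
  exact: (continuous_subspaceT cf').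
apply: (@is_primitive_of_small_increments _ _ _ _ (fun x => `|v x| + `|f' x|)).
- exact: integrable_add.
- by apply: integrable_add => //; exact: integrable_norm.
move=> e e0.
have [r1 r10 U1] := uniformly_continuous_itv cu e0.
have [r2 r20 U2] := uniformly_continuous_itv cfw e0.
exists (Num.min r1 r2); first by rewrite lt_min r10.
move=> s t as_ st tb; rewrite lt_min => /andP[sr1 sr2].
have sub : `]s, t] `<=` `[a, b] by apply: subset_itv; rewrite bnd_simp.
have icst (h : R -> R) (K : R) : mu.-integrable `[a, b] (EFin \o h) ->
    mu.-integrable `]s, t] (EFin \o (fun x => h x * K)).
  move=> ih; apply: (integrable_mul_bounded (M := `|K|)) => //.
  exact: integrable_sub_itv ih _.
have -> : u t * f t - u s * f s - \int[mu]_(x in `]s, t]) (v x * f x + u x * f' x) =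
    \int[mu]_(x in `]s, t]) (v x * (f t - f x) + f' x * (u s - u x)).
  have -> : u t * f t - u s * f s =
      \int[mu]_(x in `]s, t]) (v x * f t + f' x * u s).
    rewrite RintegralD ?RintegralZr//; try exact: icst; try exact: integrable_sub_itv sub.
    rewrite -H// -H'//; ring.
  rewrite -RintegralB//.
  - by apply: eq_Rintegral_line => x _; ring.
  - by apply: integrable_add => //; exact: icst.
  - by apply: integrable_sub_itv sub; exact: integrable_add.
pose h1 x := f t - f x; pose h2 x := u s - u x.
have mf : measurable_fun `]s, t] f.
  by have := integrable_sub_itv (continuous_integrable_itv cfw) sub; exact: integrable_measurable.
have mu' : measurable_fun `]s, t] u.
  by have := integrable_sub_itv (continuous_integrable_itv cu) sub; exact: integrable_measurable.
have mh1 : measurable_fun `]s, t] h1 by exact: measurable_funB.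
have mh2 : measurable_fun `]s, t] h2 by exact: measurable_funB.
have sab : a <= s <= b by rewrite as_ (le_trans st).
have tab : a <= t <= b by rewrite tb (le_trans as_).
have bh1 x : `]s, t]%classic x -> `|h1 x| <= e.
  rewrite /= in_itv/= => /andP[sx xt]; apply/ltW/U2 => //.
    by rewrite (le_trans as_ (ltW sx)) (le_trans xt).
  by rewrite ger0_norm ?subr_ge0// (le_lt_trans _ sr2)// lerB// ltW.
have bh2 x : `]s, t]%classic x -> `|h2 x| <= e.
  rewrite /= in_itv/= => /andP[sx xt]; apply/ltW/U1 => //.
    by rewrite (le_trans as_ (ltW sx)) (le_trans xt).
  by rewrite distrC ger0_norm ?subr_ge0 ?(ltW sx)// (le_lt_trans _ sr1)// lerB.
have ivs : mu.-integrable `]s, t] (EFin \o v) by exact: integrable_sub_itv sub.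
have ifs : mu.-integrable `]s, t] (EFin \o f') by exact: integrable_sub_itv sub.
have mst : measurable (`]s, t]%classic : set (measurableTypeR R)) by [].
have iv1 := integrable_mul_bounded mst ivs mh1 bh1.
have if2 := integrable_mul_bounded mst ifs mh2 bh2.
rewrite RintegralD// (le_trans (ler_normD _ _))// RintegralD//; last 2 first.
- exact: integrable_norm.
- exact: integrable_norm.
by rewrite mulrDr lerD//; exact: Rintegral_mul_le.
Qed.

Lemma mean_value_along a b u (Phi phi : R -> R) s t :
  (forall x, is_derive x (1 : R) Phi (phi x)) -> {within `[a, b], continuous u} ->
  a <= s -> s <= t -> t <= b ->
  exists2 r, s <= r <= t & Phi (u t) - Phi (u s) = phi (u r) * (u t - u s).
Proof.
move=> dPhi cu as_ st tb.
have cus : {within `[s, t], continuous u}.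
  by apply: continuous_subspaceW cu; apply: subset_itv; rewrite bnd_simp.
have [y [y1 y2 ->]] : exists y, [/\ Num.min (u s) (u t) <= y,
    y <= Num.max (u s) (u t) & Phi (u t) - Phi (u s) = phi y * (u t - u s)].
  have [lt|lt|->] := ltgtP (u s) (u t).
  - have [y /andP[y1 y2] E] := MVT_everywhere lt dPhi.
    by exists y; split => //; exact: ltW.
  - have [y /andP[y1 y2] E] := MVT_everywhere lt dPhi.
    exists y; split; [exact: ltW|exact: ltW|].
    by rewrite -opprB E -mulrN opprB.
  - by exists (u t); rewrite !subrr mulr0.
have [|r] := IVT st cus _ (v := y); first by rewrite y1.
by rewrite in_itv/= => rst <-; exists r.
Qed.

Lemma is_primitive_comp a b u v (Phi phi : R -> R) : a <= b -> is_primitive a b u v ->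
  (forall x, is_derive x (1 : R) Phi (phi x)) -> continuous phi ->
  is_primitive a b (fun x => Phi (u x)) (fun x => v x * phi (u x)).
Proof.
move=> ab Puv dPhi cphi; have [iv H] := Puv.
have cu := is_primitive_continuous Puv.
have cpu : {within `[a, b], continuous (phi \o u)}.
  by move=> x; apply: (@continuous_comp (subspace `[a, b]) _ _ u phi); [exact: cu|exact: cphi].
have ipu := continuous_integrable_itv cpu.
have ivp : mu.-integrable `[a, b] (EFin \o (fun x => v x * phi (u x))).
  have [M [_ HM]] := compact_bounded (continuous_compact cpu (@segment_compact R a b)).
  apply: (integrable_mul_bounded (M := `|M| + 1) _ iv) => //.
    exact: integrable_measurable ipu.
  move=> x abx; apply: (HM (`|M| + 1)); last by exists x.
  by rewrite (le_lt_trans (ler_norm _))// ltrDl.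
apply: (@is_primitive_of_small_increments _ _ _ _ (fun x => `|v x|)) => //.
  exact: integrable_norm.
move=> e e0; have [r r0 U] := uniformly_continuous_itv cpu e0.
exists r => // s t as_ st tb str.
have sub : `]s, t] `<=` `[a, b] by apply: subset_itv; rewrite bnd_simp.
have mst : measurable (`]s, t]%classic : set (measurableTypeR R)) by [].
have [c /andP[sc ct] ->] := mean_value_along dPhi cu as_ st tb.
have ivs : mu.-integrable `]s, t] (EFin \o v) by exact: integrable_sub_itv sub.
pose h x := phi (u c) - phi (u x).
have mh : measurable_fun `]s, t] h.
  apply: measurable_funB => //.
  by have := integrable_sub_itv ipu sub; exact: integrable_measurable.
rewrite (H s t)// mulrC -RintegralZr// -RintegralB//; last 2 first.
- by apply: (integrable_mul_bounded (M := `|phi (u c)|) mst ivs).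
- exact: integrable_sub_itv ivp sub.
rewrite (@eq_Rintegral_line _ _ (fun x => v x * h x)); last first.
  by move=> x _; rewrite /h mulrBr.
apply: Rintegral_mul_le => // x; rewrite /= in_itv/= => /andP[sx xt].
apply/ltW/U.
- by rewrite (le_trans as_ sc) (le_trans ct).
- by rewrite (le_trans as_ (ltW sx)) (le_trans xt).
- apply: le_lt_trans str; rewrite ler_norml; apply/andP; split; lra.
Qed.

Lemma integration_by_parts_line a b u v f f' : a <= b -> is_primitive a b u v ->
  (forall x, is_derive x (1 : R) f (f' x)) -> continuous f' ->
  f a = 0 -> f b = 0 ->
  \int[mu]_(x in `[a, b]) (u x * f' x) = - \int[mu]_(x in `[a, b]) (v x * f x).
Proof.
move=> ab Puv df cf' fa fb.
have [i H] := is_primitive_mul ab Puv df cf'.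
have := H a b (lexx a) ab (lexx b).
rewrite fa fb !mulr0 subr0 -(Rintegral_itv_diff i)// set_itv1 Rintegral_set1 subr0.
have [iv _] := Puv.
have cu := is_primitive_continuous Puv.
rewrite RintegralD//.
- by move/eqP; rewrite eq_sym addrC addr_eq0 => /eqP.
- have cf : {within `[a, b], continuous f}.
    exact/continuous_subspaceT/is_derive_continuous.
  have [|M _ HM] := @continuous_bounded_on R _ `[a, b]%classic f (@segment_compact _ _ _).
    by move=> t _; apply: is_derive_continuous df t.
  apply: (integrable_mul_bounded _ iv _ HM) => //.
  exact: integrable_measurable (continuous_integrable_itv cf).
- apply: continuous_integrable_itv => x; apply: cvgM; first exact: cu.
  exact: (continuous_subspaceT cf').
Qed.

End AbsolutelyContinuousCalculus.

(** * The straightening map of the Grushin plane *)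

Section Weight.
Context {R : realType}.
Variable alpha : R.
Hypothesis alpha0 : 0 < alpha.

Definition weight (t : R) : R := `|t| `^ alpha.

(** The change of variable that straightens the Grushin plane. *)
Definition straighten (t : R) : R := t * weight t / (alpha + 1).

Lemma weight_ge0 t : 0 <= weight t. Proof. exact: powR_ge0. Qed.

Lemma weight_gt0 t : t != 0 -> 0 < weight t.
Proof. by move=> t0; rewrite powR_gt0// normr_gt0. Qed.

Lemma weight0 : weight 0 = 0.
Proof. by rewrite /weight normr0 powR0// gt_eqF. Qed.

Lemma weightN t : weight (- t) = weight t.
Proof. by rewrite /weight normrN. Qed.

Lemma weight_le s t : `|s| <= `|t| -> weight s <= weight t.
Proof. by move=> st; apply: ge0_ler_powR; rewrite ?nnegrE ?normr_ge0 ?(ltW alpha0). Qed.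

Lemma weightM s t : weight (s * t) = weight s * weight t.
Proof. by rewrite /weight normrM powRM. Qed.

Lemma weight_small e : 0 < e -> exists2 r : R, 0 < r & forall t : R, `|t| < r -> weight t < e.
Proof.
move=> e0; exists (e `^ alpha^-1); first exact: powR_gt0.
move=> t tr; rewrite /weight -[ltRHS](_ : (e `^ alpha^-1) `^ alpha = e).
  by apply: gt0_ltr_powR; rewrite ?nnegrE// powR_ge0.
by rewrite -powRrM mulVf ?gt_eqF// powRr1// ltW.
Qed.

Lemma continuous_weight : continuous weight.
Proof.
move=> t; have [->|t0] := eqVneq t 0.
  apply/cvgrPdist_lt => e e0; rewrite weight0.
  have [r r0 Hr] := weight_small e0.
  exists r => //= x; rewrite /= sub0r normrN => xr.
  by rewrite sub0r normrN ger0_norm ?weight_ge0//; exact: Hr.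
apply: (@continuous_comp R R R (fun t : R => `|t|) (fun t : R => t `^ alpha) t).
  exact: norm_continuous.
have nt : 0 < `|t| by rewrite normr_gt0.
apply: differentiable_continuous; apply/derivable1_diffP.
by case: (is_derive1_powR alpha nt).
Qed.

Lemma straightenN t : straighten (- t) = - straighten t.
Proof. by rewrite /straighten weightN !mulNr. Qed.

Let straighten_derive_pos (t : R) : 0 < t -> is_derive t (1 : R) straighten (weight t).
Proof.
move=> t0; have a1 : alpha + 1 != 0 by rewrite gt_eqF// addr_gt0.
have D := is_deriveZ (alpha + 1)^-1 (is_derive1_powR (alpha + 1) t0).
have E : \forall x \near t, ((alpha + 1)^-1 \*: (fun x => x `^ (alpha + 1))) x = straighten x.
  near=> x; have x0 : 0 < x by near: x; exact: lt_nbhsr.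
  rewrite /straighten /weight gtr0_norm// /GRing.scale /=.
  rewrite powRD ?(gt_eqF x0) ?implybT// powRr1 ?(ltW x0)//.
  by rewrite -[LHS]/(_ * _) mulrC (mulrC x).
apply: is_derive_eq (near_eq_is_derive E D) _.
by rewrite /GRing.scale /= mulKf// addrK /weight gtr0_norm.
Unshelve. all: by end_near. Qed.

Lemma is_derive_straighten t : is_derive t (1 : R) straighten (weight t).
Proof.
have [t0|t0|->] := ltgtP t 0; last 2 first.
- exact: straighten_derive_pos.
- apply/is_derive1_caratheodory; exists (fun z => weight z / (alpha + 1)); split.
  + by move=> z; rewrite /straighten !mul0r !subr0 [RHS]mulrC mulrA.
  + by apply: cvgM; [exact: continuous_weight|exact: cvg_cst].
  + by rewrite weight0 mul0r.
- have nt0 : 0 < - t by rewrite oppr_gt0.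
  have D := is_deriveN (is_derive1_comp (straighten_derive_pos nt0)
    (is_deriveN (is_derive_id t (1 : R)))).
  apply: is_derive_eq (near_eq_is_derive _ D) _.
    by near=> x; rewrite !fctE /= straightenN opprK.
  by rewrite weightN mulrN mulr1 opprK.
Unshelve. all: by end_near. Qed.

Lemma continuous_straighten : continuous straighten.
Proof. exact: is_derive_continuous is_derive_straighten. Qed.

Lemma straighten_lt (s t : R) : s < t -> straighten s < straighten t.
Proof.
have pos (x y : R) : 0 <= x -> x < y -> straighten x < straighten y.
  move=> x0 xy; have [c /andP[xc cy] E] := MVT_everywhere xy is_derive_straighten.
  by rewrite -subr_gt0 E mulr_gt0// ?subr_gt0// weight_gt0// gt_eqF// (le_lt_trans x0).
move=> st; have [s0|s0] := leP 0 s; first exact: pos.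
have [t0|t0] := leP t 0.
  by rewrite -ltrN2 -!straightenN; apply: pos; rewrite ?oppr_ge0 ?ltrN2.
apply: (@lt_trans _ _ (straighten 0)); last exact: pos.
rewrite -ltrN2 -!straightenN; apply: pos; rewrite ?oppr0 ?oppr_gt0//.
Qed.

Lemma straighten_inj : injective straighten.
Proof.
move=> s t st; apply/eqP; rewrite eq_le !leNgt; apply/andP; split;
  by apply/negP => /straighten_lt; rewrite st ltxx.
Qed.

End Weight.

(** * The weak Cauchy-Riemann equations *)

Section IntegrationByPartsOnBoxes.
Context {R : realType}.
Local Notation mu := (@lebesgue_measure R).
Local Notation mu2 := (plane_measure R).
Implicit Types (u v psi : R * R -> R) (z : R * R) (a b c d : R).

Lemma ae_neq (a : R) : {ae mu, forall x, x != a}.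
Proof.
exists [set a]; split=> //; first exact: lebesgue_measure_set1.
by move=> x /= /negP; rewrite negbK => /eqP.
Qed.

Lemma ae_itv_oo_cc a b (P : R -> Prop) :
  {ae mu, forall x, x \in `]a, b[ -> P x} -> {ae mu, forall x, x \in `[a, b] -> P x}.
Proof.
move=> H; apply: aeS2 (aeS2 _ (ae_neq a) (ae_neq b)) H => [x|x xa xb]; last first.
  exact: (conj xa xb).
move=> [xa xb] Hx; rewrite in_itv/= => /andP[ax xb']; apply: Hx.
by rewrite in_itv/= !lt_neqAle ax xb' eq_sym xa xb.
Qed.

Lemma vertical_ibp a b c d u v psi psi2 (Phi phi : R -> R) : c < d ->
  (forall z, box a b c d z -> {for z, continuous u}) ->
  mu2.-integrable (box a b c d) (EFin \o v) ->
  ac_on_vertical_lines u v a b c d ->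
  (forall t, is_derive t (1 : R) Phi (phi t)) -> continuous phi ->
  continuous psi -> continuous psi2 ->
  (forall x y, is_derive y (1 : R) (fun y => psi (x, y)) (psi2 (x, y))) ->
  (forall x, a <= x <= b -> psi (x, c) = 0 /\ psi (x, d) = 0) ->
  mu2.-integrable (box a b c d) (EFin \o (fun z => v z * phi (u z) * psi z)) /\
  \int[mu2]_(z in box a b c d) (Phi (u z) * psi2 z) =
    - \int[mu2]_(z in box a b c d) (v z * phi (u z) * psi z).
Proof.
move=> cd cu iv AC dPhi cphi cpsi cpsi2 dpsi psi0.
have mB := @measurable_box R a b c d.
have cPhi := is_derive_continuous dPhi.
have comp_cont (h : R -> R) : continuous h ->
    forall z, box a b c d z -> {for z, continuous (fun z => h (u z))}.
  by move=> ch z Bz; apply: continuous_comp; [exact: cu|exact: ch].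
have cpp z : box a b c d z -> {for z, continuous (fun z => phi (u z) * psi z)}.
  by move=> Bz; apply: cvgM; [exact: comp_cont|exact: cpsi].
have i1 : mu2.-integrable (box a b c d) (EFin \o (fun z => Phi (u z) * psi2 z)).
  apply: continuous_box_integrable => z Bz.
  by apply: cvgM; [exact: comp_cont|exact: cpsi2].
have i2 : mu2.-integrable (box a b c d) (EFin \o (fun z => v z * phi (u z) * psi z)).
  have [M _ HM] := continuous_bounded_on (@compact_box R a b c d) cpp.
  have := integrable_mul_bounded mB iv (continuous_plane_measurable mB cpp) HM.
  by apply: eq_integrable => // z _ /=; rewrite mulrA.
split=> //; apply/eqP; rewrite -addr_eq0 -RintegralD//; apply/eqP.
have iF := integrable_add mB i1 i2.
have [aeF _ ->] := box_fubini iF.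
rewrite (@eq_Rintegral_ae _ _ _ mu _ _ (cst 0)) //; last 3 first.
- by have [_] := box_fubini iF.
- exact: integrable0.
- apply: aeS2 (ae_itv_oo_cc AC) aeF => x Hx aeFx xab.
  have xab' : a <= x <= b by move: xab; rewrite /= in_itv.
  have [ivx ux] := Hx xab.
  have prim : is_primitive c d (fun y => u (x, y)) (fun y => v (x, y)) by [].
  have primP := is_primitive_comp (ltW cd) prim dPhi cphi.
  have cslice : continuous (fun y => psi2 (x, y)).
    by move=> y; apply: continuous_slice2; exact: cpsi2.
  have [pc pd] := psi0 _ xab'.
  have ibp := integration_by_parts_line (ltW cd) primP (dpsi x) cslice pc pd.
  rewrite RintegralD//=.
  + by rewrite ibp addNr.
  + apply: continuous_integrable_itv; apply: continuous_itv_within => y ycd.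
    have Bxy : box a b c d (x, y) by apply/boxP.
    apply: (@continuous_slice2 R (fun z => Phi (u z) * psi2 z)).
    by apply: cvgM; [exact: comp_cont|exact: cpsi2].
  + have Bxy y : `[c, d]%classic y -> box a b c d (x, y) by move=> yc; split.
    have cpx : {within `[c, d], continuous (fun y => psi (x, y))}.
      by apply: continuous_subspaceT => y; apply: continuous_slice2; exact: cpsi.
    have [|M _ HM] := @continuous_bounded_on R _ `[c, d]%classic
        (fun y => psi (x, y)) (@segment_compact _ _ _).
      by move=> y _; apply: continuous_slice2; exact: cpsi.
    have [ip _] := primP.
    apply: (integrable_mul_bounded _ ip _ HM) => //.
    exact: integrable_measurable (continuous_integrable_itv cpx).
by rewrite Rintegral_cst// mul0r.
Qed.

Lemma horizontal_ibp a b c d u v psi psi1 (Phi phi : R -> R) : a < b ->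
  (forall z, box a b c d z -> {for z, continuous u}) ->
  mu2.-integrable (box a b c d) (EFin \o v) ->
  ac_on_vertical_lines (u \o swap_plane) (v \o swap_plane) c d a b ->
  (forall t, is_derive t (1 : R) Phi (phi t)) -> continuous phi ->
  continuous psi -> continuous psi1 ->
  (forall x y, is_derive x (1 : R) (fun x => psi (x, y)) (psi1 (x, y))) ->
  (forall y, c <= y <= d -> psi (a, y) = 0 /\ psi (b, y) = 0) ->
  mu2.-integrable (box a b c d) (EFin \o (fun z => v z * phi (u z) * psi z)) /\
  \int[mu2]_(z in box a b c d) (Phi (u z) * psi1 z) =
    - \int[mu2]_(z in box a b c d) (v z * phi (u z) * psi z).
Proof.
move=> ab cu iv AC dPhi cphi cpsi cpsi1 dpsi psi0.
have csw (h : R * R -> R) : continuous h -> continuous (h \o swap_plane).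
  by move=> ch z; apply: continuous_swap_plane; exact: ch.
have [ivs _] := integrable_box_swap iv.
have cus z : box c d a b z -> {for z, continuous (u \o swap_plane)}.
  by move=> /box_swap Bz; apply: continuous_swap_plane; exact: cu.
have [i E] := vertical_ibp ab cus ivs AC dPhi cphi (csw _ cpsi) (csw _ cpsi1)
  (fun x y => dpsi y x) psi0.
have [i' E1] := integrable_box_swap i.
have {}i' : mu2.-integrable (box a b c d) (EFin \o (fun z => v z * phi (u z) * psi z)).
  rewrite (_ : (fun z => v z * phi (u z) * psi z) =
    (fun z => (v \o swap_plane) z * phi ((u \o swap_plane) z) *
              (psi \o swap_plane) z) \o swap_plane) //.
  by apply/funext => -[].
split=> //.
have cc z : box a b c d z -> {for z, continuous (fun z => Phi (u z) * psi1 z)}.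
  move=> Bz; apply: cvgM; last exact: cpsi1.
  apply: continuous_comp; [exact: cu|exact: (is_derive_continuous dPhi)].
have [_ E2] := integrable_box_swap (continuous_box_integrable cc).
have [_ E3] := integrable_box_swap i'.
by rewrite -E2 -E3.
Qed.

End IntegrationByPartsOnBoxes.

Section WeakCauchyRiemann.
Context {R : realType}.
Local Notation mu := (@lebesgue_measure R).
Local Notation mu2 := (plane_measure R).
Implicit Types (u v psi : R * R -> R) (z : R * R) (a b c d : R) (Om : set (R * R)).

Lemma ae_fst_neq (t : R) : {ae mu2, forall z, z.1 != t}.
Proof.
exists ([set t] `*` setT); split.
- by apply: measurableX => //; exact: measurable_set1.
- have -> : mu2 ([set t] `*` setT) = (mu [set t] * mu setT)%E.
    by apply: product_measure1E => //; exact: measurable_set1.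
  by rewrite lebesgue_measure_set1 mul0e.
- by move=> z /= /negP; rewrite negbK => /eqP.
Qed.

Lemma ae_box_interior a b c d (P : R * R -> Prop) :
  {ae mu2, forall z, a < z.1 < b -> c < z.2 < d -> P z} ->
  {ae mu2, forall z, box a b c d z -> P z}.
Proof.
have ne2 (t : R) : {ae mu2, forall z, z.2 != t}.
  by apply: aeS (ae_swap (ae_fst_neq t)) => z.
move=> H; have H1 := aeS2 (fun t => @conj _ _) (ae_fst_neq a) (ae_fst_neq b).
have H2 := aeS2 (fun t => @conj _ _) (ne2 c) (ne2 d).
apply: aeS2 (aeS2 (fun t => @conj _ _) H1 H2) H => z [[za zb] [zc zd]] Pz /boxP.
move=> [/andP[az bz] /andP[cz dz]]; apply: Pz.
  by rewrite !lt_neqAle az bz eq_sym za zb.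
by rewrite !lt_neqAle cz dz eq_sym zc zd.
Qed.

Lemma ae_weak_partial2 Om u v a b c d : a < b -> c < d -> box a b c d `<=` Om ->
  (forall z, Om z -> {for z, continuous u}) -> weak_partial Om e2 u v ->
  {ae mu2, forall z, box a b c d z ->
    forall l, is_derive z (e2 : R * R) u l -> l = v z}.
Proof.
move=> ab cd BOm cu W; apply: ae_box_interior; apply: ae_derive_vertical.
- by move=> z Bz; exact/cu/BOm.
- by have [] := weak_partial_box2 BOm cu W.
- exact: weak_partial_ac2 W.
Qed.

Lemma ae_weak_partial1 Om u v a b c d : a < b -> c < d -> box a b c d `<=` Om ->
  (forall z, Om z -> {for z, continuous u}) -> weak_partial Om e1 u v ->
  {ae mu2, forall z, box a b c d z ->
    forall l, is_derive z (e1 : R * R) u l -> l = v z}.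
Proof.
move=> ab cd BOm cu W.
have := @ae_derive_vertical R (u \o swap_plane) (v \o swap_plane) c d a b.
move=> /(_ _ _ _)/ae_box_interior/ae_swap H.
have {}H : {ae mu2, forall z, box c d a b (swap_plane z) -> forall l,
    is_derive (swap_plane z) (e2 : R * R) (u \o swap_plane) l ->
    l = (v \o swap_plane) (swap_plane z)}.
  apply: H.
  - by move=> z /box_swap Bz; apply: continuous_swap_plane; exact/cu/BOm.
  - by have [] := weak_partial_box1 BOm cu W.
  - exact: weak_partial_ac1 W.
apply: aeS H => -[x y] Hz Bz l Dl; apply: (Hz _ l); first exact/box_swap.
by apply/is_derive_slice2; move/is_derive_slice1 : Dl.
Qed.

Variable alpha : R.
Hypothesis alpha0 : 0 < alpha.

Record test_triple a b c d psi psi1 psi2 : Prop := TestTriple {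
  tt_cont : continuous psi;
  tt_cont1 : continuous psi1;
  tt_cont2 : continuous psi2;
  tt_derive1 : forall x y, is_derive x (1 : R) (fun x => psi (x, y)) (psi1 (x, y));
  tt_derive2 : forall x y, is_derive y (1 : R) (fun y => psi (x, y)) (psi2 (x, y));
  tt_left : forall y, c <= y <= d -> psi (a, y) = 0;
  tt_right : forall y, c <= y <= d -> psi (b, y) = 0;
  tt_bottom : forall x, a <= x <= b -> psi (x, c) = 0;
  tt_top : forall x, a <= x <= b -> psi (x, d) = 0 }.

(** The pair (G, h) satisfies, against [C^1] functions vanishing on the
    boundary of the box, the Cauchy-Riemann equations in the coordinates
    (straighten x, y). *)
Definition weak_CR a b c d (G h : R * R -> R) :=
  forall psi psi1 psi2, test_triple a b c d psi psi1 psi2 ->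
    \int[mu2]_(z in box a b c d) (G z * psi1 z) =
      \int[mu2]_(z in box a b c d) (h z * (weight alpha z.1 * psi2 z)) /\
    \int[mu2]_(z in box a b c d) (G z * (weight alpha z.1 * psi2 z)) =
      - \int[mu2]_(z in box a b c d) (h z * psi1 z).

(** Integrating by parts along almost every line moves the derivatives to the
    test function, and the chain rule for the straightening map turns
    [wt (g1) d g1] into the derivative of [straighten g1]. *)
Lemma weak_CR_of_ae Om (g1 g2 v11 v12 v21 v22 : R * R -> R) a b c d :
  a < b -> c < d -> box a b c d `<=` Om ->
  (forall z, Om z -> {for z, continuous g1}) ->
  (forall z, Om z -> {for z, continuous g2}) ->
  weak_partial Om e1 g1 v11 -> weak_partial Om e2 g1 v12 ->
  weak_partial Om e1 g2 v21 -> weak_partial Om e2 g2 v22 ->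
  {ae mu2, forall z, box a b c d z -> exists p11 p12 p21 p22 : R,
     [/\ is_derive z (e1 : R * R) g1 p11, is_derive z (e2 : R * R) g1 p12,
         is_derive z (e1 : R * R) g2 p21, is_derive z (e2 : R * R) g2 p22 &
         weight alpha (g1 z) * p11 = weight alpha z.1 * p22 /\
         weight alpha (g1 z) * (weight alpha z.1 * p12) = - p21]} ->
  weak_CR a b c d (straighten alpha \o g1) g2.
Proof.
move=> ab cd BOm cg1 cg2 W11 W12 W21 W22 CR psi psi1 psi2 T.
have mB := @measurable_box R a b c d.
have ae11 := ae_weak_partial1 ab cd BOm cg1 W11.
have ae12 := ae_weak_partial2 ab cd BOm cg1 W12.
have ae21 := ae_weak_partial1 ab cd BOm cg2 W21.
have ae22 := ae_weak_partial2 ab cd BOm cg2 W22.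
have CRw : {ae mu2, forall z, box a b c d z ->
    weight alpha (g1 z) * v11 z = weight alpha z.1 * v22 z /\
    weight alpha (g1 z) * (weight alpha z.1 * v12 z) = - v21 z}.
  have A1 := aeS2 (fun t => @conj _ _) ae11 ae12.
  have A2 := aeS2 (fun t => @conj _ _) ae21 ae22.
  apply: aeS2 (aeS2 (fun t => @conj _ _) A1 A2) CR => z [[H11 H12] [H21 H22]] H Bz.
  have [p11 [p12 [p21 [p22 [D11 D12 D21 D22 E]]]]] := H Bz.
  by rewrite -(H11 Bz _ D11) -(H12 Bz _ D12) -(H21 Bz _ D21) -(H22 Bz _ D22).
have iv11 : mu2.-integrable (box a b c d) (EFin \o v11).
  by case: W11 => _ L _; apply: L => //; exact: compact_box.
have iv12 : mu2.-integrable (box a b c d) (EFin \o v12).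
  by case: W12 => _ L _; apply: L => //; exact: compact_box.
have iv21 : mu2.-integrable (box a b c d) (EFin \o v21).
  by case: W21 => _ L _; apply: L => //; exact: compact_box.
have iv22 : mu2.-integrable (box a b c d) (EFin \o v22).
  by case: W22 => _ L _; apply: L => //; exact: compact_box.
have cB1 z : box a b c d z -> {for z, continuous g1} by move=> Bz; exact/cg1/BOm.
have cB2 z : box a b c d z -> {for z, continuous g2} by move=> Bz; exact/cg2/BOm.
have cw : continuous (fun z : R * R => weight alpha z.1).
  move=> z; apply: continuous_comp; first exact: cvg_fst.
  exact: continuous_weight.
have dS := is_derive_straighten alpha0; have cW := continuous_weight alpha0.
have dI (t : R) : is_derive t (1 : R) id ((fun=> 1) t) by exact: is_derive_id.
have cI : continuous ((fun=> 1) : R -> R) by exact: (@cst_continuous R R 1).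
have [T0 T1 T2 D1 D2 tl tr tb tt] := T.
have cwpsi : continuous (fun z => weight alpha z.1 * psi z).
  by move=> z; apply: cvgM; [exact: cw|exact: T0].
have cwpsi2 : continuous (fun z => weight alpha z.1 * psi2 z).
  by move=> z; apply: cvgM; [exact: cw|exact: T2].
have D2w x y : is_derive y (1 : R) (fun y => weight alpha (x, y).1 * psi (x, y))
    (weight alpha (x, y).1 * psi2 (x, y)).
  exact: (is_deriveZ (weight alpha x) (D2 x y)).
have B1 y : c <= y <= d -> psi (a, y) = 0 /\ psi (b, y) = 0 by move=> h; split; auto.
have B2 x : a <= x <= b -> weight alpha (x, c).1 * psi (x, c) = 0 /\
    weight alpha (x, d).1 * psi (x, d) = 0.
  by move=> h; rewrite tb// tt// mulr0.
have [i1 E1] := horizontal_ibp ab cB1 iv11 (weak_partial_ac1 ab cd BOm cg1 W11)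
  dS cW T0 T1 D1 B1.
have [i2 E2] := vertical_ibp cd cB2 iv22 (weak_partial_ac2 ab cd BOm cg2 W22)
  dI cI cwpsi cwpsi2 D2w B2.
have [i3 E3] := vertical_ibp cd cB1 iv12 (weak_partial_ac2 ab cd BOm cg1 W12)
  dS cW cwpsi cwpsi2 D2w B2.
have [i4 E4] := horizontal_ibp ab cB2 iv21 (weak_partial_ac1 ab cd BOm cg2 W21)
  dI cI T0 T1 D1 B1.
split.
  rewrite E1 E2; congr (- _); apply: (@eq_Rintegral_ae _ _ _ mu2) => //.
  apply: aeS CRw => z Hz Bz; have [+ _] := Hz Bz.
  by rewrite mulr1 mulrA (mulrC (v11 z)) (mulrC (v22 z)) => ->.
rewrite E3 E4 opprK -RintegralN//.
apply: (@eq_Rintegral_ae _ _ _ mu2) => //.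
  rewrite (_ : EFin \o _ = EFin \o (fun z => (-1) * (v12 z * weight alpha (g1 z) *
    (weight alpha z.1 * psi z)))); first exact: (integrableZl _ (-1) i3).
  by apply/funext => z /=; rewrite mulN1r.
apply: aeS CRw => z Hz Bz; have [_ +] := Hz Bz.
rewrite mulr1 => E; rewrite -[v21 z]opprK -E; ring.
Qed.

End WeakCauchyRiemann.

(** * Integrals against kernels *)

Section KernelIntegrals.
Context {R : realType}.
Local Notation mu2 := (plane_measure R).
Implicit Types (z : R * R) (V : set (R * R)).

Definition C1_on V (f f1 f2 : R * R -> R) := forall z, V z ->
  [/\ is_derive z (e1 : R * R) f (f1 z), is_derive z (e2 : R * R) f (f2 z),
      {for z, continuous f1} & {for z, continuous f2}].

(** Tube lemma in quantitative form, the continuity of integrals that depend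
    on a parameter. *)
Lemma near_uniform_on_compact (T U : topologicalType) (H : T * U -> R)
    (K : set U) (t : T) (e : R) : continuous H -> compact K -> 0 < e ->
  \forall t' \near t, forall x, K x -> `|H (t', x) - H (t, x)| < e.
Proof.
move=> cH cK e0; have e20 : 0 < e / 2 by rewrite divr_gt0.
have /(_ T (nbhs t) (fun t' x => `|H (t', x) - H (t, x)| < e) _) := (compact_near_coveringP K).1 cK.
apply=> x Kx.
have /cvgrPdist_lt /(_ _ e20) H1 : H p @[p --> (t, x)] --> H (t, x) by exact: cH.
case: H1 => -[A B] /= [At Bx] AB.
exists (B, A) => //= -[x' t'] /= [Bx' At'].
have E1 := AB (t', x') (conj At' Bx').
have E2 := AB (t, x') (conj (nbhs_singleton At) Bx').
rewrite (le_lt_trans (ler_distD (H (t, x)) _ _))// (splitr e) ltrD//.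
by rewrite distrC.
Qed.

Variables (a b c d : R).
Let B : set (R * R) := box a b c d.
Variable k : R * R -> R.
Hypothesis ck : forall z, B z -> {for z, continuous k}.

Let mB := @measurable_box R a b c d.
Let ik : mu2.-integrable B (EFin \o k).
Proof. exact: continuous_box_integrable. Qed.

Definition kernel_integral (K : (R * R) * (R * R) -> R) z :=
  \int[mu2]_(w in B) (k w * K (z, w)).

Let cslice (K : (R * R) * (R * R) -> R) z : continuous K -> continuous (fun w => K (z, w)).
Proof.
move=> cK w; apply: (@continuous_comp _ _ _ (fun w => (z, w)) K); last exact: cK.
exact: (cvg_pair (cvg_cst z) cvg_id).
Qed.

Lemma kernel_integrable K z : continuous K ->
  mu2.-integrable B (EFin \o (fun w => k w * K (z, w))).
Proof.
move=> cK; apply: continuous_box_integrable => w Bw.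
by apply: cvgM; [exact: ck|exact: cslice].
Qed.

Let bound_diff (K : R * R -> R) e : continuous K ->
  (forall w, B w -> `|K w| <= e) ->
  `|\int[mu2]_(w in B) (k w * K w)| <= e * \int[mu2]_(w in B) `|k w|.
Proof.
move=> cK Ke; apply: Rintegral_mul_le => //.
by apply: continuous_plane_measurable => // w _; exact: cK.
Qed.

Let pos_total : 0 <= \int[mu2]_(w in B) `|k w|.
Proof. exact: Rintegral_ge0. Qed.

Lemma kernel_integral_continuous K : continuous K -> continuous (kernel_integral K).
Proof.
move=> cK z; apply/cvgrPdist_lt => e e0.
set T := \int[mu2]_(w in B) `|k w|.
have T0 : 0 < T + 1 by rewrite ltr_wpDl// pos_total.
have eT : 0 < e / (T + 1) by rewrite divr_gt0.
have := near_uniform_on_compact z cK (@compact_box R a b c d) eT.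
apply: filterS => z' Hz'; rewrite distrC /kernel_integral.
rewrite -RintegralB//; [|exact: kernel_integrable..].
under eq_Rintegral do rewrite -mulrBr.
apply: le_lt_trans (bound_diff (e := e / (T + 1)) _ _) _.
- by move=> w; apply: cvgB; exact: cslice.
- by move=> w Bw; apply/ltW/Hz'.
- by rewrite -mulrA gtr_pMr// mulrC ltr_pdivrMr// mul1r ltrDl.
Qed.

(** By the mean value theorem the difference quotient of the kernel is its
    derivative at an intermediate point, uniformly close to the derivative at
    [z] over the compact box. *)
Lemma is_derive_kernel_integral1 K K1 z : continuous K -> continuous K1 ->
  (forall w x y, is_derive x (1 : R) (fun x => K ((x, y), w)) (K1 ((x, y), w))) ->
  is_derive z (e1 : R * R) (kernel_integral K) (kernel_integral K1 z).
Proof.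
move=> cK cK1 dK; apply/is_derive_slice1; case: z => x y /=.
suff L : h^-1 *: (kernel_integral K (h *: (1 : R) + x, y) - kernel_integral K (x, y))
    @[h --> (0 : R)^'] --> kernel_integral K1 (x, y).
  split; first by apply/cvg_ex; exists (kernel_integral K1 (x, y)).
  by apply: cvg_lim L; exact: norm_hausdorff.
apply/cvgrPdist_lt => e e0.
set T := \int[mu2]_(w in B) `|k w|.
have T0 : 0 < T + 1 by rewrite ltr_wpDl// pos_total.
have eT : 0 < e / (T + 1) by rewrite divr_gt0.
have := near_uniform_on_compact (x, y) cK1 (@compact_box R a b c d) eT.
move=> /nbhs_ballP[r /= r0 Hr].
exists r => //= h; rewrite /ball_/= sub0r normrN => hr h0.
rewrite distrC /kernel_integral -RintegralB//; [|exact: kernel_integrable..].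
rewrite -[_ *: _]/(_ * _) -RintegralZl//; last first.
  by apply: integrable_sub => //; exact: kernel_integrable.
have iZ : mu2.-integrable B (EFin \o (fun w =>
    h^-1 * (k w * K ((h *: (1 : R) + x, y), w) - k w * K ((x, y), w)))).
  apply: integrable_scale => //.
  by apply: integrable_sub => //; exact: kernel_integrable.
rewrite -RintegralB//; last exact: kernel_integrable.
pose D w := h^-1 * (K ((h *: (1 : R) + x, y), w) - K ((x, y), w)) - K1 ((x, y), w).
have -> : \int[mu2]_(w in B) (h^-1 * (k w * K ((h *: (1 : R) + x, y), w) - k w * K ((x, y), w))
    - k w * K1 ((x, y), w)) = \int[mu2]_(w in B) (k w * D w).
  by apply: eq_Rintegral => w _; rewrite /D; ring.
apply: le_lt_trans (bound_diff (e := e / (T + 1)) _ _) _.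
- move=> w; apply: cvgB; last exact: cslice.
  by apply: cvgM; [exact: cvg_cst|apply: cvgB; exact: cslice].
- move=> w Bw; rewrite /D.
  have [xi xir ->] : exists2 xi, `|xi - x| < r &
      h^-1 * (K ((h *: (1 : R) + x, y), w) - K ((x, y), w)) = K1 ((xi, y), w).
    rewrite [h *: 1](_ : _ = h) ?[_ *: _]mulr1//.
    have [hp|hn|h0'] := ltgtP h 0; last by rewrite h0' eqxx in h0.
    + have hx : h + x < x by rewrite gtrDr.
      have [xi /andP[x1 x2] E] := MVT_everywhere hx (fun x => dK w x y).
      exists xi; first by rewrite ltr_norml; apply/andP; split; move: hr; rewrite ltr_norml => /andP[]; lra.
      rewrite (_ : K _ - K _ = h * K1 ((xi, y), w)) ?mulKf//.
      by rewrite -opprB E; ring.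
    + have hx : x < h + x by rewrite ltrDr.
      have [xi /andP[x1 x2] E] := MVT_everywhere hx (fun x => dK w x y).
      exists xi; first by rewrite ltr_norml; apply/andP; split; move: hr; rewrite ltr_norml => /andP[]; lra.
      by rewrite E addrK mulrC mulfK.
  apply/ltW/Hr => //; split => /=; first by rewrite /ball/= distrC.
  exact: ballxx.
- by rewrite -mulrA gtr_pMr// mulrC ltr_pdivrMr// mul1r ltrDl.
Qed.

Lemma is_derive_kernel_integral2 K K2 z : continuous K -> continuous K2 ->
  (forall w x y, is_derive y (1 : R) (fun y => K ((x, y), w)) (K2 ((x, y), w))) ->
  is_derive z (e2 : R * R) (kernel_integral K) (kernel_integral K2 z).
Proof.
move=> cK cK2 dK; pose sw (p : (R * R) * (R * R)) := (swap_plane p.1, p.2).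
have csw (H : (R * R) * (R * R) -> R) : continuous H -> continuous (H \o sw).
  move=> cH p; apply: (@continuous_comp _ _ _ sw H); last exact: cH.
  have c1 : {for p, continuous (fun p : (R * R) * (R * R) => p.1)} by exact: cvg_fst.
  have c11 : {for p, continuous (fun p : (R * R) * (R * R) => p.1.1)}.
    by apply: (@continuous_comp _ _ _ fst fst) => //; exact: cvg_fst.
  have c12 : {for p, continuous (fun p : (R * R) * (R * R) => p.1.2)}.
    by apply: (@continuous_comp _ _ _ fst snd) => //; exact: cvg_snd.
  exact: (cvg_pair (cvg_pair c12 c11) cvg_snd).
have := is_derive_kernel_integral1 (swap_plane z) (csw _ cK) (csw _ cK2)
  (fun w x y => dK w y x).
by move/is_derive_slice1 => /= H; apply/is_derive_slice2; case: z H.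
Qed.

Lemma C1_kernel_integral K K1 K2 V : continuous K -> continuous K1 -> continuous K2 ->
  (forall w x y, is_derive x (1 : R) (fun x => K ((x, y), w)) (K1 ((x, y), w))) ->
  (forall w x y, is_derive y (1 : R) (fun y => K ((x, y), w)) (K2 ((x, y), w))) ->
  C1_on V (kernel_integral K) (kernel_integral K1) (kernel_integral K2).
Proof.
move=> cK cK1 cK2 d1 d2 z _; split.
- exact: is_derive_kernel_integral1.
- exact: is_derive_kernel_integral2.
- exact: kernel_integral_continuous.
- exact: kernel_integral_continuous.
Qed.

End KernelIntegrals.

(** * A Weyl lemma for the Cauchy-Riemann equations *)

Section WeylKernel.
Context {R : realType}.
Local Notation mu := (@lebesgue_measure R).
Local Notation mu2 := (plane_measure R).
Implicit Types (z : R * R).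

Lemma is_derive_inv (t : R) : t != 0 ->
  is_derive t (1 : R) (fun x : R => x^-1) (- t ^- 2).
Proof.
move=> t0; have := @is_deriveV _ id t 1 1 t0 (is_derive_id t (1:R)).
by rewrite /GRing.scale /= mulr1.
Qed.

(** The quotient vanishes identically near 0 and obeys the quotient rule
    elsewhere, so the division by the squared distance below stays of class
    [C^1]. *)
Lemma is_derive_div_flat (f f' : R -> R) (m : R) : 0 < m ->
  (forall t, is_derive t (1 : R) f (f' t)) -> continuous f' ->
  (forall t, t <= m -> f t = 0) ->
  (forall t, is_derive t (1 : R) (fun t => f t / t) (f' t / t - f t / t ^+ 2)) /\
  continuous (fun t => f' t / t - f t / t ^+ 2).
Proof.
move=> m0 df cf' f0.
have f'0 t : t < m -> f' t = 0.
  move=> tm; have E : \forall x \near t, (cst (0 : R)) x = f x.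
    near=> x; rewrite f0// ltW//; near: x; exact: lt_nbhsl.
  have [_ <-] := df t; by have [_ <-] := near_eq_is_derive E (is_derive_cst _ t 1).
have cf := is_derive_continuous df.
split=> t; have [tm|mt] := ltP t m.
- have E : \forall x \near t, (cst (0 : R)) x = f x / x.
    near=> x; rewrite f0 ?mul0r// ltW//; near: x; exact: lt_nbhsl.
  apply: is_derive_eq (near_eq_is_derive E (is_derive_cst _ t 1)) _.
  by rewrite f0 ?(ltW tm)// f'0// !mul0r subrr.
- have t0 : t != 0 by rewrite gt_eqF// (lt_le_trans m0).
  have := is_deriveM (df t) (is_derive_inv t0).
  move=> H; apply: is_derive_eq H _.
  by rewrite /GRing.scale /= mulrN addrC (mulrC t^-1).
- have E : \forall x \near t, (cst (0 : R)) x = f' x / x - f x / x ^+ 2.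
    near=> x; have xm : x < m by near: x; exact: lt_nbhsl.
    by rewrite f0 ?(ltW xm)// f'0// !mul0r subrr.
  rewrite /continuous_at f0 ?(ltW tm)// f'0// !mul0r subrr.
  exact: cvg_trans (near_eq_cvg E) (cvg_cst _).
- have t0 : t != 0 by rewrite gt_eqF// (lt_le_trans m0).
  apply: cvgB; apply: cvgM; [exact: cf'| |exact: cf|].
    by apply: cvgV => //; exact: cvg_id.
  apply: cvgV; first by rewrite expf_neq0.
  by apply: (@cvgM _ _ _ _ id id); exact: cvg_id.
Unshelve. all: by end_near. Qed.

Variable alpha : R.
Hypothesis alpha0 : 0 < alpha.
Variables (S s : R -> R).
Hypothesis Ss : is_smooth_step S s.
Local Notation U := (straighten alpha).
Local Notation wt := (weight alpha).

Definition dX (p : (R * R) * (R * R)) : R := U p.2.1 - U p.1.1.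
Definition dY (p : (R * R) * (R * R)) : R := p.2.2 - p.1.2.

(** The squared euclidean distance of two points in the coordinates
    (straighten x, y). *)
Definition sqdist p : R := dX p ^+ 2 + dY p ^+ 2.

Lemma continuous_dX : continuous dX.
Proof.
have cU := continuous_straighten alpha0.
move=> p; apply: cvgB.
  apply: (@continuous_comp _ _ _ (fun p : (R * R) * (R * R) => p.2.1) U); last exact: cU.
  by apply: (@continuous_comp _ _ _ snd fst); [exact: cvg_snd|exact: cvg_fst].
apply: (@continuous_comp _ _ _ (fun p : (R * R) * (R * R) => p.1.1) U); last exact: cU.
by apply: (@continuous_comp _ _ _ fst fst); [exact: cvg_fst|exact: cvg_fst].
Qed.

Lemma continuous_dY : continuous dY.
Proof.
move=> p; apply: cvgB.
  by apply: (@continuous_comp _ _ _ snd snd); [exact: cvg_snd|exact: cvg_snd].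
by apply: (@continuous_comp _ _ _ fst snd); [exact: cvg_fst|exact: cvg_snd].
Qed.

Lemma continuous_sqdist_comp (f : R -> R) : continuous f -> continuous (fun p => f (sqdist p)).
Proof.
move=> cf p; apply: (@continuous_comp _ _ _ sqdist f); last exact: cf.
by apply: cvgD; apply: (@cvgM _ _ _ _ _ _ _ _) => //;
  [exact: continuous_dX|exact: continuous_dX|exact: continuous_dY|exact: continuous_dY].
Qed.

Lemma is_derive_sq_add (f : R -> R) (f' C x : R) : is_derive x (1 : R) f f' ->
  is_derive x (1 : R) (fun x => f x ^+ 2 + C) (2 * f x * f').
Proof.
move=> df; have := is_deriveD (is_deriveM df df) (is_derive_cst C x 1).
move=> H; apply: is_derive_eq H _; rewrite addr0 /GRing.scale /=; ring.
Qed.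

Lemma is_derive_sqdist_comp (f f' : R -> R) (z w : R * R) :
  (forall t, is_derive t (1 : R) f (f' t)) ->
  [/\ is_derive w.1 (1 : R) (fun x => f (sqdist (z, (x, w.2))))
        (f' (sqdist (z, w)) * (2 * dX (z, w) * wt w.1)),
      is_derive w.2 (1 : R) (fun y => f (sqdist (z, (w.1, y))))
        (f' (sqdist (z, w)) * (2 * dY (z, w))),
      is_derive z.1 (1 : R) (fun x => f (sqdist ((x, z.2), w)))
        (f' (sqdist (z, w)) * (2 * dX (z, w) * - wt z.1)) &
      is_derive z.2 (1 : R) (fun y => f (sqdist ((z.1, y), w)))
        (f' (sqdist (z, w)) * (2 * dY (z, w) * - 1))].
Proof.
case: z w => z1 z2 [w1 w2] df /=; have dU := is_derive_straighten alpha0.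
have D1 := is_deriveB (dU w1) (is_derive_cst (U z1) w1 1).
have D2 := is_deriveB (is_derive_id w2 (1 : R)) (is_derive_cst z2 w2 1).
have D3 := is_deriveB (is_derive_cst (U w1) z1 1) (dU z1).
have D4 := is_deriveB (is_derive_cst w2 z2 1) (is_derive_id z2 (1 : R)).
have comm x y : dX x ^+ 2 + dY y ^+ 2 = dY y ^+ 2 + dX x ^+ 2 by rewrite addrC.
split; apply: (is_derive1_comp (df _)).
- rewrite subr0 in D1.
  exact: (is_derive_sq_add (dY ((z1, z2), (w1, w2)) ^+ 2) D1).
- rewrite subr0 in D2.
  have := is_derive_sq_add (dX ((z1, z2), (w1, w2)) ^+ 2) D2; rewrite mulr1.
  by rewrite (_ : (fun x => sqdist _) = fun x => (x - z2) ^+ 2 +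
    dX ((z1, z2), (w1, w2)) ^+ 2) //; apply/funext => y; exact: comm.
- rewrite sub0r in D3.
  exact: (is_derive_sq_add (dY ((z1, z2), (w1, w2)) ^+ 2) D3).
- rewrite sub0r in D4.
  have := is_derive_sq_add (dX ((z1, z2), (w1, w2)) ^+ 2) D4.
  by rewrite (_ : (fun x => sqdist _) = fun x => (w2 - x) ^+ 2 +
    dX ((z1, z2), (w1, w2)) ^+ 2) //; apply/funext => y; exact: comm.
Qed.

End WeylKernel.

Section WeylInvariance.
Context {R : realType}.
Local Notation mu := (@lebesgue_measure R).
Local Notation mu2 := (plane_measure R).
Variable alpha : R.
Hypothesis alpha0 : 0 < alpha.
Variables (S s : R -> R).
Hypothesis Ss : is_smooth_step S s.
Local Notation U := (straighten alpha).
Local Notation wt := (weight alpha).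
Local Notation dX := (dX alpha).
Local Notation sqdist := (sqdist alpha).

(** A radial profile of mass one concentrated between [e / 2] and [e]. *)
Definition profile (e t : R) : R := 2 / e * s (2 / e * (t - e / 2)).

(** Antiderivative of the difference of two profiles; it vanishes both near 0
    and far away. *)
Definition profile_gap (e e' t : R) : R :=
  S (2 / e * (t - e / 2)) - S (2 / e' * (t - e' / 2)).

Lemma is_derive_profile_gap e e' t :
  is_derive t (1 : R) (profile_gap e e') (profile e t - profile e' t).
Proof.
case: Ss => _ _ dS _ _.
by have := is_deriveB (is_derive_affine_comp (2 / e) (e / 2) dS t)
                      (is_derive_affine_comp (2 / e') (e' / 2) dS t).
Qed.

Lemma continuous_profile e : continuous (profile e).
Proof.
case: Ss => _ ss _ _ _ t; apply: cvgM; first exact: cvg_cst.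
exact: (smooth_continuous (smooth_affine_comp _ _ ss)).
Qed.

Lemma profile_ge0 e t : 0 < e -> 0 <= profile e t.
Proof. by case: Ss => _ _ _ s0 _ e0; rewrite mulr_ge0// divr_ge0// ltW. Qed.

Lemma profile_small e t : 0 < e -> t <= e / 2 -> profile e t = 0.
Proof.
case: Ss => _ _ _ _ [_ _ s0 _] e0 te; rewrite /profile s0 ?mulr0//.
by rewrite pmulr_rle0 ?divr_gt0// subr_le0.
Qed.

Let large_arg (e t : R) : 0 < e -> e <= t -> 1 <= 2 / e * (t - e / 2).
Proof.
move=> e0 et; rewrite mulrAC ler_pdivlMr// mul1r mulrBr mulrCA divff// mulr1; lra.
Qed.

Lemma profile_large e t : 0 < e -> e <= t -> profile e t = 0.
Proof.
case: Ss => _ _ _ _ [_ _ _ s1] e0 te; rewrite /profile s1 ?mulr0//.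
exact: large_arg.
Qed.

Lemma profile_gap_small e e' t : 0 < e -> 0 < e' -> t <= Num.min (e / 2) (e' / 2) ->
  profile_gap e e' t = 0.
Proof.
case: Ss => _ _ _ _ [S0 _ _ _] e0 e'0; rewrite le_min => /andP[te te'].
by rewrite /profile_gap !S0 ?subrr// pmulr_rle0 ?divr_gt0// subr_le0.
Qed.

Lemma profile_gap_large e e' t : 0 < e -> 0 < e' -> e <= t -> e' <= t ->
  profile_gap e e' t = 0.
Proof.
case: Ss => _ _ _ _ [_ S1 _ _] e0 e'0 et e't.
by rewrite /profile_gap !S1 ?subrr//; exact: large_arg.
Qed.

Definition on_boundary (a b c d : R) (w : R * R) :=
  [\/ w.1 = a, w.1 = b, w.2 = c | w.2 = d].

(** The heart of Weyl's lemma. With q the squared distance, (X, Y) the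
    displacement and F q = N q the difference of two cumulative profiles, the
    fields F X and F Y vanish on the boundary of the box, and testing the
    Cauchy-Riemann equations on them makes the integral against
    2 (F + q F') = 2 N' vanish. *)
Lemma profile_integral_invariant a b c d (G h : R * R -> R) z e e' :
  a <= b -> c <= d ->
  (forall w, box a b c d w -> {for w, continuous G}) ->
  (forall w, box a b c d w -> {for w, continuous h}) ->
  weak_CR alpha a b c d G h -> 0 < e -> 0 < e' ->
  (forall w, box a b c d w -> on_boundary a b c d w ->
     e <= sqdist (z, w) /\ e' <= sqdist (z, w)) ->
  \int[mu2]_(w in box a b c d) (G w * wt w.1 * profile e (sqdist (z, w))) =
  \int[mu2]_(w in box a b c d) (G w * wt w.1 * profile e' (sqdist (z, w))) /\
  \int[mu2]_(w in box a b c d) (h w * wt w.1 * profile e (sqdist (z, w))) =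
  \int[mu2]_(w in box a b c d) (h w * wt w.1 * profile e' (sqdist (z, w))).
Proof.
move=> ab cd cG ch CR e0 e'0 far.
have mB := @measurable_box R a b c d.
pose N := profile_gap e e'; pose N' t := profile e t - profile e' t.
have dN := is_derive_profile_gap e e'.
have cN' : continuous N' by move=> t; apply: cvgB; exact: continuous_profile.
pose m := Num.min (e / 2) (e' / 2).
have m0 : 0 < m by rewrite lt_min !divr_gt0.
pose F t := N t / t; pose F' t := N' t / t - N t / t ^+ 2.
have [dF cF'] := is_derive_div_flat m0 dN cN' (fun t => @profile_gap_small e e' t e0 e'0).
have {}dF t : is_derive t (1 : R) F (F' t) by exact: dF.
have {}cF' : continuous F' by exact: cF'.
have cF := is_derive_continuous dF.
have FN t : t * F' t + F t = N' t.
  rewrite /F /F'; have [->|t0] := eqVneq t 0.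
    rewrite invr0 !mulr0 mul0r addr0 /N' !profile_small ?subrr//.
    - by rewrite divr_ge0// ltW.
    - by rewrite divr_ge0// ltW.
  by field.
have slice (H : (R * R) * (R * R) -> R) : continuous H -> continuous (fun w => H (z, w)).
  move=> cH w; apply: (@continuous_comp _ _ _ (fun w => (z, w)) H); last exact: cH.
  exact: (cvg_pair (cvg_cst z) cvg_id).
have cw : continuous (fun w : R * R => wt w.1).
  by move=> w; apply: continuous_comp; [exact: cvg_fst|exact: continuous_weight].
have cX := slice _ (continuous_dX alpha0); have cY := slice _ (@continuous_dY R).
have cq (f : R -> R) : continuous f -> continuous (fun w => f (sqdist (z, w))).
  by move=> cf; exact: (slice (fun p => f (sqdist p)) (continuous_sqdist_comp alpha0 cf)).
pose q w := sqdist (z, w); pose X w := dX (z, w); pose Y w := dY (z, w).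
have F0 w : box a b c d w -> on_boundary a b c d w -> F (q w) = 0.
  move=> Bw bw; have [h1 h2] := far w Bw bw.
  by rewrite /F /N profile_gap_large// mul0r.
pose X1 w := F' (q w) * (2 * X w * wt w.1) * X w + F (q w) * wt w.1.
pose X2 w := F' (q w) * (2 * Y w) * X w.
pose Y1 w := F' (q w) * (2 * X w * wt w.1) * Y w.
pose Y2 w := F' (q w) * (2 * Y w) * Y w + F (q w).
have c2X : continuous (fun w => 2 * X w) by move=> w; apply: cvgM; [exact: cvg_cst|exact: cX].
have c2Y : continuous (fun w => 2 * Y w) by move=> w; apply: cvgM; [exact: cvg_cst|exact: cY].
have cF'q := cq _ cF'; have cFq := cq _ cF.
have cX1 : continuous X1.
  move=> w; apply: cvgD; last by apply: cvgM; [exact: cFq|exact: cw].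
  apply: cvgM; last exact: cX; apply: cvgM; first exact: cF'q.
  by apply: cvgM; [exact: c2X|exact: cw].
have cX2 : continuous X2.
  by move=> w; apply: cvgM; last exact: cX; apply: cvgM; [exact: cF'q|exact: c2Y].
have cY1 : continuous Y1.
  move=> w; apply: cvgM; last exact: cY; apply: cvgM; first exact: cF'q.
  by apply: cvgM; [exact: c2X|exact: cw].
have cY2 : continuous Y2.
  move=> w; apply: cvgD; last exact: cFq.
  by apply: cvgM; last exact: cY; apply: cvgM; [exact: cF'q|exact: c2Y].
have dF12 w := is_derive_sqdist_comp alpha0 z w dF.
have dX1 x y : is_derive x (1 : R) (fun x => X (x, y)) (wt x).
  have := is_deriveB (is_derive_straighten alpha0 x) (is_derive_cst (U z.1) x 1).
  by rewrite subr0.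
have dX2 x y : is_derive y (1 : R) (fun y => X (x, y)) 0.
  exact: (is_derive_cst (U x - U z.1) y (1 : R)).
have dY1 x y : is_derive x (1 : R) (fun x => Y (x, y)) 0.
  exact: (is_derive_cst (y - z.2) x (1 : R)).
have dY2 x y : is_derive y (1 : R) (fun y => Y (x, y)) 1.
  have := is_deriveB (is_derive_id y (1 : R)) (is_derive_cst z.2 y 1).
  by rewrite subr0.
have TX : test_triple a b c d (fun w => F (q w) * X w) X1 X2.
  split=> //.
  - by move=> w; apply: cvgM; [exact: cFq|exact: cX].
  - move=> x y; have [D _ _ _] := dF12 (x, y).
    have := is_deriveM D (dX1 x y) => H; apply: is_derive_eq H _.
    rewrite /GRing.scale /= /X1 /q /X /Y /=; ring.
  - move=> x y; have [_ D _ _] := dF12 (x, y).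
    have := is_deriveM D (dX2 x y) => H; apply: is_derive_eq H _.
    rewrite /GRing.scale /= /X2 /q /X /Y /=; ring.
  - by move=> y cyd; rewrite F0 ?mul0r//; [apply/boxP; rewrite /= lexx ab|exact: Or41].
  - by move=> y cyd; rewrite F0 ?mul0r//; [apply/boxP; rewrite /= lexx ab|exact: Or42].
  - by move=> x axb; rewrite F0 ?mul0r//; [apply/boxP; rewrite /= lexx cd|exact: Or43].
  - by move=> x axb; rewrite F0 ?mul0r//; [apply/boxP; rewrite /= lexx cd|exact: Or44].
have TY : test_triple a b c d (fun w => F (q w) * Y w) Y1 Y2.
  split=> //.
  - by move=> w; apply: cvgM; [exact: cFq|exact: cY].
  - move=> x y; have [D _ _ _] := dF12 (x, y).
    have := is_deriveM D (dY1 x y) => H; apply: is_derive_eq H _.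
    rewrite /GRing.scale /= /Y1 /q /X /Y /=; ring.
  - move=> x y; have [_ D _ _] := dF12 (x, y).
    have := is_deriveM D (dY2 x y) => H; apply: is_derive_eq H _.
    rewrite /GRing.scale /= /Y2 /q /X /Y /=; ring.
  - by move=> y cyd; rewrite F0 ?mul0r//; [apply/boxP; rewrite /= lexx ab|exact: Or41].
  - by move=> y cyd; rewrite F0 ?mul0r//; [apply/boxP; rewrite /= lexx ab|exact: Or42].
  - by move=> x axb; rewrite F0 ?mul0r//; [apply/boxP; rewrite /= lexx cd|exact: Or43].
  - by move=> x axb; rewrite F0 ?mul0r//; [apply/boxP; rewrite /= lexx cd|exact: Or44].
have [WX1 WX2] := CR _ _ _ TX; have [WY1 WY2] := CR _ _ _ TY.
have ib (f k : R * R -> R) : (forall w, box a b c d w -> {for w, continuous f}) ->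
    continuous k -> mu2.-integrable (box a b c d) (EFin \o (fun w => f w * k w)).
  move=> cf ck; apply: continuous_box_integrable => w Bw.
  by apply: cvgM; [exact: cf|exact: ck].
have cwt (k : R * R -> R) : continuous k -> continuous (fun w => wt w.1 * k w).
  by move=> ck w; apply: cvgM; [exact: cw|exact: ck].
have XY w : X1 w + wt w.1 * Y2 w = 2 * (wt w.1 * N' (q w)).
  have Eq : q w = X w ^+ 2 + Y w ^+ 2 by [].
  have := FN (q w); rewrite /X1 /Y2; move: (F' (q w)) (F (q w)) => A B <-.
  by rewrite Eq; ring.
have X2Y1 w : wt w.1 * X2 w = Y1 w by rewrite /X2 /Y1; ring.
have cN'q : continuous (fun w => wt w.1 * N' (q w)) by apply: cwt; exact: cq.
have vanish (f : R * R -> R) : (forall w, box a b c d w -> {for w, continuous f}) ->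
    \int[mu2]_(w in box a b c d) (f w * X1 w) +
    \int[mu2]_(w in box a b c d) (f w * (wt w.1 * Y2 w)) = 0 ->
    \int[mu2]_(w in box a b c d) (f w * wt w.1 * profile e (sqdist (z, w))) =
    \int[mu2]_(w in box a b c d) (f w * wt w.1 * profile e' (sqdist (z, w))).
  move=> cf; have cwY2 := cwt _ cY2.
  rewrite -RintegralD//; [|exact: ib..].
  have -> : \int[mu2]_(w in box a b c d) (f w * X1 w + f w * (wt w.1 * Y2 w)) =
      2 * \int[mu2]_(w in box a b c d) (f w * (wt w.1 * N' (q w))).
    rewrite -RintegralZl//; last exact: ib.
    by apply: eq_Rintegral => w _; rewrite -mulrDr XY; ring.
  move=> /eqP; rewrite mulf_eq0 pnatr_eq0 /= => /eqP E0.
  have ip e'' : mu2.-integrable (box a b c d)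
      (EFin \o (fun w => f w * wt w.1 * profile e'' (sqdist (z, w)))).
    rewrite (_ : (fun w => _) = fun w => f w * (wt w.1 * profile e'' (sqdist (z, w)))).
      by apply: ib => //; apply: cwt; apply: cq; exact: continuous_profile.
    by apply/funext => w; rewrite mulrA.
  apply/eqP; rewrite -subr_eq0 -RintegralB//; apply/eqP; rewrite -[RHS]E0.
  by apply: eq_Rintegral => w _; rewrite /N' /q; ring.
split; apply: vanish => //.
  rewrite WX1 WY2; apply/eqP; rewrite subr_eq0; apply/eqP.
  by apply: eq_Rintegral => w _; rewrite X2Y1.
rewrite -[X in X + _]opprK -WX2 -WY1 addrC; apply/eqP; rewrite subr_eq0; apply/eqP.
by apply: eq_Rintegral => w _; rewrite X2Y1.
Qed.
End WeylInvariance.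

Section DensityOfFullMeasure.
Context {R : realType}.
Local Notation mu := (@lebesgue_measure R).
Local Notation mu2 := (plane_measure R).

Lemma box_measure_gt0 (a b c d : R) : a < b -> c < d -> (0 < mu2 (box a b c d))%E.
Proof.
move=> ab cd.
have -> : mu2 (box a b c d) = (mu `[a, b]%classic * mu `[c, d]%classic)%E.
  exact: product_measure1E.
by rewrite !lebesgue_measure_itv /= !lte_fin ab cd mule_gt0// -EFinB lte_fin subr_gt0.
Qed.

(** A set of full measure meets every open set, because boxes have positive
    measure. *)
Lemma ae_plane_dense (P : R * R -> Prop) (z : R * R) : {ae mu2, forall w, P w} ->
  forall V, nbhs z V -> exists2 w, V w & P w.
Proof.
move=> aeP V /nbhs_ballP[r /= r0 rV].
have r20 : 0 < r / 2 by rewrite divr_gt0.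
apply: contrapT => nP; case: aeP => N [mN N0 PN].
have BN : box (z.1 - r / 2) (z.1 + r / 2) (z.2 - r / 2) (z.2 + r / 2) `<=` N.
  move=> w /boxP[/andP[w1 w2] /andP[w3 w4]]; apply: PN => /= Pw; apply: nP.
  by exists w => //; apply: rV; split; rewrite /ball /= ltr_norml; apply/andP; split; lra.
have h1 : z.1 - r / 2 < z.1 + r / 2 by lra.
have h2 : z.2 - r / 2 < z.2 + r / 2 by lra.
have := box_measure_gt0 h1 h2; rewrite -N0 ltNge => /negP; apply.
by apply: le_measure => //; rewrite inE//; exact: measurable_box.
Qed.

End DensityOfFullMeasure.

Section WeylLemma.
Context {R : realType}.
Local Notation mu := (@lebesgue_measure R).
Local Notation mu2 := (plane_measure R).
Variable alpha : R.
Hypothesis alpha0 : 0 < alpha.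
Local Notation U := (straighten alpha).
Local Notation wt := (weight alpha).
Local Notation sqdist := (sqdist alpha).

Lemma box_interior_nbhs (a b c d : R) z : a < z.1 < b -> c < z.2 < d ->
  exists2 r : R, 0 < r & forall w, `|w.1 - z.1| < r -> `|w.2 - z.2| < r ->
    a < w.1 < b /\ c < w.2 < d.
Proof.
move=> /andP[az zb] /andP[cz zd].
exists (Num.min (Num.min (z.1 - a) (b - z.1)) (Num.min (z.2 - c) (d - z.2))).
  by rewrite !lt_min !subr_gt0 az zb cz zd.
move=> w; rewrite !lt_min !ltr_norml => /andP[/andP[/andP[h1 _] /andP[_ h2]] _].
move=> /andP[_ /andP[/andP[h3 _] /andP[_ h4]]]; split; apply/andP; split; lra.
Qed.

(** Points at small straightened distance are close in both coordinates,
    because the straightening map is strictly increasing. *)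
Lemma sqdist_near z (r : R) : 0 < r -> exists2 e : R, 0 < e &
  forall w, sqdist (z, w) < e -> `|w.1 - z.1| < r /\ `|w.2 - z.2| < r.
Proof.
move=> r0.
have h1 : U z.1 < U (z.1 + r) by apply: straighten_lt => //; lra.
have h2 : U (z.1 - r) < U z.1 by apply: straighten_lt => //; lra.
pose m := Num.min r (Num.min (U (z.1 + r) - U z.1) (U z.1 - U (z.1 - r))).
have m0 : 0 < m by rewrite !lt_min !subr_gt0 r0 h1 h2.
exists (m ^+ 2); first by rewrite exprn_gt0.
move=> w qw; have mono x y : U x < U y -> x < y.
  by move=> xy; rewrite ltNge; apply/negP; rewrite le_eqVlt => /orP[/eqP E|/(straighten_lt alpha0)];
    [move: xy; rewrite E ltxx|move=> /(lt_trans xy); rewrite ltxx].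
have lt_sq (x : R) : x ^+ 2 < m ^+ 2 -> `|x| < m.
  by rewrite -(real_normK (num_real x)) ltr_pXn2r// nnegrE ltW.
have X : `|dX alpha (z, w)| < m.
  by apply: lt_sq; apply: le_lt_trans qw; rewrite lerDl sqr_ge0.
have Y : `|dY (z, w)| < m.
  by apply: lt_sq; apply: le_lt_trans qw; rewrite lerDr sqr_ge0.
move: X Y; rewrite !lt_min /dX /dY /= => /andP[_ /andP[X1 X2]] /andP[Y _]; split=> //.
move: X1 X2; rewrite !ltr_norml => /andP[_ X1] /andP[X2 _].
have h3 : w.1 < z.1 + r by apply: mono; lra.
have h4 : z.1 - r < w.1 by apply: mono; lra.
by apply/andP; split; lra.
Qed.

Lemma is_derive_slice_quotient (f g : R -> R) (f' g' x : R) : g x != 0 ->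
  is_derive x (1 : R) f f' -> is_derive x (1 : R) g g' ->
  is_derive x (1 : R) (fun x => f x / g x) ((f' * g x - f x * g') / g x ^+ 2).
Proof.
move=> g0 df dg; have H := is_deriveM df (is_deriveV g0 dg).
by apply: is_derive_eq H _; rewrite /GRing.scale /=; field.
Qed.

Lemma C1_on_eq V (f f' f1 f2 : R * R -> R) : open V -> (forall z, V z -> f z = f' z) ->
  C1_on V f f1 f2 -> C1_on V f' f1 f2.
Proof.
move=> oV E C z Vz; have [d1 d2 c1 c2] := C z Vz.
have nE : \near z, f z = f' z by apply: filterS (open_nbhs_nbhs (conj oV Vz)).
by split=> //; exact: near_eq_is_derive nE _.
Qed.


Lemma C1_on_div V (f f1 f2 g g1 g2 : R * R -> R) :
  (forall z, V z -> {for z, continuous f}) -> (forall z, V z -> {for z, continuous g}) ->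
  (forall z, V z -> g z != 0) ->
  C1_on V f f1 f2 -> C1_on V g g1 g2 ->
  C1_on V (fun z => f z / g z) (fun z => (f1 z * g z - f z * g1 z) / g z ^+ 2)
    (fun z => (f2 z * g z - f z * g2 z) / g z ^+ 2).
Proof.
move=> cf cg g0 Cf Cg z Vz; have [d1 d2 c1 c2] := Cf z Vz.
have [d1' d2' c1' c2'] := Cg z Vz; have gz := g0 z Vz.
have cq (h h' : R * R -> R) : {for z, continuous h} -> {for z, continuous h'} ->
    {for z, continuous (fun z => (h z * g z - f z * h' z) / g z ^+ 2)}.
  move=> ch ch'; apply: cvgM.
    by apply: cvgB; apply: cvgM; [exact: ch|exact: cg|exact: cf|exact: ch'].
  apply: cvgV; first by rewrite expf_neq0.
  by apply: cvgM; exact: cg.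
split; [| |exact: cq|exact: cq].
- apply/is_derive_slice1; move/is_derive_slice1 : d1 => d1.
  move/is_derive_slice1 : d1' => d1'; case: z gz {Vz d2 d2' c1 c2 c1' c2' cq} d1 d1' => x y gz d1 d1'.
  exact: is_derive_slice_quotient d1 d1'.
- apply/is_derive_slice2; move/is_derive_slice2 : d2 => d2.
  move/is_derive_slice2 : d2' => d2'; case: z gz {Vz d1 d1' c1 c2 c1' c2' cq} d2 d2' => x y gz d2 d2'.
  exact: is_derive_slice_quotient d2 d2'.
Qed.

Variables (S s : R -> R).
Hypothesis Ss : is_smooth_step S s.
Local Notation profile := (profile s).
Variables (a b c d : R).
Hypotheses (ab : a < b) (cd : c < d).
Local Notation B := (box a b c d).
Let mB := @measurable_box R a b c d.

Definition far_from_boundary e z := forall w, B w -> on_boundary a b c d w -> e <= sqdist (z, w).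

(** This solution makes the mass of the radial kernels independent of their
    radius. *)
Lemma weak_CR_constant : weak_CR alpha a b c d (cst 1) (cst 0).
Proof.
move=> psi psi1 psi2 [T0 T1 T2 D1 D2 tl tr tb tt].
have dI (t : R) : is_derive t (1 : R) id ((fun=> 1) t) by exact: is_derive_id.
have cI : continuous ((fun=> 1) : R -> R) by exact: (@cst_continuous R R 1).
have c1 z : B z -> {for z, continuous (cst 1 : R * R -> R)} by move=> _; exact: cst_continuous.
have i0 : mu2.-integrable B (EFin \o (cst 0 : R * R -> R)).
  by apply: continuous_box_integrable => z _; exact: cst_continuous.
have ac a' b' c' d' : ac_on_vertical_lines (cst 1 : R * R -> R) (cst 0 : R * R -> R) a' b' c' d'.
  apply: aeW => x _; split.
    apply: (@continuous_integrable_itv R c' d' (fun=> 0)).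
    exact: (continuous_subspaceT (@cst_continuous R R 0)).
  by move=> p q _ _ _; rewrite subrr; under eq_Rintegral do rewrite /=; rewrite Rintegral_cst// mul0r.
have cw : continuous (fun z : R * R => wt z.1).
  by move=> z; apply: continuous_comp; [exact: cvg_fst|exact: continuous_weight].
have [_ E1] := horizontal_ibp ab c1 i0 (ac c d a b) dI cI T0 T1 D1 (fun y h => conj (tl y h) (tr y h)).
have [||||_ E2] := @vertical_ibp R a b c d (cst 1) (cst 0) (fun z => wt z.1 * psi z)
  (fun z => wt z.1 * psi2 z) id (fun=> 1) cd c1 i0 (ac a b c d) dI cI.
- by move=> z; apply: cvgM; [exact: cw|exact: T0].
- by move=> z; apply: cvgM; [exact: cw|exact: T2].
- move=> x y; exact: (is_deriveZ (wt x) (D2 x y)).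
- by move=> x h; rewrite tb// tt// mulr0.
have z0 (k : R * R -> R) : \int[mu2]_(z in B) ((cst 0 : R * R -> R) z * k z) = 0.
  under eq_Rintegral do rewrite /= mul0r.
  by rewrite /Rintegral integral0.
split; first by rewrite z0 E1; under eq_Rintegral do rewrite /= mul0r mul0r; rewrite /Rintegral integral0 oppr0.
by rewrite z0 E2 oppr0; under eq_Rintegral do rewrite /= mul0r mul0r; rewrite /Rintegral integral0 oppr0.
Qed.

Local Notation I := (kernel_integral a b c d).
Local Notation K e := (fun p => profile e (sqdist p)).

(** The two integrals do not change when the kernel shrinks to the point [z],
    where the factor in front of it is nearly constant. *)
Lemma radial_mean_eq G h e z :
  (forall w, B w -> {for w, continuous G}) ->
  (forall w, B w -> {for w, continuous h}) ->
  weak_CR alpha a b c d G h -> B z -> 0 < e -> far_from_boundary e z ->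
  I (fun w => G w * wt w.1) (K e) z = G z * I (fun w => wt w.1) (K e) z /\
  I (fun w => h w * wt w.1) (K e) z = h z * I (fun w => wt w.1) (K e) z.
Proof.
move=> cG ch CR Bz e0 far.
have cw : continuous (fun z : R * R => wt z.1).
  by move=> w; apply: continuous_comp; [exact: cvg_fst|exact: continuous_weight].
have cK e' : continuous (K e').
  exact: (continuous_sqdist_comp alpha0 (continuous_profile Ss (e := e'))).
have cfw (f : R * R -> R) : (forall w, B w -> {for w, continuous f}) ->
    forall w, B w -> {for w, continuous (fun w => f w * wt w.1)}.
  by move=> cf w Bw; apply: cvgM; [exact: cf|exact: cw].
have c1 w : B w -> {for w, continuous (cst 1 : R * R -> R)} by move=> _; exact: cst_continuous.
have c0 w : B w -> {for w, continuous (cst 0 : R * R -> R)} by move=> _; exact: cst_continuous.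
pose m e' := I (fun w => wt w.1) (K e') z.
have inv e' : 0 < e' -> e' <= e -> [/\
    I (fun w => G w * wt w.1) (K e) z = I (fun w => G w * wt w.1) (K e') z,
    I (fun w => h w * wt w.1) (K e) z = I (fun w => h w * wt w.1) (K e') z &
    m e = m e'].
  move=> e'0 e'e.
  have far' w : B w -> on_boundary a b c d w -> e <= sqdist (z, w) /\ e' <= sqdist (z, w).
    by move=> Bw bw; have := far w Bw bw => h1; split=> //; exact: le_trans h1.
  have [E1 E2] := profile_integral_invariant alpha0 Ss (ltW ab) (ltW cd) cG ch CR e0 e'0 far'.
  have [E3 _] := profile_integral_invariant alpha0 Ss (ltW ab) (ltW cd) c1 c0
    weak_CR_constant e0 e'0 far'.
  split=> //; rewrite /m /kernel_integral; move: E3.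
  by under eq_Rintegral do rewrite /= mul1r; move=> ->; under eq_Rintegral do rewrite /= mul1r.
have m_ge0 e' : 0 < e' -> 0 <= m e'.
  move=> e'0; apply: Rintegral_ge0 => w _; apply: mulr_ge0; first exact: weight_ge0.
  exact: (profile_ge0 Ss).
suff main (f : R * R -> R) : (forall w, B w -> {for w, continuous f}) ->
    (forall e', 0 < e' -> e' <= e ->
      I (fun w => f w * wt w.1) (K e) z = I (fun w => f w * wt w.1) (K e') z) ->
    I (fun w => f w * wt w.1) (K e) z = f z * m e.
  by split; apply: main => // e' e'0 e'e; have [] := inv _ e'0 e'e.
move=> cf invf; apply/eqP; rewrite -subr_eq0 -normr_le0; apply/ler_addgt0Pl => eta eta0.
rewrite addr0.
have eta1 : 0 < eta / (m e + 1) by rewrite divr_gt0// ltr_wpDl// m_ge0.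
have /cvgrPdist_le /(_ _ eta1) /nbhs_ballP[r /= r0 Hr] : f w @[w --> z] --> f z by exact: cf.
have [e1 e10 He1] := sqdist_near z r0.
pose e' := Num.min e e1; have e'0 : 0 < e' by rewrite lt_min e0.
have e'e : e' <= e by rewrite ge_min lexx.
rewrite (invf _ e'0 e'e); have [_ _ Em] := inv _ e'0 e'e.
have iK (k : R * R -> R) : (forall w, B w -> {for w, continuous k}) ->
    mu2.-integrable B (EFin \o (fun w => k w * K e' (z, w))).
  by move=> ck; exact: (@kernel_integrable R a b c d k ck (K e') z (cK e')).
have cwB w : B w -> {for w, continuous (fun w : R * R => wt w.1)} by move=> _; exact: cw.
have icw := iK _ cwB; have ifw := iK _ (cfw _ cf).
have cdf w : B w -> {for w, continuous (fun w => (f w - f z) * wt w.1)}.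
  by apply: cfw => w' Bw'; apply: cvgB; [exact: cf|exact: cvg_cst].
have idf := iK _ cdf.
have -> : I (fun w => f w * wt w.1) (K e') z - f z * m e =
    \int[mu2]_(w in B) ((f w - f z) * wt w.1 * K e' (z, w)).
  rewrite Em /m /kernel_integral -RintegralZl// -RintegralB//; last exact: integrable_scale.
  by apply: eq_Rintegral => w _; ring.
apply: le_trans (le_normr_Rintegral mB idf) _.
apply: (@le_trans _ _ (\int[mu2]_(w in B) (eta / (m e + 1) * (wt w.1 * K e' (z, w))))).
  apply: le_Rintegral => //.
  - exact: (integrable_abse idf).
  - exact: integrable_scale.
  move=> w Bw; have pw := profile_ge0 Ss (sqdist (z, w)) e'0.
  rewrite normrM (normrM (f w - f z)) (ger0_norm (weight_ge0 _ _)) (ger0_norm pw).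
  rewrite -mulrA; have [wf|wn] := ltP (sqdist (z, w)) e'; last first.
    by rewrite (profile_large Ss e'0 wn) !mulr0.
  apply: ler_wpM2r; first by rewrite mulr_ge0// weight_ge0.
  rewrite distrC; apply: Hr.
  have [|h1 h2] := He1 w; first by apply: lt_le_trans wf _; rewrite ge_min lexx orbT.
  by split; rewrite /ball /= distrC.
rewrite RintegralZl// -[X in _ * X]/(m e') -Em mulrAC ler_pdivrMr ?ltr_wpDl ?m_ge0//.
by rewrite ler_pM2l// lerDl.
Qed.

(** The kernel is positive at a point straight above [z], close enough to stay
    in the box. *)
Lemma radial_mass_gt0 e z : (forall w, B w -> w.1 != 0) ->
  a < z.1 < b -> c < z.2 < d -> 0 < e -> far_from_boundary e z ->
  0 < I (fun w => wt w.1) (K e) z.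
Proof.
move=> wB /andP[az zb] /andP[cz zd] e0 far.
have cw : continuous (fun z : R * R => wt z.1).
  by move=> w; apply: continuous_comp; [exact: cvg_fst|exact: continuous_weight].
pose f w := wt w.1 * profile e (sqdist (z, w)).
have cf : continuous f.
  move=> w; apply: cvgM; first exact: cw.
  apply: (@continuous_comp _ _ _ (fun w => (z, w)) (K e)).
    exact: (cvg_pair (cvg_cst z) cvg_id).
  exact: (continuous_sqdist_comp alpha0 (continuous_profile Ss (e := e))).
have f0 w : 0 <= f w by rewrite mulr_ge0 ?weight_ge0//; exact: (profile_ge0 Ss).
have [_ _ dS _ [S0 S1 _ _]] := Ss.
have [t0 /andP[t00 t01]] := MVT_everywhere ltr01 dS.
rewrite S1// S0// !subr0 mulr1 => /esym st0.
pose t := e / 2 * (t0 + 1).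
have t_gt0 : 0 < t by rewrite mulr_gt0// ?divr_gt0//; lra.
have te : t < e.
  by rewrite /t -mulrA gtr_pMr//; lra.
pose w := (z.1, z.2 + Num.sqrt t).
have qw : sqdist (z, w) = t.
  by rewrite /sqdist /dX /dY /= subrr expr0n add0r addrAC subrr add0r sqr_sqrtr// ltW.
have tB : z.2 + Num.sqrt t < d.
  have := far (z.1, d); rewrite /sqdist /dX /dY /= subrr expr0n add0r => /(_ _ _)/(lt_le_trans te) H.
  have : t < (d - z.2) ^+ 2.
    by apply: H; [apply/boxP; rewrite /= lexx (ltW az) (ltW zb) (ltW cd)|exact: Or44].
  rewrite -ltrBrDl -{1}(sqr_sqrtr (ltW t_gt0)) ltr_pXn2r// nnegrE ?sqrtr_ge0//; lra.
have st_ge0 : 0 <= Num.sqrt t by exact: sqrtr_ge0.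
have Bw : B w by apply/boxP; rewrite /= !ltW//; lra.
have fw : 0 < f w.
  rewrite /f qw mulr_gt0 ?weight_gt0 ?wB// /profile.
  have -> : 2 / e * (t - e / 2) = t0 by rewrite /t; field; rewrite gt_eqF.
  by rewrite st0 mulr1 divr_gt0.
have mf : measurable_fun B f by apply: continuous_plane_measurable => // w' _; exact: cf.
have If : mu2.-integrable B (EFin \o f) by apply: continuous_box_integrable => w' _; exact: cf.
rewrite lt_neqAle; apply/andP; split; last by apply: Rintegral_ge0 => w' _; exact: f0.
apply/eqP => /esym I0.
have E0 : (\int[mu2]_(w in B) `|(EFin \o f) w|)%E = 0.
  transitivity (\int[mu2]_(w in B) (EFin \o f) w)%E.
    by apply: eq_integral => w' _; rewrite /= ger0_norm.
  rewrite -[LHS]fineK; last exact: integrable_fin_num If.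
  by rewrite [fine _]I0.
have /(ae_eq_integral_abs mu2 mB) : measurable_fun B (EFin \o f) by exact/measurable_EFinP.
move=> /proj1/(_ E0) ae0.
have [V1 V2] : nbhs w [set w' | 0 < f w'] /\ nbhs w B.
  split; first exact: (@cvgr_gt _ _ _ _ f (f w) (cf w) 0 fw).
  have [|//|r r0 Hr] := @box_interior_nbhs a b c d w; first by rewrite /= az.
    by rewrite /=; apply/andP; split=> //; rewrite (lt_le_trans cz)// lerDl.
  apply/nbhs_ballP; exists r => //= w' [/= h1 h2].
  rewrite /ball /= distrC in h1; rewrite /ball /= distrC in h2.
  have [/andP[/ltW a1 /ltW a2] /andP[/ltW a3 /ltW a4]] := Hr w' h1 h2.
  by apply/boxP; rewrite a1 a2 a3 a4.
have [w' [f'w Bw'] /(_ Bw') /= [Ef]] := ae_plane_dense ae0 (filterI V1 V2).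
by move: f'w; rewrite /= Ef ltxx.
Qed.

(** Weyl's lemma for the Cauchy-Riemann equations: a continuous weak solution
    is the quotient of two integrals against a radial kernel of class C^1. *)
Lemma weyl_regularity G h z0 : (forall w, B w -> w.1 != 0) ->
  (forall w, B w -> {for w, continuous G}) ->
  (forall w, B w -> {for w, continuous h}) ->
  weak_CR alpha a b c d G h -> a < z0.1 < b -> c < z0.2 < d ->
  exists V G1 G2 h1 h2, [/\ open V, V z0, V `<=` B, C1_on V G G1 G2 & C1_on V h h1 h2].
Proof.
move=> wB cG ch CR z01 z02.
have [r r0 Hr] := box_interior_nbhs z01 z02.
have [e1 e10 He1] := sqdist_near z0 r0.
pose e := e1 / 2; have e0 : 0 < e by rewrite divr_gt0.
have cq : continuous sqdist by exact: (continuous_sqdist_comp alpha0 (f := id) (fun x => cvg_id)).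
have N1 := near_uniform_on_compact z0 cq (@compact_box R a b c d) e0.
have N2 : nbhs z0 [set z | a < z.1 < b /\ c < z.2 < d].
  apply/nbhs_ballP; exists r => //= w' [/= h1 h2].
  by rewrite /ball /= distrC in h1; rewrite /ball /= distrC in h2; exact: Hr.
have : nbhs z0 [set z | far_from_boundary e z /\ (a < z.1 < b /\ c < z.2 < d)].
  apply: filterS (filterI N1 N2) => z [H1 H2]; split=> // w Bw bw.
  have H := H1 w Bw; have : e1 <= sqdist (z0, w).
    rewrite leNgt; apply/negP => /He1[h1 h2].
    have [/andP[a1 a2] /andP[a3 a4]] := Hr w h1 h2.
    by case: bw => E; [move: a1|move: a2|move: a3|move: a4]; rewrite E ltxx.
  by move: H; rewrite ltr_norml /e => /andP[]; lra.
rewrite nbhsE => -[V [oV Vz0] HV].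
have VB z : V z -> B z.
  by move=> /HV[_ [/andP[/ltW a1 /ltW a2] /andP[/ltW a3 /ltW a4]]]; apply/boxP; rewrite a1 a2 a3 a4.
have [_ /smooth_derivative[s' [ss' ds']] _ _ _] := Ss.
have cs' := smooth_continuous ss'.
pose p' t := 2 / e * (2 / e * s' (2 / e * (t - e / 2))).
have dp t : is_derive t (1 : R) (profile e) (p' t).
  exact: (is_deriveZ (2 / e) (is_derive_affine_comp (2 / e) (e / 2) ds' t)).
have cp' : continuous p'.
  move=> t; apply: cvgM; first exact: cvg_cst.
  apply: cvgM; first exact: cvg_cst.
  exact: (smooth_continuous (smooth_affine_comp _ _ ss')).
have cw : continuous (fun z : R * R => wt z.1).
  by move=> w; apply: continuous_comp; [exact: cvg_fst|exact: continuous_weight].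
pose K1 p := p' (sqdist p) * (2 * dX alpha p * - wt p.1.1).
pose K2 (p : (R * R) * (R * R)) := p' (sqdist p) * (2 * dY p * - 1).
have cK : continuous (K e).
  exact: (continuous_sqdist_comp alpha0 (continuous_profile Ss (e := e))).
have cp'q : continuous (fun p => p' (sqdist p)) by exact: (continuous_sqdist_comp alpha0 cp').
have cK1 : continuous K1.
  move=> p; apply: cvgM; first exact: cp'q.
  apply: cvgM; first by apply: cvgM; [exact: cvg_cst|exact: continuous_dX].
  apply: cvgN; apply: (@continuous_comp _ _ _ (fun p : (R * R) * (R * R) => p.1) (fun z => wt z.1)).
    exact: cvg_fst.
  exact: cw.
have cK2 : continuous K2.
  move=> p; apply: cvgM; first exact: cp'q.
  by apply: cvgM; [apply: cvgM; [exact: cvg_cst|exact: continuous_dY]|exact: cvg_cst].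
have dK1 w x y : is_derive x (1 : R) (fun x => K e ((x, y), w)) (K1 ((x, y), w)).
  by have [_ _ D _] := is_derive_sqdist_comp alpha0 (x, y) w dp.
have dK2 w x y : is_derive y (1 : R) (fun y => K e ((x, y), w)) (K2 ((x, y), w)).
  by have [_ _ _ D] := is_derive_sqdist_comp alpha0 (x, y) w dp.
have cwB w : B w -> {for w, continuous (fun w : R * R => wt w.1)} by move=> _; exact: cw.
have m0 z : V z -> I (fun w => wt w.1) (K e) z != 0.
  by move=> /HV[far [z1 z2]]; rewrite gt_eqF// radial_mass_gt0.
have C1I k : (forall w, B w -> {for w, continuous k}) ->
   C1_on V (I k (K e)) (I k K1) (I k K2).
  by move=> ck; apply: C1_kernel_integral.
have cI (k : R * R -> R) : (forall w, B w -> {for w, continuous k}) ->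
   forall z, V z -> {for z, continuous (I k (K e))}.
  by move=> ck z _; apply: kernel_integral_continuous.
have C1q (f : R * R -> R) : (forall w, B w -> {for w, continuous f}) ->
    (forall z, V z -> I (fun w => f w * wt w.1) (K e) z = f z * I (fun w => wt w.1) (K e) z) ->
    exists f1 f2, C1_on V f f1 f2.
  move=> cf Ef; have ck w : B w -> {for w, continuous (fun w => f w * wt w.1)}.
    by move=> Bw; apply: cvgM; [exact: cf|exact: cw].
  have H := C1_on_div (cI _ ck) (cI _ cwB) m0 (C1I _ ck) (C1I _ cwB).
  eexists; eexists; apply: C1_on_eq oV _ H.
  by move=> z Vz; rewrite Ef// mulfK// m0.
have [G1 [G2 HG]] : exists f1 f2, C1_on V G f1 f2.
  apply: C1q => // z Vz; have [far [z1 z2]] := HV z Vz.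
  by have [-> _] := radial_mean_eq cG ch CR (VB z Vz) e0 far.
have [h1 [h2 Hh]] : exists f1 f2, C1_on V h f1 f2.
  apply: C1q => // z Vz; have [far [z1 z2]] := HV z Vz.
  by have [_ ->] := radial_mean_eq cG ch CR (VB z Vz) e0 far.
by exists V, G1, G2, h1, h2.
Qed.
End WeylLemma.

(** * Total variation and absolute continuity *)

Section Chains.
Context {R : realType}.
Implicit Types (x y s t : R) (l : seq (R * R)).

(** Finite families of non-overlapping intervals, listed from left to right
    between [x] and [y]. *)
Fixpoint chain x l y : Prop :=
  if l is p :: l' then [/\ x <= p.1, p.1 <= p.2 & chain p.2 l' y] else x <= y.

Definition total_length l : R := \sum_(p <- l) (p.2 - p.1).
Definition oscillation (f : R -> R) l : R := \sum_(p <- l) `|f p.2 - f p.1|.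

Lemma chain_le x l y : chain x l y -> x <= y.
Proof.
elim: l x => //= p l IH x [xp pp /IH py].
by rewrite (le_trans xp)// (le_trans pp).
Qed.

Lemma chain_weaken x x' l y y' : x' <= x -> y <= y' -> chain x l y -> chain x' l y'.
Proof.
elim: l x x' => [|p l IH] x x' /= x'x yy'; first by move=> xy; rewrite (le_trans x'x)// (le_trans xy).
by move=> [xp pp C]; split=> //; [exact: le_trans xp|exact: IH C].
Qed.

Lemma chain_cat x l y l' z : chain x l y -> chain y l' z -> chain x (l ++ l') z.
Proof.
elim: l x => [|p l IH] x /=; first by move=> xy; exact: chain_weaken.
by move=> [xp pp C] C'; split=> //; exact: IH.
Qed.

Lemma total_length_le x l y : chain x l y -> total_length l <= y - x.
Proof.
rewrite /total_length; elim: l x => [|p l IH] x /=; first by rewrite big_nil subr_ge0.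
by move=> [xp pp /IH h]; rewrite big_cons; lra.
Qed.

Lemma chain_split f x l y m : x <= m -> m <= y -> chain x l y -> exists l1 l2,
  [/\ chain x l1 m, chain m l2 y & oscillation f l <= oscillation f l1 + oscillation f l2].
Proof.
rewrite /oscillation; elim: l x => [|p l IH] x xm my /=.
  by move=> xy; exists [::], [::]; rewrite !big_nil addr0.
move=> [xp pp C]; have [mp1|/ltW p1m] := leP m p.1.
  exists [::], (p :: l); rewrite big_nil add0r; split=> //.
have [mp2|/ltW p2m] := leP m p.2.
  exists [:: (p.1, m)], ((m, p.2) :: l); split.
  - by split=> //=.
  - by split=> //=.
  rewrite !big_cons big_nil /= addr0 addrA lerD2r.
  by rewrite addrC ler_distD.
have [l1 [l2 [C1 C2 E]]] := IH p.2 p2m my C.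
exists (p :: l1), l2; split=> //.
by rewrite !big_cons -addrA lerD2l.
Qed.

(** Absolute continuity in terms of chains, which can be split, concatenated
    and refined by induction. *)
Definition AC_chain a b (f : R -> R) := forall e : R, 0 < e -> exists2 d : R, 0 < d &
  forall l, chain a l b -> total_length l < d -> oscillation f l < e.

Lemma AC_chain_sub a b f h : AC_chain a b f -> AC_chain a b h -> AC_chain a b (fun x => f x - h x).
Proof.
move=> Af Ah e e0; have e20 : 0 < e / 2 by rewrite divr_gt0.
have [d d0 Hd] := Af _ e20; have [d' d'0 Hd'] := Ah _ e20.
exists (Num.min d d'); first by rewrite lt_min d0.
move=> l C; rewrite lt_min => /andP[h1 h2].
have := Hd l C h1; have := Hd' l C h2.
suff : oscillation (fun x => f x - h x) l <= oscillation f l + oscillation h l by lra.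
rewrite /oscillation -big_split /=; apply: ler_sum => p _.
apply: le_trans (ler_normB _ _); rewrite [X in `|X| <= _](_ : _ = f p.2 - f p.1 - (h p.2 - h p.1))//.
by ring.
Qed.

Section Variation.
Variables (a b : R) (f : R -> R).
Hypotheses (ab : a <= b) (ACf : AC_chain a b f).

(** Each piece of length at most [d / 2] contributes at most 1. *)
Lemma bounded_oscillation : exists B : R, forall x l y, a <= x -> y <= b -> chain x l y ->
  oscillation f l <= B.
Proof.
have [d d0 Hd] := ACf ltr01; have d20 : 0 < d / 2 by rewrite divr_gt0.
have step (k : nat) : forall x l y, a <= x -> y <= b -> chain x l y -> y - x <= k%:R * (d / 2) ->
    oscillation f l <= k%:R.
  elim: k => [|k IH] x l y ax yb C.
    rewrite mul0r subr_le0 => yx.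
    have L0 : total_length l < d by rewrite (le_lt_trans (total_length_le C))//; lra.
    have E (l0 : seq (R * R)) x0 y0 : y0 <= x0 -> chain x0 l0 y0 -> oscillation f l0 = 0.
      rewrite /oscillation; elim: l0 x0 => [|p l0 IH] x0 y0x0 /=; first by rewrite big_nil.
      move=> [h1 h2 C0]; have h3 := chain_le C0.
      have E : p.2 = p.1 by lra.
      by rewrite big_cons E subrr normr0 add0r; apply: (IH p.2) => //; lra.
    by rewrite (E _ _ _ yx C).
  move=> H; have [xy|/ltW h] := leP y (x + d / 2).
    have L0 : total_length l < d by rewrite (le_lt_trans (total_length_le C))//; lra.
    have := Hd l (chain_weaken ax yb C) L0; rewrite -natr1.
    by have : 0 <= k%:R :> R by []; lra.
  have xm : x <= x + d / 2 by lra.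
  have [l1 [l2 [C1 C2 E]]] := chain_split f xm h C.
  have L1 : total_length l1 < d by rewrite (le_lt_trans (total_length_le C1))//; lra.
  have h1 := Hd l1 (chain_weaken ax (le_trans h yb) C1) L1.
  have h2 : oscillation f l2 <= k%:R.
    by apply: (IH (x + d / 2) l2 y) => //; [lra|move: H; rewrite -natr1; lra].
  by rewrite -natr1; lra.
have [k kb] : exists k : nat, (b - a) / (d / 2) < k%:R.
  by exists (Num.truncn ((b - a) / (d / 2))).+1; exact: truncnS_gt.
exists k%:R => x l y ax yb C; apply: (step k _ _ _ ax yb C).
by rewrite ltr_pdivrMr// in kb; lra.
Qed.

(** Total variation over [x, y]. *)
Definition variation_on x y : R := sup [set oscillation f l | l in [set l | chain x l y]].

Let has_sup_var x y : a <= x -> x <= y -> y <= b ->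
  has_sup [set oscillation f l | l in [set l | chain x l y]].
Proof.
move=> ax xy yb; split; first by exists (oscillation f [::]), [::].
by have [B HB] := bounded_oscillation; exists B => _ [l C <-]; exact: HB C.
Qed.

Lemma variation_ge x l y : a <= x -> y <= b -> chain x l y -> oscillation f l <= variation_on x y.
Proof.
move=> ax yb C; apply: sup_upper_bound; last by exists l.
by apply: has_sup_var => //; exact: chain_le C.
Qed.

Lemma variation_approx x y e : a <= x -> x <= y -> y <= b -> 0 < e ->
  exists2 l, chain x l y & variation_on x y < oscillation f l + e.
Proof.
move=> ax xy yb e0; have [_ [l C <-] h] := sup_adherent e0 (has_sup_var ax xy yb).
by exists l => //; rewrite /variation_on; lra.
Qed.

Lemma variation_superadditive x y : a <= x -> x <= y -> y <= b ->
  variation_on a y - variation_on a x <= variation_on x y.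
Proof.
move=> ax xy yb; rewrite lerBlDr; apply/ler_addgt0Pr => e e0.
have [l C /ltW h] := variation_approx (lexx a) (le_trans ax xy) yb e0.
apply: le_trans h _; rewrite lerD2r.
have [l1 [l2 [C1 C2 E]]] := chain_split f ax xy C.
apply: le_trans E _; rewrite addrC.
by apply: lerD; apply: variation_ge => //; exact: le_trans yb.
Qed.

Lemma variation_increment x y : a <= x -> x <= y -> y <= b ->
  `|f y - f x| <= variation_on a y - variation_on a x.
Proof.
move=> ax xy yb; rewrite lerBrDr; apply/ler_addgt0Pr => e e0.
have [l C /ltW h] := variation_approx (lexx a) ax (le_trans xy yb) e0.
have C' : chain a (l ++ [:: (x, y)]) y by apply: chain_cat C _; split=> //=.
have := variation_ge (lexx a) yb C'.
by rewrite /oscillation big_cat /= big_seq1 /=; move: h; rewrite /oscillation; lra.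
Qed.

(** Replacing each interval by a partition that nearly achieves its variation
    does not increase the total length, which is how the variation inherits
    absolute continuity. *)
Lemma refine_chain l x e : a <= x -> chain x l b -> 0 < e -> exists l',
  [/\ chain x l' b, total_length l' <= total_length l &
      \sum_(p <- l) variation_on p.1 p.2 <= oscillation f l' + e].
Proof.
rewrite /oscillation /total_length; elim: l x e => [|p l IH] x e ax /=.
  by move=> xb e0; exists [::]; rewrite !big_nil add0r; split=> //; exact: ltW.
move=> [xp pp C] e0; have e20 : 0 < e / 2 by rewrite divr_gt0.
have ap : a <= p.1 by exact: le_trans xp.
have pb := chain_le C.
have [l' [C' L' V']] := IH p.2 (e / 2) (le_trans ap pp) C e20.
have [k Ck Vk] := variation_approx ap pp pb e20.
exists (k ++ l'); split.
- by apply: chain_cat C'; exact: chain_weaken Ck.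
- rewrite big_cat big_cons /=; apply: lerD => //; exact: total_length_le Ck.
- by rewrite big_cat big_cons /=; move: Vk; rewrite /oscillation; lra.
Qed.

Lemma AC_variation : AC_chain a b (variation_on a).
Proof.
move=> e e0; have e20 : 0 < e / 2 by rewrite divr_gt0.
have [d d0 Hd] := ACf e20; exists d => // l C L.
have [l' [C' L' V']] := refine_chain (lexx a) C e20.
have := Hd l' C' (le_lt_trans L' L).
suff : oscillation (variation_on a) l <= \sum_(p <- l) variation_on p.1 p.2 by lra.
suff gen k x : a <= x -> chain x k b ->
    oscillation (variation_on a) k <= \sum_(p <- k) variation_on p.1 p.2 by exact: (gen l a).
rewrite /oscillation; elim: k x => [|p k IH] x; first by rewrite !big_nil.
move=> ax [xp pp {}C]; rewrite !big_cons lerD//; last exact: IH (le_trans ax (le_trans xp pp)) C.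
have ap := le_trans ax xp; have pb := chain_le C.
rewrite ger0_norm; first exact: variation_superadditive.
by apply: le_trans (variation_increment ap pp pb).
Qed.

End Variation.
End Chains.

(** * Absolutely continuous functions are indefinite integrals *)

Section MonotoneAC.
Context {R : realType}.
Local Notation lam := (@lebesgue_measure R).
Implicit Types (x y : R) (l : seq (R * R)).
Variables (a b : R) (F : R -> R).
Hypotheses (ab : a < b) (ndF : {homo F : x y / x <= y}) (cF : continuous F).
Hypothesis ACF : AC_chain a b F.

Let rcF : right_continuous F.
Proof. exact: right_continuousW. Qed.

HB.instance Definition _ := isCumulative.Build R _ R F ndF rcF.

Let nu : {measure set (measurableTypeR R) -> \bar R} := lebesgue_stieltjes_measure F.

Lemma stieltjes_itv x y : x <= y -> nu (`]x, y]%classic : set (measurableTypeR R)) = (F y - F x)%:E.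
Proof.
move=> xy; rewrite /nu /= /lebesgue_stieltjes_measure /measure_extension measurable_mu_extE//; last exact: is_ocitv.
exact: (wlength_itv_bnd F false false xy).
Qed.

Definition chain_set l : set (measurableTypeR R) :=
  foldr (fun p A => `]p.1, p.2]%classic `|` A) set0 l.

Lemma measurable_chain_set l : measurable (chain_set l).
Proof. by elim: l => [|p l IH] /=; [exact: measurable0|apply: measurableU]. Qed.

Lemma chain_set_sub x l y : chain x l y -> chain_set l `<=` `]x, y].
Proof.
elim: l x => [|p l IH] x; first by move=> _ t [].
move=> [xp pp C] t [tp|/(IH _ C) tl].
  move: tp; rewrite /= !in_itv /= => /andP[h1 h2].
  by rewrite (le_lt_trans xp)// (le_trans h2)//; exact: chain_le C.
move: tl; rewrite /= !in_itv /= => /andP[h1 ->].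
by rewrite (le_lt_trans xp)// (le_lt_trans pp).
Qed.

Lemma chain_set_length x l y : chain x l y -> lam (chain_set l) = (total_length l)%:E.
Proof.
rewrite /total_length; elim: l x => [|p l IH] x /=; first by rewrite measure0 big_nil.
move=> [xp pp C].
transitivity (lam (`]p.1, p.2]%classic : set (measurableTypeR R)) + lam (chain_set l))%E; first apply: measureU => //; last first.
- rewrite big_cons EFinD (IH _ C); congr (_ + _)%E.
  rewrite lebesgue_measure_itv /= lte_fin; have [_|h] := ltP p.1 p.2; first by rewrite EFinB.
  have -> : p.1 = p.2 by apply/eqP; rewrite eq_le pp h.
  by rewrite subrr.
- apply/seteqP; split=> // t [/= + /(chain_set_sub C)]; rewrite !in_itv /= => /andP[_ h1] /andP[h2 _].
  by have := le_lt_trans h1 h2; rewrite ltxx.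
- exact: measurable_chain_set.
Qed.

Lemma chain_set_stieltjes x l y : chain x l y -> (nu (chain_set l) <= (oscillation F l)%:E)%E.
Proof.
rewrite /oscillation; elim: l x => [|p l IH] x /=; first by rewrite measure0 big_nil.
move=> [xp pp C]; rewrite big_cons EFinD.
apply: (@le_trans _ _ (nu (`]p.1, p.2]%classic : set (measurableTypeR R)) + nu (chain_set l))%E).
  by apply: measureU2 => //; exact: measurable_chain_set.
apply: leeD; last exact: IH C.
by rewrite stieltjes_itv// lee_fin ler_norm.
Qed.

Let node (n k : nat) : R := a + (b - a) * (k%:R / (2 ^ n)%:R).

Let node_le n k k' : (k <= k')%N -> node n k <= node n k'.
Proof.
move=> kk; rewrite lerD2l ler_wpM2l ?subr_ge0 ?(ltW ab)// ler_wpM2r ?invr_ge0//.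
by rewrite ler_nat.
Qed.

Let node0 n : node n 0 = a. Proof. by rewrite /node mul0r mulr0 addr0. Qed.

Let nodeN n : node n (2 ^ n) = b.
Proof. by rewrite /node divff ?pnatr_eq0 ?expn_eq0// mulr1 addrC subrK. Qed.

Let node_double n k : node n.+1 k.*2 = node n k.
Proof.
rewrite /node expnS -muln2 !natrM; congr (_ + _ * _).
by field; rewrite pnatr_eq0 expn_eq0.
Qed.

Variable O : set R.
Hypothesis oO : open O.

Let cell n k : set R := `]node n k, node n k.+1]%classic.
Let cells n : seq (R * R) :=
  [seq (node n k, node n k.+1) | k <- iota 0 (2 ^ n) & `[< cell n k `<=` O >]].

Let chain_cells n : chain a (cells n) b.
Proof.
suff gen m N : chain (node n m) [seq (node n k, node n k.+1) | k <- iota m N & `[< cell n k `<=` O >]]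
    (node n (m + N)).
  by have := gen 0%N (2 ^ n)%N; rewrite node0 add0n nodeN.
elim: N m => [|N IH] m /=; first by rewrite addn0.
rewrite addnS -addSn; case: ifP => _ /=; last first.
  by apply: chain_weaken (IH m.+1) => //; exact: node_le.
by split=> //; exact: node_le.
Qed.

Let cellsP n x : chain_set (cells n) x <->
  exists k, [/\ (k < 2 ^ n)%N, cell n k `<=` O & cell n k x].
Proof.
rewrite /cells; have -> : (exists k, [/\ (k < 2 ^ n)%N, cell n k `<=` O & cell n k x]) <->
   (exists k, [/\ k \in iota 0 (2 ^ n), cell n k `<=` O & cell n k x]).
  by split=> -[k [h1 h2 h3]]; exists k; split=> //; move: h1; rewrite mem_iota.
elim: (iota 0 (2 ^ n)) => [|k s IH] /=; first by split=> // -[k []].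
case: asboolP => h /=; rewrite IH; split.
- by case=> [xk|[j [js jO jx]]]; [exists k; rewrite inE eqxx|exists j; rewrite inE js orbT].
- by move=> [j [+ jO jx]]; rewrite inE => /orP[/eqP <-|js]; [left|right; exists j].
- by move=> [j [js jO jx]]; exists j; rewrite inE js orbT.
- by move=> [j [+ jO jx]]; rewrite inE => /orP[/eqP ej|js]; [rewrite ej in jO|exists j].
Qed.

Let cells_sub n : chain_set (cells n) `<=` O.
Proof. by move=> x /cellsP[k [_ kO /kO]]. Qed.

Let cells_mono n : chain_set (cells n) `<=` chain_set (cells n.+1).
Proof.
move=> x /cellsP[k [kn kO xk]]; apply/cellsP.
have kn2 : (k.*2.+1 < 2 ^ n.+1)%N by rewrite expnS mul2n -doubleS leq_double.
have cO j : cell n.+1 j `<=` cell n k -> cell n.+1 j `<=` O by move=> h y /h/kO.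
have E1 := node_double n k; have E2 := node_double n k.+1.
have h1 : node n.+1 k.*2 <= node n.+1 k.*2.+1 by exact: node_le.
have h2 : node n.+1 k.*2.+1 <= node n.+1 k.+1.*2 by apply: node_le; rewrite doubleS.
move: xk; rewrite /cell /= in_itv /= => /andP[x1 x2].
have [xm|mx] := leP x (node n.+1 k.*2.+1).
  exists k.*2; split; first exact: ltnW.
  - apply: cO => y; rewrite /cell /= !in_itv /= E1 => /andP[-> y2] /=.
    by rewrite (le_trans y2)// (le_trans h2)// E2.
  - by rewrite /cell /= in_itv /= E1 x1.
exists k.*2.+1; split=> //.
- apply: cO => y; rewrite /cell /= !in_itv /= -doubleS E2 => /andP[y1 ->].
  by rewrite -E1 (le_lt_trans h1 y1).
- by rewrite /cell /= in_itv /= -doubleS E2 mx.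
Qed.

Let cells_exhaust x : O x -> a < x <= b -> exists n, chain_set (cells n) x.
Proof.
move=> Ox /andP[ax xb]; have /nbhs_ballP[r /= r0 rO] : nbhs x O by exact: open_nbhs_nbhs.
have [n hn] : exists n : nat, (b - a) / (2 ^ n)%:R < r.
  exists (Num.truncn ((b - a) / r)).+1.
  rewrite ltr_pdivrMr ?ltr0n ?expn_gt0// mulrC -ltr_pdivrMr//.
  apply: lt_trans (truncnS_gt _) _; rewrite ltr_nat; exact: ltn_expl.
exists n; apply/cellsP.
have [k [kn xk]] : exists k, (k < 2 ^ n)%N /\ cell n k x.
  have : node n 0 < x <= node n (2 ^ n) by rewrite node0 nodeN ax.
  elim: (2 ^ n)%N => [|N IH]; first by move=> /andP[h1 h2]; have := lt_le_trans h1 h2; rewrite ltxx.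
  move=> /andP[h1 h2]; have [h|h] := leP x (node n N).
    by have [|k [kN xk]] := IH; [rewrite h1|exists k; split=> //; exact: ltnW].
  by exists N; split=> //; rewrite /cell /= in_itv /= h.
exists k; split=> // y; move: xk; rewrite /cell /= !in_itv /= => /andP[x1 x2] /andP[y1 y2].
apply: rO; have E : node n k.+1 = node n k + (b - a) / (2 ^ n)%:R.
  by rewrite /node -natr1; ring.
by rewrite /ball /= ltr_norml; apply/andP; split; lra.
Qed.

(** Within ]a, b] the open set is the increasing union of the dyadic cells that it contains;
    the cells of one level form a chain, to which absolute continuity
    applies. *)
Lemma stieltjes_open_small e d :
  (forall l, chain a l b -> total_length l < d -> oscillation F l < e) ->
  (lam O < d%:E)%E -> (nu ((O : set (measurableTypeR R)) `&` `]a, b]%classic) <= e%:E)%E.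
Proof.
move=> Hd Od.
have mU : measurable (\bigcup_n chain_set (cells n)).
  by apply: bigcup_measurable => n _; exact: measurable_chain_set.
have mO : measurable (O : set (measurableTypeR R)) by exact: open_measurable.
apply: (@le_trans _ _ (nu (\bigcup_n chain_set (cells n)))).
  apply: le_measure; rewrite ?inE//; first exact: measurableI.
  by move=> x [Ox]; rewrite /= in_itv /= => /(cells_exhaust Ox)[n h]; exists n.
have homo : {homo (fun n => chain_set (cells n)) : n m / (n <= m)%N >-> (n <= m)%O}.
  by apply/nondecreasing_seqP => n; rewrite subsetEset; exact: cells_mono.
have cv := @nondecreasing_cvg_mu _ _ _ nu _ (fun n => measurable_chain_set (cells n)) mU homo.
rewrite -(cvg_lim _ cv)//; apply: lime_le; first by apply/cvg_ex; eexists; exact: cv.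
near=> n; apply: le_trans (chain_set_stieltjes (chain_cells n)) _.
rewrite lee_fin; apply/ltW/Hd; first exact: chain_cells.
rewrite -lte_fin -(chain_set_length (chain_cells n)); apply: le_lt_trans Od.
apply: le_measure; rewrite ?inE//; first exact: measurable_chain_set.
Unshelve. all: by end_near. Qed.

End MonotoneAC.

Section DensityOfAC.
Context {R : realType}.
Local Notation lam := (@lebesgue_measure R).

(** An absolutely continuous monotone function defines a finite measure
    dominated by Lebesgue measure; its density is the derivative sought. *)
Lemma monotone_AC_primitive (a b : R) (F : R -> R) : a < b ->
  {homo F : x y / x <= y} -> continuous F -> AC_chain a b F ->
  exists v : R -> R, is_primitive a b F v.
Proof.
move=> ab ndF cF ACF.
pose C := Cumulative.Pack (Cumulative.Class (isCumulative.Build R _ R F ndF (right_continuousW cF))).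
pose nu := lebesgue_stieltjes_measure C.
have nuI x y : x <= y -> nu (`]x, y]%classic : set (measurableTypeR R)) = (F y - F x)%:E.
  exact: (stieltjes_itv ndF cF).
have mI : measurable (`]a, b]%classic : set (measurableTypeR R)) by [].
have fI : (nu (`]a, b]%classic : set (measurableTypeR R)) < +oo)%E by rewrite nuI ?ltry// ltW.
pose nu' : {finite_measure set (measurableTypeR R) -> \bar R} := mfrestr mI fI.
have dom : nu' `<< lam.
  move=> A nA B mB BA.
  have B0 : (lebesgue_measure B <= 0)%E.
    by rewrite le_eqVlt; apply/orP; left; apply/eqP; exact: nA B mB BA.
  apply/eqP; rewrite eq_le measure_ge0 andbT; apply/lee_addgt0Pr => e e0; rewrite add0e.
  have [d d0 Hd] := ACF e e0.
  have [W [oO BO Od]] := lebesgue_regularity_outer mB (le_lt_trans B0 (ltry 0)) d0.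
  have mO : measurable (W : set (measurableTypeR R)) by exact: open_measurable.
  have Od' : (lam W < d%:E)%E.
    have -> : W = B `|` (W `\` B) by rewrite setDUK.
    apply: le_lt_trans (measureU2 _ _ _) _ => //; first exact: measurableD.
    by apply: le_lt_trans (leeD B0 (lexx _)) _; rewrite add0e.
  have small : (nu ((W : set (measurableTypeR R)) `&` `]a, b]%classic) <= e%:E)%E.
    exact: (stieltjes_open_small ab ndF cF oO Hd Od').
  apply: (le_trans _ small).
  rewrite /nu' /= /mfrestr /mrestr; apply: le_measure; rewrite ?inE//; try exact: measurableI.
  exact: setSI.
have [f [f0 ffin fint fE]] := radon_nikodym_sigma_finite dom.
have Ef : EFin \o (fine \o f) = f by apply/funext => x /=; rewrite fineK.
exists (fine \o f); split.
  rewrite Ef; apply: integrableS fint => //.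
move=> p q ap pq qb; rewrite /Rintegral.
have -> : (\int[lam]_(t in `]p, q]) ((fine \o f) t)%:E)%E = nu' (`]p, q]%classic : set (measurableTypeR R)).
  by rewrite fE//; apply: eq_integral => x _ /=; rewrite fineK.
rewrite /nu' /= /mfrestr /mrestr setIidl; first by have := nuI p q pq; rewrite /nu => ->.
by move=> x; rewrite /= !in_itv /= => /andP[h1 h2]; rewrite (le_lt_trans ap h1) (le_trans h2 qb).
Qed.

End DensityOfAC.

Section AbsoluteContinuity.
Context {R : realType}.
Local Notation lam := (@lebesgue_measure R).
Implicit Types (a b x y : R) (f v : R -> R) (l : seq (R * R)).

Lemma chain_mem x l y p : chain x l y -> p \in l -> [/\ x <= p.1, p.1 <= p.2 & p.2 <= y].
Proof.
elim: l x => //= q l IH x [xq qq C]; rewrite inE => /orP[/eqP ->|pl].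
  by split=> //; exact: chain_le C.
by have [h1 h2 h3] := IH _ C pl; split=> //; rewrite (le_trans xq)// (le_trans qq).
Qed.

Lemma AC_chain_ext a b f h : (forall x, a <= x <= b -> f x = h x) ->
  AC_chain a b f -> AC_chain a b h.
Proof.
move=> E Af e e0; have [d d0 Hd] := Af e e0; exists d => // l C L.
rewrite (_ : oscillation h l = oscillation f l) ?Hd//.
apply: eq_big_seq => p /(chain_mem C)[h1 h2 h3].
by rewrite !E// ?h1 ?h3 ?(le_trans h1 h2) ?(le_trans h2 h3).
Qed.

Definition clamp a b x : R := Num.max a (Num.min x b).

Lemma clamp_id a b x : a <= x <= b -> clamp a b x = x.
Proof. by move=> /andP[ax xb]; rewrite /clamp (min_idPl xb) (max_idPr ax). Qed.

Lemma clamp_itv a b x : a <= b -> a <= clamp a b x <= b.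
Proof. by move=> ab; rewrite /clamp le_max lexx ge_max ab ge_min lexx orbT. Qed.

Lemma clamp_homo a b x y : x <= y -> clamp a b x <= clamp a b y.
Proof.
move=> xy; rewrite /clamp ge_max !le_max lexx /= le_min !ge_min xy lexx !orbT //.
Qed.

Lemma clamp_diff a b x y : a <= b -> x <= y -> clamp a b y - clamp a b x <= y - x.
Proof.
move=> ab xy; rewrite /clamp /Num.max /Num.min.
by case: (ltP y b) => ?; case: (ltP x b) => ?; case: (ltP a y) => ?; case: (ltP a x) => ?;
  case: (ltP a b) => ?; lra.
Qed.

Lemma nondecreasing_AC_primitive a b f : a < b ->
  (forall x y, a <= x -> x <= y -> y <= b -> f x <= f y) -> AC_chain a b f ->
  exists v, is_primitive a b f v.
Proof.
move=> ab nf Af; have ab' := ltW ab; pose F x := f (clamp a b x).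
have EF x : a <= x <= b -> f x = F x by move=> h; rewrite /F clamp_id.
have AF := AC_chain_ext EF Af.
have nF : {homo F : x y / x <= y}.
  move=> x y xy; have /andP[h1 _] := clamp_itv x ab'; have /andP[_ h2] := clamp_itv y ab'.
  by apply: nf => //; exact: clamp_homo.
have cF : continuous F.
  move=> x; apply/cvgrPdist_lt => e e0; have [d d0 Hd] := Af e e0.
  have step s t : s <= t -> t - s < d -> `|F t - F s| < e.
    move=> st ts; have := Hd [:: (clamp a b s, clamp a b t)].
    rewrite /total_length /oscillation !big_seq1 /=; apply.
      have /andP[h1 _] := clamp_itv s ab'; have /andP[_ h2] := clamp_itv t ab'.
      by split=> //; exact: clamp_homo.
    by apply: le_lt_trans ts; exact: clamp_diff.
  apply/nbhs_ballP; exists d => //= y; rewrite /ball /= => xy.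
  have [yx|/ltW xy'] := leP y x; first by apply: step => //; move: xy; rewrite ger0_norm// subr_ge0.
  by rewrite distrC; apply: step => //; move: xy; rewrite distrC ger0_norm// subr_ge0.
have [v [iv Ev]] := monotone_AC_primitive ab nF cF AF; exists v; split=> // p q ap pq qb.
by rewrite !EF ?Ev// ?ap ?qb ?(le_trans ap pq) ?(le_trans pq qb).
Qed.

Lemma is_primitive_sub a b f h v w : is_primitive a b f v -> is_primitive a b h w ->
  is_primitive a b (fun x => f x - h x) (fun x => v x - w x).
Proof.
move=> [iv Ev] [iw Ew]; split; first exact: integrable_sub.
move=> p q ap pq qb; have sub : `]p, q]%classic `<=` `[a, b]%classic.
  by move=> t; rewrite /= !in_itv /= => /andP[h1 h2]; rewrite (le_trans ap (ltW h1)) (le_trans h2 qb).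
rewrite RintegralB//; [|exact: (integrable_sub_itv iv sub)|exact: (integrable_sub_itv iw sub)].
by rewrite -Ev// -Ew//; ring.
Qed.

(** Both the variation of [f] and its excess over [f] are monotone and
    absolutely continuous. *)
Theorem AC_chain_primitive a b f : a <= b -> AC_chain a b f -> exists v, is_primitive a b f v.
Proof.
rewrite le_eqVlt => /orP[/eqP <-|ab] Af.
  exists (fun=> 0); split; first by apply: continuous_integrable_itv; exact: (continuous_subspaceT (@cst_continuous R R 0)).
  move=> p q ap pq qa; have -> : p = q by apply/eqP; rewrite eq_le pq (le_trans qa ap).
  by rewrite subrr Rintegral_cst// mul0r.
have ab' := ltW ab; pose V := variation_on f a.
have AV : AC_chain a b V by exact: AC_variation.
have AW : AC_chain a b (fun x => V x - f x) by exact: AC_chain_sub.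
have inc x y : a <= x -> x <= y -> y <= b -> `|f y - f x| <= V y - V x by exact: variation_increment.
have [v Pv] : exists v, is_primitive a b V v.
  by apply: nondecreasing_AC_primitive => // x y ax xy yb; rewrite -subr_ge0 (le_trans _ (inc _ _ ax xy yb)).
have [w Pw] : exists w, is_primitive a b (fun x => V x - f x) w.
  apply: nondecreasing_AC_primitive => // x y ax xy yb.
  by have := inc _ _ ax xy yb; have := ler_norm (f y - f x); lra.
exists (fun x => v x - w x); have := is_primitive_sub Pv Pw.
by rewrite (_ : (fun x => V x - (V x - f x)) = f)//; apply/funext => x; ring.
Qed.

Lemma chain_disjoint x l y (i j : nat) : chain x l y -> (i < j < size l)%N ->
  (nth (0, 0) l i).2 <= (nth (0, 0) l j).1.
Proof.
elim: l x i j => [|p l IH] x i j; first by rewrite ltn0 andbF.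
move=> [xp pp C]; case: i => [|i]; case: j => [|j] //=; rewrite !ltnS => h.
  by have [] := chain_mem C (mem_nth (0, 0) h).
exact: IH C h.
Qed.

Lemma coord_le_eucl_dist (z w : R * R) : `|w.1 - z.1| <= eucl_dist z w /\ `|w.2 - z.2| <= eucl_dist z w.
Proof.
by split; rewrite -sqrtr_sqr /eucl_dist ler_sqrt ?addr_ge0 ?sqr_ge0// -sqrrN opprB ?lerDl ?lerDr sqr_ge0.
Qed.

Lemma eucl_dist_le (z w : R * R) : eucl_dist z w <= `|w.1 - z.1| + `|w.2 - z.2|.
Proof.
have h : 0 <= `|w.1 - z.1| + `|w.2 - z.2| by rewrite addr_ge0.
rewrite -(ger0_norm h) -sqrtr_sqr /eucl_dist ler_sqrt ?sqr_ge0//.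
rewrite [leRHS]sqrrD !real_normK ?num_real// -(sqrrN (z.1 - _)) -(sqrrN (z.2 - _)) !opprB.
by rewrite addrAC lerDl mulrn_wge0// mulr_ge0.
Qed.

Lemma absolutely_continuous_chain a b (gam : R -> R * R) : absolutely_continuous a b gam ->
  AC_chain a b (fun t => (gam t).1) /\ AC_chain a b (fun t => (gam t).2).
Proof.
move=> A; suff main e : 0 < e -> exists2 d : R, 0 < d & forall l, chain a l b ->
    total_length l < d -> \sum_(p <- l) eucl_dist (gam p.1) (gam p.2) < e.
  split=> e e0; have [d d0 Hd] := main e e0; exists d => // l C L;
    apply: le_lt_trans (Hd l C L); apply: ler_sum => p _;
    by have [] := coord_le_eucl_dist (gam p.1) (gam p.2).
move=> e0; have [d d0 Hd] := A e e0; exists d => // l C L.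
rewrite big_tnth; apply: (Hd _ (fun i => (tnth (in_tuple l) i).1) (fun i => (tnth (in_tuple l) i).2)).
- by move=> i; have [] := chain_mem C (mem_tnth i (in_tuple l)).
- have dis (i j : 'I_(size l)) : (i < j)%N ->
      (tnth (in_tuple l) i).2 <= (tnth (in_tuple l) j).1.
    move=> ij; rewrite !(tnth_nth (0, 0)) /=; apply: chain_disjoint C _.
    by rewrite ij ltn_ord.
  move=> i j _ _ [t [/= /andP[i1 i2] /andP[j1 j2]]].
  case: (ltngtP i j) => [/dis h|/dis h|/val_inj//].
    by have := lt_trans (lt_le_trans i2 h) j1; rewrite ltxx.
  by have := lt_trans (lt_le_trans j2 h) i1; rewrite ltxx.
- by move: L; rewrite /total_length big_tnth.
Qed.

(** Absolute continuity of the integral, applied to the disjoint union of the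
    intervals. *)
Theorem primitive_absolutely_continuous a b (gam : R -> R * R) v w :
  is_primitive a b (fun t => (gam t).1) v -> is_primitive a b (fun t => (gam t).2) w ->
  absolutely_continuous a b gam.
Proof.
move=> [iv Ev] [iw Ew] e e0.
have mI : measurable (`[a, b]%classic : set (measurableTypeR R)) by [].
pose k t := `|v t| + `|w t|.
have ik : lam.-integrable `[a, b] (EFin \o k).
  by apply: integrable_add => //; exact: (integrable_norm _).
pose K := k \_ `[a, b].
have iK : lam.-integrable setT (EFin \o K).
  by rewrite /K -restrict_EFin; apply/integrable_restrict => //; rewrite setTI.
have [d [d0 Hd]] := integral_normr_continuous iK e0.
exists d => // n s t st dis len.
have sub i : `]s i, t i]%classic `<=` `[a, b]%classic.
  have [h1 [h2 h3]] := st i; move=> x; rewrite /= !in_itv /= => /andP[h4 h5].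
  by rewrite (le_trans h1 (ltW h4)) (le_trans h5 h3).
pose I (i : 'I_n) : set (measurableTypeR R) := `]s i, t i]%classic.
have mII i : measurable (I i) by exact: measurable_itv.
have trivI : trivIset [set: 'I_n] I.
  move=> i j _ _ [x []]; rewrite /I /= !in_itv /= => /andP[i1 i2] /andP[j1 j2].
  have m1 : Num.max (s i) (s j) < x by rewrite gt_max i1.
  apply: dis => //; exists ((Num.max (s i) (s j) + x) / 2); split=> /=; apply/andP.
    have : s i <= Num.max (s i) (s j) by rewrite le_max lexx.
    by split; lra.
  have : s j <= Num.max (s i) (s j) by rewrite le_max lexx orbT.
  by split; lra.
pose D : set (measurableTypeR R) := \big[setU/set0]_(i <- index_enum 'I_n) I i.
have mD : measurable D by apply: bigsetU_measurable.
have lD : (lam D < d%:E)%E.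
  have -> : lam D = \sum_(i < n) lam (I i).
    rewrite -[LHS]mul1e -(integral_cst lam mD 1%E) ge0_integral_bigsetU//.
    - by apply: eq_bigr => i _; rewrite integral_cst// mul1e.
    - exact: index_enum_uniq.
    - by apply: sub_trivIset trivI.
  rewrite (eq_bigr (fun i => (t i - s i)%:E)); last first.
    move=> i _; rewrite /I lebesgue_measure_itv /= lte_fin; have [_ [h _]] := st i.
    by move: h; rewrite le_eqVlt => /orP[/eqP ->|->]; rewrite ?ltxx ?subrr// EFinB.
  by rewrite sumEFin lte_fin.
have := Hd D mD lD; apply: le_lt_trans.
have E : \int[lam]_(x in D) `|K x| = \sum_(i < n) \int[lam]_(x in I i) `|K x|.
  rewrite /Rintegral ge0_integral_bigsetU//.
  - rewrite -sum_fine// => i _; apply: integrable_fin_num => //.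
    apply: integrableS (integrable_norm iK) => //.
  - exact: index_enum_uniq.
  - by apply: sub_trivIset trivI.
  - apply/measurable_EFinP; apply: measurableT_comp => //.
    by apply: measurable_funS (integrable_measurable iK).
rewrite E; apply: ler_sum => i _; have [h1 [h2 h3]] := st i.
apply: le_trans (eucl_dist_le _ _) _.
rewrite (Ev _ _ h1 h2 h3) (Ew _ _ h1 h2 h3).
have iv' := integrable_sub_itv iv (sub i); have iw' := integrable_sub_itv iw (sub i).
apply: le_trans (lerD (le_normr_Rintegral _ iv') (le_normr_Rintegral _ iw')) _ => //.
rewrite -RintegralD//; [|exact: (integrable_norm iv')|exact: (integrable_norm iw')].
rewrite le_eqVlt; apply/orP; left; apply/eqP; apply: eq_Rintegral => x; rewrite inE => /sub xab.
by rewrite /K patchE mem_set// /k [RHS]ger0_norm// addr_ge0.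
Qed.

End AbsoluteContinuity.

(** * Increments of functions of two variables *)

Section PlaneCalculus.
Context {R : realType}.
Implicit Types (z w : R * R).

Lemma is_derive_continuous_at (f : R -> R) (x l : R) : is_derive x (1 : R) f l ->
  {for x, continuous f}.
Proof. by move=> [d _]; apply/differentiable_continuous/derivable1_diffP. Qed.

Lemma increment_mean (f f' : R -> R) (s t : R) : s <= t ->
  (forall x, s <= x <= t -> {for x, continuous f}) ->
  (forall x, s < x < t -> is_derive x (1 : R) f (f' x)) ->
  exists2 c : R, s <= c <= t & f t - f s = f' c * (t - s).
Proof.
rewrite le_eqVlt => /orP[/eqP->|st] cf df.
  by exists t; rewrite ?lexx// !subrr mulr0.
have dfI x : x \in `]s, t[ -> is_derive x (1 : R) f (f' x) by rewrite in_itv /=; exact: df.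
have cfI : {within `[s, t], continuous f}.
  by apply: continuous_itv_within => x /cf.
have [c] := MVT st dfI cfI.
by rewrite in_itv /= => /andP[/ltW h1 /ltW h2] E; exists c; rewrite ?h1.
Qed.

Lemma increment_between (f f' : R -> R) (s t : R) :
  (forall x, `|x - s| <= `|t - s| -> is_derive x (1 : R) f (f' x)) ->
  exists2 c : R, `|c - s| <= `|t - s| & f t - f s = f' c * (t - s).
Proof.
move=> df; have cf x (h : `|x - s| <= `|t - s|) := is_derive_continuous_at (df x h).
have [st|/ltW ts] := leP s t.
  have bd x : s <= x <= t -> `|x - s| <= `|t - s|.
    by move=> /andP[h1 h2]; rewrite !ger0_norm ?subr_ge0// lerB.
  have cf' x : s <= x <= t -> {for x, continuous f} by move=> /bd/cf.
  have df' x : s < x < t -> is_derive x (1 : R) f (f' x).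
    by move=> /andP[/ltW h1 /ltW h2]; apply/df/bd; rewrite h1 h2.
  by have [c /bd h E] := increment_mean st cf' df'; exists c.
have bd x : t <= x <= s -> `|x - s| <= `|t - s|.
  by move=> /andP[h1 h2]; rewrite distrC (distrC t) !ger0_norm ?subr_ge0// lerB.
have cf' x : t <= x <= s -> {for x, continuous f} by move=> /bd/cf.
have df' x : t < x < s -> is_derive x (1 : R) f (f' x).
  by move=> /andP[/ltW h1 /ltW h2]; apply/df/bd; rewrite h1 h2.
have [c /bd h E] := increment_mean ts cf' df'; exists c => //.
by rewrite -opprB E -mulrN opprB.
Qed.

Lemma near_ball z (P : R * R -> Prop) : (\forall w \near z, P w) ->
  exists2 r : R, 0 < r & forall w, `|w.1 - z.1| < r -> `|w.2 - z.2| < r -> P w.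
Proof.
move=> /nbhs_ballP[r /= r0 H]; exists r => // w h1 h2; apply: H.
by split; rewrite /ball /= distrC.
Qed.

Lemma ball_near z (P : R * R -> Prop) (r : R) : 0 < r ->
  (forall w, `|w.1 - z.1| < r -> `|w.2 - z.2| < r -> P w) -> \forall w \near z, P w.
Proof.
move=> r0 H; apply/nbhs_ballP; exists r => //= w [h1 h2].
by apply: H; rewrite distrC.
Qed.

(** Differentiability in the form of Caratheodory. The coefficients are partial
    derivatives at intermediate points on the two sides of the rectangle
    spanned by [z] and [w]. *)
Lemma caratheodory (f f1 f2 : R * R -> R) z :
  (\forall w \near z, is_derive w (e1 : R * R) f (f1 w) /\ is_derive w (e2 : R * R) f (f2 w)) ->
  {for z, continuous f1} -> {for z, continuous f2} ->
  exists A B : R * R -> R, [/\ A w @[w --> z] --> f1 z, B w @[w --> z] --> f2 z &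
    \forall w \near z, f w - f z = A w * (w.1 - z.1) + B w * (w.2 - z.2)].
Proof.
move=> /near_ball[r r0 df] c1 c2.
pose good w (ab : R * R) := f w - f z = f1 (ab.1, w.2) * (w.1 - z.1) + f2 (z.1, ab.2) * (w.2 - z.2)
  /\ `|ab.1 - z.1| <= `|w.1 - z.1| /\ `|ab.2 - z.2| <= `|w.2 - z.2|.
have ex w : exists ab, `|w.1 - z.1| < r -> `|w.2 - z.2| < r -> good w ab.
  have [h|nh] := pselect (`|w.1 - z.1| < r /\ `|w.2 - z.2| < r); last first.
    by exists z => h1 h2; exfalso; exact: nh.
  have [h1 h2] := h.
  have [x hx|a ha Ea] := @increment_between (fun x => f (x, w.2)) (fun x => f1 (x, w.2)) z.1 w.1.
    have [D _] := df (x, w.2) (le_lt_trans hx h1) h2.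
    by move/is_derive_slice1 : D.
  have [y hy|b hb Eb] := @increment_between (fun y => f (z.1, y)) (fun y => f2 (z.1, y)) z.2 w.2.
    have [|_ D] := df (z.1, y) _ (le_lt_trans hy h2); first by rewrite subrr normr0.
    by move/is_derive_slice2 : D.
  exists (a, b) => _ _; split => //=.
  rewrite -Ea -Eb; case: (w) (z) => w1 w2 [z1 z2] /=; ring.
have [s Hs] := choice ex.
exists (fun w => f1 ((s w).1, w.2)), (fun w => f2 (z.1, (s w).2)); split.
- apply/cvgrPdist_lt => e e0.
  have /cvgrPdist_lt/(_ _ e0)/near_ball[r' r'0 H] : f1 w @[w --> z] --> f1 z by exact: c1.
  apply: (@ball_near z _ (Num.min r r')); first by rewrite lt_min r0.
  move=> w; rewrite !lt_min => /andP[h1 h1'] /andP[h2 h2'].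
  have [_ [ha _]] := Hs w h1 h2.
  by apply: H => //=; exact: le_lt_trans ha h1'.
- apply/cvgrPdist_lt => e e0.
  have /cvgrPdist_lt/(_ _ e0)/near_ball[r' r'0 H] : f2 w @[w --> z] --> f2 z by exact: c2.
  apply: (@ball_near z _ (Num.min r r')); first by rewrite lt_min r0.
  move=> w; rewrite !lt_min => /andP[h1 h1'] /andP[h2 h2'].
  have [_ [_ hb]] := Hs w h1 h2.
  by apply: H => //=; [rewrite subrr normr0|exact: le_lt_trans hb h2'].
- by apply: (ball_near r0) => w h1 h2; have [] := Hs w h1 h2.
Qed.

Variable alpha : R.
Hypothesis alpha0 : 0 < alpha.
Local Notation wt := (weight alpha).

(** A bounded function cannot have, off the axis, a vertical derivative of
    size at least [c / wt x]: on vertical segments close to the axis it would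
    oscillate arbitrarily much. *)
Lemma vertical_blow_up (F : R * R -> R) z0 (M c : R) : z0.1 = 0 -> 0 < c ->
  (\forall z \near z0, z.1 != 0 -> `|F z| <= M) ->
  (\forall z \near z0, z.1 != 0 -> exists2 l : R, is_derive z (e2 : R * R) F l &
     c <= wt z.1 * `|l|) -> False.
Proof.
move=> z00 c0 nM nD; have [r r0 H] := near_ball (filterI nM nD).
have M1 : 0 < `|M| + 1 by rewrite ltr_wpDl.
pose eps := c * (r / 2) / (2 * (`|M| + 1)).
have eps0 : 0 < eps by rewrite divr_gt0 ?mulr_gt0// divr_gt0.
have /cvgrPdist_lt /(_ _ eps0) /nbhs_ballP[r' /= r'0 Hr'] : wt x @[x --> (0 : R)] --> wt 0.
  exact: continuous_weight.
pose x := Num.min r r' / 2.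
have x0 : 0 < x by rewrite divr_gt0// lt_min r0.
have xr : x < Num.min r r' by rewrite /x ltr_pdivrMr// ltr_pMr ?lt_min ?r0// ltr1n.
move: xr; rewrite lt_min => /andP[xr xr'].
have wx : wt x < eps.
  have := Hr' x; rewrite /ball /= sub0r normrN (gtr0_norm x0) => /(_ xr').
  by rewrite weight0// sub0r normrN ger0_norm// weight_ge0.
have xn0 : x != 0 by rewrite gt_eqF.
have near_x y : z0.2 <= y <= z0.2 + r / 2 -> `|F (x, y)| <= M /\
    exists2 l : R, is_derive y (1 : R) (fun y => F (x, y)) l & c <= wt x * `|l|.
  move=> /andP[y1 y2]; have [||h1 h2] := H (x, y).
  - by rewrite /= z00 subr0 gtr0_norm.
  - rewrite /= ger0_norm ?subr_ge0//; lra.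
  have [l /is_derive_slice2 D cl] := h2 xn0; split; first exact: h1.
  by exists l.
have [f' Hf'] : exists f' : R -> R, forall y, z0.2 <= y <= z0.2 + r / 2 ->
    is_derive y (1 : R) (fun y => F (x, y)) (f' y) /\ c <= wt x * `|f' y|.
  have /choice[f' Hf'] : forall y, exists l : R, z0.2 <= y <= z0.2 + r / 2 ->
      is_derive y (1 : R) (fun y => F (x, y)) l /\ c <= wt x * `|l|.
    move=> y; have [h|nh] := pselect (z0.2 <= y <= z0.2 + r / 2); last by exists 0 => /nh.
    by have [_ [l D cl]] := near_x y h; exists l.
  by exists f'.
have ab : z0.2 < z0.2 + r / 2 by rewrite ltrDl divr_gt0.
have [||y yI E] := @increment_mean (fun y => F (x, y)) f' _ _ (ltW ab).
- by move=> y /Hf'[D _]; exact: is_derive_continuous_at D.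
- by move=> y /andP[/ltW h1 /ltW h2]; have [|] := Hf' y; rewrite ?h1.
have [_ cf'] := Hf' y yI.
have [|B1 _] := near_x z0.2; first by rewrite lexx ltW.
have [|B2 _] := near_x (z0.2 + r / 2); first by rewrite lexx ltW.
have r20 : 0 < r / 2 by rewrite divr_gt0.
have osc : `|f' y| * (r / 2) <= 2 * (`|M| + 1).
  rewrite -[r / 2]gtr0_norm// -normrM.
  have -> : f' y * (r / 2) = F (x, z0.2 + r / 2) - F (x, z0.2) by rewrite E; ring.
  have MM : M <= `|M| by exact: ler_norm.
  by apply: le_trans (ler_normB _ _) _; lra.
have T0 : 0 < 2 * (`|M| + 1) by rewrite mulr_gt0.
have h3 : c * (r / 2) <= wt x * (`|f' y| * (r / 2)) by rewrite [leRHS]mulrA ler_pM2r.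
have h4 : wt x * (`|f' y| * (r / 2)) <= wt x * (2 * (`|M| + 1)).
  by rewrite ler_wpM2l// weight_ge0.
have h5 : wt x * (2 * (`|M| + 1)) < c * (r / 2).
  by rewrite -(divfK (lt0r_neq0 T0) (c * (r / 2))) ltr_pM2r.
by have := le_lt_trans (le_trans h3 h4) h5; rewrite ltxx.
Qed.

End PlaneCalculus.

(** * Functions along curves *)

Section CurveCalculus.
Context {R : realType}.
Local Notation lam := (@lebesgue_measure R).
Implicit Types (a b s t : R) (z w : R * R).

Lemma integrable_dominated_ae (A : set (measurableTypeR R)) (f h : R -> R) : measurable A ->
  measurable_fun A f -> lam.-integrable A (EFin \o h) ->
  {ae lam, forall x, A x -> `|f x| <= h x} -> lam.-integrable A (EFin \o f).
Proof.
move=> mA mf ih fh; have mef : measurable_fun A (EFin \o f) by exact/measurable_EFinP.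
apply/integrableP; split=> //; have /integrableP[mh hfin] := ih.
apply: le_lt_trans hfin; apply: ae_ge0_le_integral => //.
- exact: measurableT_comp.
- exact: measurableT_comp.
- by apply: aeS fh => x H Ax /=; rewrite lee_fin (le_trans (H Ax))// ler_norm.
Qed.

Lemma le_Rintegral_ae (A : set (measurableTypeR R)) (f h : R -> R) : measurable A ->
  lam.-integrable A (EFin \o f) -> lam.-integrable A (EFin \o h) ->
  {ae lam, forall x, A x -> f x <= h x} ->
  \int[lam]_(x in A) f x <= \int[lam]_(x in A) h x.
Proof.
move=> mA If Ih fh; rewrite -subr_ge0 -RintegralB//.
rewrite (_ : \int[lam]_(x in A) (h x - f x) = \int[lam]_(x in A) `|h x - f x|).
  exact: Rintegral_ge0.
have Is : lam.-integrable A (EFin \o (fun x => h x - f x)) by exact: integrable_sub.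
apply: (@eq_Rintegral_ae _ _ _ lam) => //.
- exact: (integrable_norm Is).
- by apply: aeS fh => x H Ax; rewrite ger0_norm// subr_ge0 H.
Qed.

Lemma ae_derive_primitive a b (f v : R -> R) : is_primitive a b f v ->
  {ae lam, forall t, t \in `]a, b[ -> is_derive t (1 : R) f (v t)}.
Proof.
move=> [iv Ev]; apply: aeS (ae_derive_integral iv) => t H tab.
have E : \forall x \near t, f a + \int[lam]_(s in `[a, x]) v s = f x.
  near=> x; have /andP[ax xb] : a < x < b by near: x; exact: near_in_itvoo.
  have -> : f x = f a + (f x - f a) by ring.
  rewrite Ev ?lexx ?(ltW ax) ?(ltW xb)//; congr (_ + _).
  by rewrite -(Rintegral_itv_diff iv) ?lexx ?(ltW ax) ?(ltW xb)// set_itv1 Rintegral_set1 subr0.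
apply: near_eq_is_derive E _.
by have := is_deriveD (is_derive_cst (f a) t (1 : R)) (H tab); rewrite add0r.
Unshelve. all: by end_near. Qed.

Lemma is_derive_cvgP (V W : normedModType R) (f : V -> W) (c v : V) (l : W) :
  is_derive c v f l <-> (r^-1 *: (f (r *: v + c) - f c)) @[r --> (0 : R)^'] --> l.
Proof.
split=> [[d <-]|L]; first exact: d.
split; first by apply/cvg_ex; exists l.
by apply: cvg_lim L; exact: norm_hausdorff.
Qed.

Lemma is_derive_pairP (gam : R -> R * R) t (x y : R) :
  is_derive t (1 : R) gam (x, y) <->
  is_derive t (1 : R) (fun s => (gam s).1) x /\ is_derive t (1 : R) (fun s => (gam s).2) y.
Proof.
rewrite !is_derive_cvgP; split=> [H|[H1 H2]]; last exact: (cvg_pair H1 H2).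
split.
- exact: (cvg_comp _ _ H (@cvg_fst _ _ (nbhs x) (nbhs y) _)).
- exact: (cvg_comp _ _ H (@cvg_snd _ _ (nbhs x) (nbhs y) _)).
Qed.

Lemma is_derive_along (f A B : R * R -> R) (gam : R -> R * R) t (x y lx ly : R) :
  A w @[w --> gam t] --> lx -> B w @[w --> gam t] --> ly ->
  (\forall w \near gam t, f w - f (gam t) = A w * (w.1 - (gam t).1) + B w * (w.2 - (gam t).2)) ->
  is_derive t (1 : R) (fun s => (gam s).1) x -> is_derive t (1 : R) (fun s => (gam s).2) y ->
  is_derive t (1 : R) (fun s => f (gam s)) (lx * x + ly * y).
Proof.
move=> cA cB E d1 d2.
have cg : gam s @[s --> t] --> gam t.
  have c1 := is_derive_continuous_at d1; have c2 := is_derive_continuous_at d2.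
  have := cvg_pair (c1 : (fun s => (gam s).1) s @[s --> t] --> (gam t).1)
    (c2 : (fun s => (gam s).2) s @[s --> t] --> (gam t).2).
  rewrite (_ : (fun s => ((gam s).1, (gam s).2)) = gam); last by apply/funext => s; case: (gam s).
  by move=> /(_ _ _ _) h; exact: h.
have cs : (r *: (1 : R) + t) @[r --> (0 : R)^'] --> t.
  have h : {for (0 : R), continuous (fun r : R => r *: (1 : R) + t)}.
    apply: (@cvgD _ _ _ (nbhs (0 : R)) _ (fun r : R => r *: (1 : R)) (fun=> t)); last exact: cvg_cst.
    by apply: (@cvgZ _ _ _ (nbhs (0 : R)) _ id (fun=> (1 : R))); [exact: cvg_id|exact: cvg_cst].
  have {}h : (r *: (1 : R) + t) @[r --> (0 : R)] --> (0 : R) *: (1 : R) + t by exact: h.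
  by rewrite scale0r add0r in h; exact: cvg_within_filter.
have cgs : gam (r *: (1 : R) + t) @[r --> (0 : R)^'] --> gam t by exact: (cvg_comp _ _ cs cg).
apply/is_derive_cvgP; move/is_derive_cvgP : d1 => d1; move/is_derive_cvgP : d2 => d2.
have N : \forall r \near (0 : R)^', A (gam (r *: (1 : R) + t)) * (r^-1 *: ((gam (r *: (1 : R) + t)).1 - (gam t).1)) +
    B (gam (r *: (1 : R) + t)) * (r^-1 *: ((gam (r *: (1 : R) + t)).2 - (gam t).2)) =
    r^-1 *: (f (gam (r *: (1 : R) + t)) - f (gam t)).
  have N0 : \forall r \near (0 : R)^', f (gam (r *: (1 : R) + t)) - f (gam t) =
      A (gam (r *: (1 : R) + t)) * ((gam (r *: (1 : R) + t)).1 - (gam t).1) +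
      B (gam (r *: (1 : R) + t)) * ((gam (r *: (1 : R) + t)).2 - (gam t).2) := cgs _ E.
  by apply: filterS N0 => r ->; rewrite /GRing.scale /=; ring.
apply: cvg_trans (near_eq_cvg N) _; apply: cvgD; apply: cvgM => //.
- exact: (cvg_comp _ _ cgs cA).
- exact: (cvg_comp _ _ cgs cB).
Qed.

Lemma derivative_le (f h : R -> R) t (x y : R) :
  is_derive t (1 : R) f x -> is_derive t (1 : R) h y ->
  (forall s, `|f s - f t| <= `|h s - h t|) -> `|x| <= `|y|.
Proof.
move=> /is_derive_cvgP d1 /is_derive_cvgP d2 H.
have n1 : (`|r^-1 *: (f (r *: (1 : R) + t) - f t)| : R) @[r --> (0 : R)^'] --> (`|x| : R).
  by apply: cvg_norm.
have n2 : (`|r^-1 *: (h (r *: (1 : R) + t) - h t)| : R) @[r --> (0 : R)^'] --> (`|y| : R).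
  by apply: cvg_norm.
apply: (ler_cvg_to n1 n2); near=> r; rewrite !normrZ ler_wpM2l//; exact: H.
Unshelve. all: by end_near. Qed.

(** Subtracting the clamped value gives a contraction that is flat near 0 and
    uniformly close to the identity. *)
Definition truncate (eta s : R) : R := s - clamp (- eta) eta s.

Lemma truncate_small eta s : `|s| <= eta -> truncate eta s = 0.
Proof. by rewrite ler_norml => h; rewrite /truncate clamp_id// subrr. Qed.

Lemma truncate_close eta s : 0 <= eta -> `|truncate eta s - s| <= eta.
Proof.
move=> eta0; rewrite /truncate addrAC subrr add0r normrN ler_norml.
by apply: clamp_itv; lra.
Qed.

Lemma truncate_contraction eta s t : 0 <= eta -> `|truncate eta t - truncate eta s| <= `|t - s|.
Proof.
move=> eta0; have ab : - eta <= eta by lra.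
have main u v : u <= v -> `|truncate eta v - truncate eta u| <= v - u.
  move=> uv; have h1 := clamp_diff ab uv; have h2 := clamp_homo (- eta) eta uv.
  by rewrite /truncate ler_norml; lra.
have [ts|/ltW st] := leP t s.
  by rewrite distrC (distrC t) (ger0_norm (_ : 0 <= s - t)) ?subr_ge0// main.
by rewrite (ger0_norm (_ : 0 <= t - s)) ?subr_ge0// main.
Qed.

(** A horizontal segment that crosses the axis is cut there; a vertical segment
    on the axis is the limit of vertical segments off it. *)
Lemma lipschitz_off_axis (f f1 f2 : R * R -> R) z (r L : R) : 0 <= L ->
  (forall w, `|w.1 - z.1| < r -> `|w.2 - z.2| < r -> {for w, continuous f} /\
    (w.1 != 0 -> [/\ is_derive w (e1 : R * R) f (f1 w), is_derive w (e2 : R * R) f (f2 w),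
       `|f1 w| <= L & `|f2 w| <= L])) ->
  forall w w', `|w.1 - z.1| < r -> `|w.2 - z.2| < r -> `|w'.1 - z.1| < r -> `|w'.2 - z.2| < r ->
  `|f w' - f w| <= L * (`|w'.1 - w.1| + `|w'.2 - w.2|).
Proof.
move=> L0 H.
have cont x y : `|x - z.1| < r -> `|y - z.2| < r -> {for x, continuous (fun x => f (x, y))} /\
    {for y, continuous (fun y => f (x, y))}.
  move=> hx hy; have [c _] := H (x, y) hx hy; split.
    by apply: (@continuous_comp _ _ _ (fun x => (x, y)) f) => //; exact: (cvg_pair cvg_id (cvg_cst y)).
  by apply: (@continuous_comp _ _ _ (fun y => (x, y)) f) => //; exact: (cvg_pair (cvg_cst x) cvg_id).
have btw (c u v x : R) : `|u - c| < r -> `|v - c| < r -> u <= x <= v -> `|x - c| < r.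
  by rewrite !ltr_norml => /andP[h1 h2] /andP[h3 h4] /andP[h5 h6]; apply/andP; split; lra.
have hor0 y u v : `|y - z.2| < r -> `|u - z.1| < r -> `|v - z.1| < r -> u <= v ->
    (forall x, u < x < v -> x != 0) -> `|f (v, y) - f (u, y)| <= L * (v - u).
  move=> hy hu hv uv n0.
  pose d x := if x == 0 then 0 else f1 (x, y).
  have dL x : `|x - z.1| < r -> `|d x| <= L.
    move=> hx; rewrite /d; case: eqP => [_|/eqP x0]; first by rewrite normr0.
    by have [_ /(_ x0)[]] := H (x, y) hx hy.
  have cI x : u <= x <= v -> {for x, continuous (fun x => f (x, y))}.
    by move=> /(btw _ _ _ _ hu hv) hx; have [] := cont x y hx hy.
  have dI x : u < x < v -> is_derive x (1 : R) (fun x => f (x, y)) (d x).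
    move=> xuv; have x0 := n0 x xuv; have /andP[/ltW h1 /ltW h2] := xuv.
    have hx : `|x - z.1| < r by apply: (btw _ _ _ _ hu hv); rewrite h1.
    have [_ /(_ x0)[/is_derive_slice1 D _ _ _]] := H (x, y) hx hy.
    by rewrite /d (negbTE x0).
  have [c /(btw _ _ _ _ hu hv) hc ->] := increment_mean uv cI dI.
  by rewrite normrM (ger0_norm (_ : 0 <= v - u)) ?subr_ge0// ler_wpM2r ?subr_ge0// dL.
have hor1 y u v : `|y - z.2| < r -> `|u - z.1| < r -> `|v - z.1| < r -> u <= v ->
    `|f (v, y) - f (u, y)| <= L * (v - u).
  move=> hy hu hv uv; have [u0|u0] := leP 0 u.
    by apply: hor0 => // x /andP[ux _]; rewrite gt_eqF// (le_lt_trans u0).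
  have [v0|v0] := leP v 0.
    by apply: hor0 => // x /andP[_ xv]; rewrite lt_eqF// (lt_le_trans xv).
  have h0 : `|0 - z.1| < r by apply: (btw _ _ _ _ hu hv); rewrite !ltW.
  have E1 : `|f (0, y) - f (u, y)| <= L * (0 - u).
    by apply: hor0 => //; [exact: ltW|move=> x /andP[_ x0]; rewrite lt_eqF].
  have E2 : `|f (v, y) - f (0, y)| <= L * (v - 0).
    by apply: hor0 => //; [exact: ltW|move=> x /andP[x0 _]; rewrite gt_eqF].
  have := ler_normD (f (v, y) - f (0, y)) (f (0, y) - f (u, y)); rewrite subrKA; lra.
have hor y u v : `|y - z.2| < r -> `|u - z.1| < r -> `|v - z.1| < r ->
    `|f (v, y) - f (u, y)| <= L * `|v - u|.
  move=> hy hu hv; have [uv|/ltW vu] := leP u v.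
    by rewrite (ger0_norm (_ : 0 <= v - u)) ?subr_ge0// hor1.
  by rewrite distrC (distrC v) (ger0_norm (_ : 0 <= u - v)) ?subr_ge0// hor1.
have ver0 x u v : x != 0 -> `|x - z.1| < r -> `|u - z.2| < r -> `|v - z.2| < r -> u <= v ->
    `|f (x, v) - f (x, u)| <= L * (v - u).
  move=> x0 hx hu hv uv.
  have cI y : u <= y <= v -> {for y, continuous (fun y => f (x, y))}.
    by move=> /(btw _ _ _ _ hu hv) hy; have [] := cont x y hx hy.
  have dI y : u < y < v -> is_derive y (1 : R) (fun y => f (x, y)) (f2 (x, y)).
    move=> /andP[/ltW h1 /ltW h2].
    have hy : `|y - z.2| < r by apply: (btw _ _ _ _ hu hv); rewrite h1.
    by have [_ /(_ x0)[_ /is_derive_slice2 D _ _]] := H (x, y) hx hy.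
  have [c /(btw _ _ _ _ hu hv) hc ->] := increment_mean uv cI dI.
  rewrite normrM (ger0_norm (_ : 0 <= v - u)) ?subr_ge0// ler_wpM2r ?subr_ge0//.
  by have [_ /(_ x0)[_ _ _]] := H (x, c) hx hc.
have ver1 x u v : x != 0 -> `|x - z.1| < r -> `|u - z.2| < r -> `|v - z.2| < r ->
    `|f (x, v) - f (x, u)| <= L * `|v - u|.
  move=> x0 hx hu hv; have [uv|/ltW vu] := leP u v.
    by rewrite (ger0_norm (_ : 0 <= v - u)) ?subr_ge0// ver0.
  by rewrite distrC (distrC v) (ger0_norm (_ : 0 <= u - v)) ?subr_ge0// ver0.
have ver x u v : `|x - z.1| < r -> `|u - z.2| < r -> `|v - z.2| < r ->
    `|f (x, v) - f (x, u)| <= L * `|v - u|.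
  move=> hx hu hv; have [x0|x0] := eqVneq x 0; last exact: ver1.
  apply/ler_addgt0Pr => e e0; rewrite x0 in hx *.
  have L1 : 0 < 2 * (L + 1) by rewrite mulr_gt0// ltr_wpDl.
  have z1r : `|z.1| < r by move: hx; rewrite sub0r normrN.
  pose x' := Num.min (e / (2 * (L + 1))) ((r - `|z.1|) / 2).
  have x'0 : 0 < x' by rewrite lt_min !divr_gt0// subr_gt0.
  have x'e : x' <= e / (2 * (L + 1)) by rewrite ge_min lexx.
  have x'r : x' <= (r - `|z.1|) / 2 by rewrite ge_min lexx orbT.
  have hx' : `|x' - z.1| < r.
    by have := ler_normB x' z.1; rewrite (gtr0_norm x'0); lra.
  have A1 := hor v x' 0 hv hx' hx; have A2 := hor u 0 x' hu hx hx'.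
  have A3 := ver1 x' u v (lt0r_neq0 x'0) hx' hu hv.
  rewrite sub0r normrN (gtr0_norm x'0) in A1; rewrite subr0 (gtr0_norm x'0) in A2.
  have A4 : 2 * (L * x') <= e.
    by move: x'e; rewrite ler_pdivlMr// mulrDr mulr1; move: (ltW x'0); nra.
  have T1 := ler_normD (f (0, v) - f (x', v)) (f (x', v) - f (x', u)).
  have T2 := ler_normD (f (0, v) - f (x', v) + (f (x', v) - f (x', u))) (f (x', u) - f (0, u)).
  rewrite (_ : f (0, v) - f (0, u) = f (0, v) - f (x', v) + (f (x', v) - f (x', u)) +
    (f (x', u) - f (0, u))); last by ring.
  lra.
move=> w w' h1 h2 h3 h4.
have E1 := hor w.2 w.1 w'.1 h2 h1 h3; have E2 := ver w'.1 w.2 w'.2 h3 h2 h4.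
have := ler_normD (f (w'.1, w'.2) - f (w'.1, w.2)) (f (w'.1, w.2) - f (w.1, w.2)).
rewrite subrKA -!surjective_pairing mulrDr; rewrite -surjective_pairing in E1.
by rewrite -surjective_pairing in E2; lra.
Qed.

(** A Lebesgue number turns the local Lipschitz constants into one constant,
    valid for parameters that are closer to each other than it. *)
Lemma AC_chain_along a b (F : R * R -> R) (gam : R -> R * R) :
  {within `[a, b], continuous (fun t => (gam t).1)} ->
  {within `[a, b], continuous (fun t => (gam t).2)} ->
  AC_chain a b (fun t => (gam t).1) -> AC_chain a b (fun t => (gam t).2) ->
  (forall t, a <= t <= b -> exists2 r : R, 0 < r & exists L : R, forall w w',
     `|w.1 - (gam t).1| < r -> `|w.2 - (gam t).2| < r ->
     `|w'.1 - (gam t).1| < r -> `|w'.2 - (gam t).2| < r ->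
     `|F w' - F w| <= L * (`|w'.1 - w.1| + `|w'.2 - w.2|)) ->
  AC_chain a b (fun t => F (gam t)).
Proof.
move=> c1 c2 A1 A2 loc.
pose D s t := `|(gam t).1 - (gam s).1| + `|(gam t).2 - (gam s).2|.
have D0 s t : 0 <= D s t by rewrite addr_ge0.
have [||r r0 [L HL]] := @lebesgue_number R a b (fun L s t => `|F (gam t) - F (gam s)| <= L * D s t).
- by move=> M M' s t MM' h; apply: le_trans h _; rewrite ler_wpM2r.
- move=> t tab; have tI : `[a, b]%classic t by rewrite /= in_itv.
  have [r r0 [L HL]] := loc t tab.
  have [r1 r10 H1] := within_continuous_eps c1 tI r0.
  have [r2 r20 H2] := within_continuous_eps c2 tI r0.
  exists (Num.min r1 r2); first by rewrite lt_min r10.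
  exists L => s s' sab s'ab; rewrite !lt_min => /andP[h1 h2] /andP[h3 h4].
  have sI : `[a, b]%classic s by rewrite /= in_itv.
  have s'I : `[a, b]%classic s' by rewrite /= in_itv.
  by apply: HL; rewrite distrC; [apply: H1|apply: H2|apply: H1|apply: H2] => //; rewrite distrC.
have L1 : 0 < `|L| + 1 by rewrite ltr_wpDl.
move=> e e0; have e1 : 0 < e / (2 * (`|L| + 1)) by rewrite divr_gt0// mulr_gt0.
have [d d0 Hd] := A1 _ e1; have [d' d'0 Hd'] := A2 _ e1.
exists (Num.min r (Num.min d d')); first by rewrite !lt_min r0 d0.
move=> l C; rewrite !lt_min => /and3P[h1 h2 h3].
have B1 := Hd l C h2; have B2 := Hd' l C h3.
have small p0 : p0 \in l -> p0.2 - p0.1 <= total_length l.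
  move=> pl; rewrite /total_length (big_rem p0)//= lerDl big_seq sumr_ge0// => i.
  by move=> /mem_rem /(chain_mem C)[_ h _]; rewrite subr_ge0.
have bound : oscillation (fun t => F (gam t)) l <= \sum_(p0 <- l) (`|L| + 1) * D p0.1 p0.2.
  rewrite /oscillation big_seq [leRHS]big_seq; apply: ler_sum => p0 pl.
  have [k1 k2 k3] := chain_mem C pl.
  apply: (@le_trans _ _ (L * D p0.1 p0.2)); last first.
    by rewrite ler_wpM2r//; have := ler_norm L; lra.
  apply: HL; [by rewrite k1 (le_trans k2)|by rewrite k3 (le_trans k1)|].
  by rewrite distrC ger0_norm ?subr_ge0// (le_lt_trans (small _ pl)).
apply: le_lt_trans bound _; rewrite -mulr_sumr big_split /=.
rewrite -[ltRHS](divfK (lt0r_neq0 L1)) mulrC ltr_pM2r//.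
have -> : e / (`|L| + 1) = e / (2 * (`|L| + 1)) + e / (2 * (`|L| + 1)).
  by field; rewrite gt_eqF.
exact: ltrD.
Qed.

(** The increments are smaller than those of the indefinite integral of the
    bound, which is absolutely continuous. *)
Lemma AC_chain_dominated a b (f k : R -> R) : lam.-integrable `[a, b] (EFin \o k) ->
  (forall s t, a <= s -> s <= t -> t <= b -> `|f t - f s| <= \int[lam]_(x in `]s, t]) k x) ->
  AC_chain a b f.
Proof.
move=> ik H; pose h t := \int[lam]_(x in `[a, t]) k x.
have Ph : is_primitive a b h k by split=> // s t *; exact: (Rintegral_itv_diff ik).
have [Ah _] := absolutely_continuous_chain
  (primitive_absolutely_continuous (gam := fun t => (h t, h t)) Ph Ph).
move=> e e0; have [d d0 Hd] := Ah e e0; exists d => // l C L.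
apply: le_lt_trans (Hd l C L); rewrite /oscillation big_seq [leRHS]big_seq; apply: ler_sum => x xl.
have [h1 h2 h3] := chain_mem C xl; apply: le_trans (H _ _ h1 h2 h3) _.
by have [_ <-//] := Ph; exact: ler_norm.
Qed.

End CurveCalculus.

(** * Regular points of conformal maps *)

Section InverseStraighten.
Context {R : realType}.
Variable alpha : R.
Hypothesis alpha0 : 0 < alpha.
Local Notation U := (straighten alpha).
Local Notation wt := (weight alpha).

(** The inverse function theorem applies off the axis, where the derivative
    of the straightening map, the weight, does not vanish. *)
Lemma is_derive_unstraighten (f : R -> R) (x l : R) : f x != 0 ->
  is_derive x (1 : R) (fun t => U (f t)) l -> is_derive x (1 : R) f (l / wt (f x)).
Proof.
move=> fx0 dU; pose inv (t : R) : R := xget 0 [set s | U s = t].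
have invK : cancel U inv.
  move=> s; have := xgetI (0 : R) (erefl : [set s' | U s' = U s] s).
  by move=> /(straighten_inj alpha0).
have D : is_derive (U (f x)) (1 : R) inv (wt (f x))^-1.
  apply: (@is_derive_inverse R U).
  - by near=> z; exact: invK.
  - by near=> z; exact: continuous_straighten.
  - exact: is_derive_straighten.
  - by rewrite gt_eqF// weight_gt0.
have := @is_derive1_comp _ inv (fun t => U (f t)) x _ _ D dU; rewrite mulrC.
by rewrite (_ : inv \o _ = f)//; apply/funext => t /=; rewrite invK.
Unshelve. all: by end_near. Qed.

End InverseStraighten.

Section RotationEntries.
Context {R : realType}.

(** The determinant [D] satisfies [D ^ 2 = 1], hence [D = 1], and the squares
    of the two differences to be shown zero add up to [2 - 2 * D]. *)
Lemma orthogonal_mx_rotation (A : 'M[R]_2) : orthogonal_mx A ->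
  0 < A 0 0 * A 1 1 - A 1 0 * A 0 1 -> A 1 1 = A 0 0 /\ A 0 1 = - A 1 0.
Proof.
move=> AA; move: (congr1 (fun M : 'M[R]_2 => M 0 0) AA) (congr1 (fun M : 'M[R]_2 => M 0 1) AA)
  (congr1 (fun M : 'M[R]_2 => M 1 1) AA).
rewrite !mxE !big_ord_recl !big_ord0 !mxE /= !addr0.
rewrite (_ : lift ord0 ord0 = 1); last exact: val_inj.
set p := A 0 0; set q := A 0 1; set r := A 1 0; set t := A 1 1.
rewrite mulr1n mulr0n => E1 E2 E3 D0.
have D1 : p * t - r * q = 1.
  have : (p * t - r * q - 1) * (p * t - r * q + 1) = 0.
    have -> : (p * t - r * q - 1) * (p * t - r * q + 1) =
      (p * p + q * q) * (r * r + t * t) - (p * r + q * t) * (p * r + q * t) - 1 by ring.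
    by rewrite E1 E2 E3; ring.
  by move=> /eqP; rewrite mulf_eq0 => /orP[/eqP|/eqP]; lra.
have S0 : (t - p) ^+ 2 + (q + r) ^+ 2 = 0.
  have -> : (t - p) ^+ 2 + (q + r) ^+ 2 =
    (p * p + q * q) + (r * r + t * t) - 2 * (p * t - r * q) by ring.
  by rewrite E1 E3 D1; ring.
have := S0; move/eqP; rewrite paddr_eq0 ?sqr_ge0// !sqrf_eq0 subr_eq0 addr_eq0.
by move=> /andP[/eqP-> /eqP->].
Qed.

End RotationEntries.

Section RegularSet.
Context {R : realType}.
Local Notation mu2 := (plane_measure R).
Variables (alpha : R) (Om Om' : set (R * R)) (g : R * R -> R * R).
Local Notation U := (straighten alpha).
Local Notation wt := (weight alpha).
Local Notation g1 := (fun w => (g w).1).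
Local Notation g2 := (fun w => (g w).2).
Local Notation Rg := (regular_set Om g).
Hypotheses (alpha0 : 0 < alpha) (oOm : open Om).
Hypothesis hg : HW alpha (2 * (alpha + 1) / alpha) Om Om' g.
Hypothesis hconf : conformal alpha Om Om' g.
Hypothesis hor : orientation_preserving alpha Om Om' g.

Lemma map_continuous z : Om z -> {for z, continuous g}.
Proof.
case: hconf => -[_ [h [_ cg _]]] _ _ _ Oz.
by move: cg; rewrite continuous_open_subspace// => /(_ z); apply; rewrite inE.
Qed.

Lemma map_continuous1 z : Om z -> {for z, continuous g1}.
Proof.
by move=> Oz; apply: (@continuous_comp _ _ _ g fst); [exact: map_continuous|exact: cvg_fst].
Qed.

Lemma map_continuous2 z : Om z -> {for z, continuous g2}.
Proof.
by move=> Oz; apply: (@continuous_comp _ _ _ g snd); [exact: map_continuous|exact: cvg_snd].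
Qed.

Lemma regular_setP z : Rg z <-> [/\ Om z, z.1 != 0 & (g z).1 != 0].
Proof.
split=> [[Oz nS]|[Oz z0 g0]].
  split=> //; apply/eqP => E; apply: nS; split=> //; [left|right]; exact: E.
by split=> // -[_ [/eqP|/eqP]]; apply/negP.
Qed.

Lemma open_regular_set z : Rg z -> nbhs z Rg.
Proof.
move=> /regular_setP[Oz z0 g0].
have N1 : nbhs z Om by exact: open_nbhs_nbhs.
have N2 : nbhs z [set w : R * R | w.1 != 0].
  by apply: (@cvgr_neq0 _ _ _ (nbhs z) _ (fun w : R * R => w.1) z.1) => //; exact: cvg_fst.
have N3 : nbhs z [set w | (g w).1 != 0].
  exact: (@cvgr_neq0 _ _ _ (nbhs z) _ g1 (g z).1 (map_continuous1 Oz)).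
by apply: filterS (filterI N1 (filterI N2 N3)) => w [Ow [w0 gw0]]; apply/regular_setP.
Qed.

(** At almost every regular point the differential is a positive multiple of
    a rotation, which is the Cauchy-Riemann system. *)
Lemma ae_cauchy_riemann : {ae mu2, forall z, Rg z -> exists p11 p12 p21 p22 : R,
  [/\ is_derive z (e1 : R * R) g1 p11, is_derive z (e2 : R * R) g1 p12,
      is_derive z (e1 : R * R) g2 p21, is_derive z (e2 : R * R) g2 p22 &
      wt (g z).1 * p11 = wt z.1 * p22 /\ wt (g z).1 * (wt z.1 * p12) = - p21]}.
Proof.
case: hconf => _ _ [lam [lam0 aeD]] _; case: hor => _ aeJ.
apply: aeS2 aeD aeJ => z D J Rz; have [[d11 d12 d21 d22] [A oA EA]] := D Rz.
have [Oz z0 gz0] := (regular_setP z).1 Rz; have [_ J0] := J Oz.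
have W0 : 0 < wt (g z).1 by rewrite weight_gt0.
have l0 := lam0 z Rz.
exists ('D_e1 g1 z), ('D_e2 g1 z), ('D_e1 g2 z), ('D_e2 g2 z).
split; [exact/derivableP..|].
have E00 := congr1 (fun M : 'M[R]_2 => M 0 0) EA; have E01 := congr1 (fun M : 'M[R]_2 => M 0 1) EA.
have E10 := congr1 (fun M : 'M[R]_2 => M 1 0) EA; have E11 := congr1 (fun M : 'M[R]_2 => M 1 1) EA.
rewrite /Dmx /mx2 !mxE /= in E00 E01 E10 E11.
have [] := orthogonal_mx_rotation oA.
  move: J0; rewrite /Defs.jacobian E00 E01.
  have -> : derY alpha g2 z = wt (g z).1 * (lam z * A 1 1).
    by rewrite -E11 mulrC divfK// gt_eqF.
  have -> : derX g2 z = wt (g z).1 * (lam z * A 1 0).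
    by rewrite -E10 mulrC divfK// gt_eqF.
  have -> : lam z * A 0 0 * (wt (g z).1 * (lam z * A 1 1)) -
     wt (g z).1 * (lam z * A 1 0) * (lam z * A 0 1) =
     (wt (g z).1 * lam z ^+ 2) * (A 0 0 * A 1 1 - A 1 0 * A 0 1) by ring.
  by rewrite pmulr_rgt0// mulr_gt0// exprn_gt0.
move=> F1 F2; rewrite F1 -E00 in E11; rewrite F2 mulrN -E10 in E01.
split.
  have -> : wt z.1 * 'D_e2 g2 z = derY alpha g2 z by [].
  by rewrite -[derY alpha g2 z](divfK (lt0r_neq0 W0)) E11 mulrC.
have -> : wt z.1 * 'D_e2 g1 z = derY alpha g1 z by [].
by rewrite E01 mulrN mulrC divfK// gt_eqF.
Qed.

(** The pair (straighten g1, g2) solves the weak Cauchy-Riemann equations near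
    a regular point, so it is of class [C^1], and then so is [g1]. *)
Lemma regular_C1 z0 : Rg z0 -> exists V p11 p12 p21 p22,
  [/\ open V, V z0, V `<=` Rg, C1_on V g1 p11 p12 & C1_on V g2 p21 p22].
Proof.
move=> Rz0; have [S [s Ss]] := @smooth_step_exists R.
have /nbhs_ballP[r /= r0 rR] := open_regular_set Rz0.
have r20 : 0 < r / 2 by rewrite divr_gt0.
set a := z0.1 - r / 2; set b := z0.1 + r / 2; set c := z0.2 - r / 2; set d := z0.2 + r / 2.
have ab : a < b by rewrite /a /b; lra.
have cd : c < d by rewrite /c /d; lra.
have BR w : box a b c d w -> Rg w.
  move=> /boxP[/andP[w1 w2] /andP[w3 w4]]; apply: rR.
  move: w1 w2 w3 w4; rewrite /a /b /c /d => w1 w2 w3 w4.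
  by split; rewrite /ball /= ltr_norml; apply/andP; split; lra.
have BOm : box a b c d `<=` Om by move=> w /BR/regular_setP[].
case: hg => _ [_ [v11 [v12 [W11 W12 _ _]]]] [_ [v21 [v22 [W21 W22 _ _]]]].
have CR : weak_CR alpha a b c d (U \o g1) g2.
  apply: (weak_CR_of_ae alpha0 ab cd BOm map_continuous1 map_continuous2 W11 W12 W21 W22).
  by apply: aeS ae_cauchy_riemann => z H /BR.
have cU w : box a b c d w -> {for w, continuous (U \o g1)}.
  move=> /BOm Ow; apply: continuous_comp; first exact: map_continuous1.
  exact: continuous_straighten.
have c2 w : box a b c d w -> {for w, continuous g2} by move=> /BOm; exact: map_continuous2.
have w0 w : box a b c d w -> w.1 != 0 by move=> /BR/regular_setP[].
have z01 : a < z0.1 < b by apply/andP; rewrite /a /b; split; lra.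
have z02 : c < z0.2 < d by apply/andP; rewrite /c /d; split; lra.
have [V [G1 [G2 [h1 [h2 [oV Vz0 VB CG Ch]]]]]] := weyl_regularity alpha0 Ss ab cd w0 cU c2 CR z01 z02.
exists V, (fun z => G1 z / wt (g z).1), (fun z => G2 z / wt (g z).1), h1, h2.
split=> //; first by move=> w /VB/BR.
move=> z Vz; have [D1 D2 cG1 cG2] := CG z Vz.
have [Oz z1 gz1] := (regular_setP z).1 (BR z (VB z Vz)).
have cdiv (G : R * R -> R) : {for z, continuous G} -> {for z, continuous (fun z => G z / wt (g z).1)}.
  move=> cG; apply: cvgM; first exact: cG.
  apply: cvgV; first by rewrite gt_eqF// weight_gt0.
  apply: (@continuous_comp _ _ _ g1 wt); first exact: map_continuous1.
  exact: continuous_weight.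
split; [| |exact: cdiv|exact: cdiv].
- apply/is_derive_slice1; move/is_derive_slice1 : D1 => D1.
  have E : g z = g (z.1, z.2) by case: (z).
  by rewrite E; apply: (is_derive_unstraighten alpha0 (f := fun x => (g (x, z.2)).1)) => //; rewrite -E.
- apply/is_derive_slice2; move/is_derive_slice2 : D2 => D2.
  have E : g z = g (z.1, z.2) by case: (z).
  by rewrite E; apply: (is_derive_unstraighten alpha0 (f := fun y => (g (z.1, y)).1)) => //; rewrite -E.
Qed.

(** The two entries of the conformal matrix [p, -q; q, p]. *)
Definition entry_p z : R := 'D_e1 g1 z.
Definition entry_q z : R := 'D_e1 g2 z / wt (g z).1.
Local Notation p := entry_p.
Local Notation q := entry_q.

(** The Cauchy-Riemann equations hold almost everywhere, hence on a dense set,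
    and both sides are continuous. *)
Theorem regular_partials z : Rg z ->
  [/\ is_derive z (e1 : R * R) g1 (p z), is_derive z (e2 : R * R) g1 (- q z / wt z.1),
      is_derive z (e1 : R * R) g2 (q z * wt (g z).1) &
      is_derive z (e2 : R * R) g2 (p z * wt (g z).1 / wt z.1)] /\
  {for z, continuous p} /\ {for z, continuous q}.
Proof.
move=> Rz; have [V [p11 [p12 [p21 [p22 [oV Vz VR C1 C2]]]]]] := regular_C1 Rz.
have cwg w : Rg w -> {for w, continuous (fun w => wt (g w).1)}.
  move=> /regular_setP[Ow _ _]; apply: (@continuous_comp _ _ _ g1 wt); first exact: map_continuous1.
  exact: continuous_weight.
have cw : continuous (fun z : R * R => wt z.1).
  by move=> w; apply: continuous_comp; [exact: cvg_fst|exact: continuous_weight].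
have dense (f : R * R -> R) : (forall w, V w -> {for w, continuous f}) ->
    {ae mu2, forall w, V w -> f w = 0} -> forall w, V w -> f w = 0.
  move=> cf aef w Vw; apply/eqP/negPn/negP => fw.
  have N1 : nbhs w [set w' | f w' != 0] by exact: (@cvgr_neq0 _ _ _ (nbhs w) _ f (f w) (cf w Vw)).
  have N2 : nbhs w V by exact: open_nbhs_nbhs.
  have [w' [/= fw' Vw'] /(_ Vw') E] := ae_plane_dense aef (filterI N1 N2).
  by rewrite E eqxx in fw'.
have CRV : {ae mu2, forall w, V w -> wt (g w).1 * p11 w = wt w.1 * p22 w /\
    wt (g w).1 * (wt w.1 * p12 w) = - p21 w}.
  apply: aeS ae_cauchy_riemann => w H Vw.
  have [l11 [l12 [l21 [l22 [D11 D12 D21 D22 E]]]]] := H (VR w Vw).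
  have [D1 D2 _ _] := C1 w Vw; have [D3 D4 _ _] := C2 w Vw.
  have uniq (v : R * R) (f : R * R -> R) (x y : R) : is_derive w v f x -> is_derive w v f y -> x = y.
    by move=> [_ <-] [_ <-].
  by rewrite (uniq _ _ _ _ D1 D11) (uniq _ _ _ _ D2 D12) (uniq _ _ _ _ D3 D21) (uniq _ _ _ _ D4 D22).
have E1 w : V w -> wt (g w).1 * p11 w = wt w.1 * p22 w.
  move=> Vw; apply/eqP; rewrite -subr_eq0; apply/eqP; move: w Vw; apply: dense.
    move=> w Vw; have [_ _ c11 c12] := C1 w Vw; have [_ _ c21 c22] := C2 w Vw.
    by apply: cvgB; apply: cvgM; [exact/cwg/VR|exact: c11|exact: cw|exact: c22].
  by apply: aeS CRV => w H Vw; have [-> _] := H Vw; rewrite subrr.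
have E2 w : V w -> wt (g w).1 * (wt w.1 * p12 w) = - p21 w.
  move=> Vw; apply/eqP; rewrite -addr_eq0; apply/eqP; move: w Vw; apply: dense.
    move=> w Vw; have [_ _ c11 c12] := C1 w Vw; have [_ _ c21 c22] := C2 w Vw.
    apply: cvgD; last exact: c21.
    by apply: cvgM; [exact/cwg/VR|apply: cvgM; [exact: cw|exact: c12]].
  by apply: aeS CRV => w H Vw; have [_ ->] := H Vw; rewrite addNr.
have Ep w : V w -> p11 w = p w by move=> Vw; have [[_ <-]] := C1 w Vw.
have Eq w : V w -> p21 w / wt (g w).1 = q w by move=> Vw; have [[_ <-]] := C2 w Vw.
have [_ z0 gz0] := (regular_setP z).1 Rz.
have wz0 : wt z.1 != 0 by rewrite gt_eqF// weight_gt0.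
have wgz0 : wt (g z).1 != 0 by rewrite gt_eqF// weight_gt0.
have [D1 D2 c11 c12] := C1 z Vz; have [D3 D4 c21 c22] := C2 z Vz.
have nV : nbhs z V by exact: open_nbhs_nbhs.
split; last split.
- have e1z := E1 z Vz; have e2z := E2 z Vz; rewrite -(Ep z Vz) -(Eq z Vz).
  split.
  + exact: D1.
  + rewrite (_ : _ / _ = p12 z)//; rewrite -mulNr -e2z; by field; rewrite wz0 wgz0.
  + by rewrite divfK.
  + rewrite (_ : _ / _ = p22 z)//; rewrite mulrC (mulrC (p11 z)) e1z mulKf//.
- have E : \near z, p11 z = p z by apply: filterS nV.
  rewrite /prop_for /continuous_at -(Ep z Vz); exact: cvg_trans (near_eq_cvg E) c11.
- have E : \near z, p21 z / wt (g z).1 = q z by apply: filterS nV.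
  rewrite /prop_for /continuous_at -(Eq z Vz); apply: cvg_trans (near_eq_cvg E) _.
  by apply: cvgM; [exact: c21|apply: cvgV => //; exact: cwg].
Qed.


(** * Singular points of conformal maps *)

Local Notation Sg := (singular_set Om g).

(** If [g1] vanished on an open set, so would the Jacobian. *)
Lemma regular_dense z V : Om z -> nbhs z V -> exists2 w, V w & Rg w.
Proof.
move=> Oz nV; have nVO : nbhs z (V `&` Om) by apply: filterI => //; exact: open_nbhs_nbhs.
move: nVO; rewrite nbhsE => -[W [oW Wz] WVO].
apply: contrapT => nR; have g0 w : W w -> w.1 != 0 -> (g w).1 = 0.
  move=> Ww w0; apply/eqP/negPn/negP => gw0; apply: nR; exists w; first by have [] := WVO w Ww.
  by apply/regular_setP; split=> //; have [] := WVO w Ww.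
case: hor => _ aeJ.
have [w Ww [w0 /(_ (WVO w Ww).2) [_ J0]]] :=
  ae_plane_dense (aeS2 (fun t => @conj _ _) (ae_fst_neq 0) aeJ) (open_nbhs_nbhs (conj oW Wz)).
have nE : \near w, (cst 0 : R * R -> R) w = g1 w.
  have N1 : nbhs w W by exact: open_nbhs_nbhs.
  have N2 : nbhs w [set w : R * R | w.1 != 0].
    by apply: (@cvgr_neq0 _ _ _ (nbhs w) _ (fun w : R * R => w.1) w.1) => //; exact: cvg_fst.
  by apply: filterS (filterI N1 N2) => w' [Ww' w'0] /=; rewrite g0.
have D (v : R * R) : 'D_v g1 w = 0.
  by have [_ ->] := near_eq_is_derive nE (is_derive_cst (0 : R) w v).
by move: J0; rewrite /Defs.jacobian /derX /derY !D mulr0 mul0r mulr0 subrr ltxx.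
Qed.

(** The limit of the conformal matrices at a singular point is a nonzero
    matrix of the form [p, -q; q, p], because regular points are dense; so one
    of its entries stays away from 0. *)
Lemma near_singular_entries z0 : Sg z0 -> exists M m : R, [/\ 0 < M, 0 < m,
  \forall z \near z0, Rg z -> `|p z| <= M /\ `|q z| <= M &
  (\forall z \near z0, Rg z -> m <= `|p z|) \/ (\forall z \near z0, Rg z -> m <= `|q z|)].
Proof.
move=> Sz0; case: hconf => _ _ _ /(_ z0 Sz0)[L L0 cvL].
have [Oz0 _] := Sz0.
have hp z : Rg z -> has_partials g z.
  by move=> /regular_partials[[[d1 _] [d2 _] [d3 _] [d4 _]] _].
have near_entry (e : R) : 0 < e -> \forall z \near z0, Rg z ->
    [/\ `|L 0 0 - p z| < e, `|L 0 1 + q z| < e, `|L 1 0 - q z| < e & `|L 1 1 - p z| < e].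
  move=> e0; have /cvg_ball /(_ e e0) := cvL.
  rewrite near_withinE => H; apply: filterS H => z H Rz.
  have [[D1 D2 D3 D4] _] := regular_partials Rz.
  have [_ H'] := H (conj Rz (hp z Rz)).
  have [_ z10 gz0] := (regular_setP z).1 Rz.
  have wz0 : wt z.1 != 0 by rewrite gt_eqF// weight_gt0.
  have wgz0 : wt (g z).1 != 0 by rewrite gt_eqF// weight_gt0.
  have E2 : derY alpha g1 z = - q z by rewrite /derY; case: D2 => _ ->; rewrite mulrC divfK.
  have E4 : derY alpha g2 z / wt (g z).1 = p z.
    rewrite /derY; case: D4 => _ ->; rewrite -[`|_| `^ _]/(wt z.1).
    by field; rewrite wz0 wgz0.
  have := H' 0 0; have := H' 0 1; have := H' 1 0; have := H' 1 1.
  by rewrite /Dmx /mx2 !mxE /= /ball /= E2 E4 opprK.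
have [A [B [EA EB]]] : exists A B : R, [/\ L 0 0 = A, L 1 0 = B & A != 0 \/ B != 0].
  exists (L 0 0), (L 1 0); split=> //; apply: contrapT => /not_orP[/negP/negPn/eqP A0 /negP/negPn/eqP B0].
  have small (x : R) : x != 0 -> (forall e : R, 0 < e -> exists t, `|t| < e /\ `|x + t| < e) -> False.
    move=> x0 H; have h : 0 < `|x| / 2 by rewrite divr_gt0// normr_gt0.
    have [t [t1 t2]] := H _ h; have := ler_normB (x + t) t; rewrite addrK; lra.
  have L01 : L 0 1 = 0.
    apply/eqP/negPn/negP => /small; apply => e e0.
    have [w Hw Rw] := regular_dense Oz0 (near_entry e e0).
    have [_ h1 h2 _] := Hw Rw; exists (q w); split=> //.
    by move: h2; rewrite B0 sub0r normrN.
  have L11 : L 1 1 = 0.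
    apply/eqP/negPn/negP => /small; apply => e e0.
    have [w Hw Rw] := regular_dense Oz0 (near_entry e e0).
    have [h1 _ _ h2] := Hw Rw; exists (- p w); split=> //.
    by move: h1; rewrite A0 sub0r.
  move/eqP: L0; apply; apply/matrixP => i j; rewrite mxE.
  have ord2 (k : 'I_2) : k = 0 \/ k = 1.
    by case: k => -[|[|//]] kp; [left|right]; exact: val_inj.
  by case: (ord2 i) => ->; case: (ord2 j) => ->.
have bound (C x e : R) : `|C - x| < e -> `|x| <= `|C| + e.
  by move=> h; have := ler_normB C (C - x); rewrite opprB addrCA subrr addr0; lra.
have low (C x : R) : `|C - x| < `|C| / 2 -> `|C| / 2 <= `|x|.
  by move=> h; have := ler_normD (C - x) x; rewrite subrK; lra.
pose M := `|A| + `|B| + 1; have M0 : 0 < M by rewrite ltr_wpDl// addr_ge0.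
have nM : \forall z \near z0, Rg z -> `|p z| <= M /\ `|q z| <= M.
  apply: filterS (near_entry 1 ltr01) => z H /H[h1 _ h2 _].
  rewrite EA in h1; rewrite EB in h2; have := bound _ _ _ h1; have := bound _ _ _ h2.
  by have := normr_ge0 A; have := normr_ge0 B; rewrite /M => *; split; lra.
case=> C0.
- exists M, (`|A| / 2); have m0 : 0 < `|A| / 2 by rewrite divr_gt0// normr_gt0.
  split=> //; left; apply: filterS (near_entry _ m0) => z H /H[h1 _ _ _].
  by apply: low; rewrite -EA; rewrite EA in h1 *.
- exists M, (`|B| / 2); have m0 : 0 < `|B| / 2 by rewrite divr_gt0// normr_gt0.
  split=> //; right; apply: filterS (near_entry _ m0) => z H /H[_ _ h1 _].
  by apply: low; rewrite -EB; rewrite EB in h1 *.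
Qed.

Lemma coordinate_near_neq0 (z : R * R) : z.1 != 0 -> \forall w \near z, w.1 != 0.
Proof.
by move=> z0; apply: (@cvgr_neq0 _ _ _ (nbhs z) _ (fun w : R * R => w.1) z.1) => //; exact: cvg_fst.
Qed.

Lemma near_bounded (f : R * R -> R) z : {for z, continuous f} ->
  \forall w \near z, `|f w| <= `|f z| + 1.
Proof.
move=> cf; have /cvgrPdist_lt/(_ _ ltr01) : f w @[w --> z] --> f z by exact: cf.
by apply: filterS => w h; have := ler_normB (f z) (f z - f w); rewrite opprB addrCA subrr addr0; lra.
Qed.

Lemma near_half (f : R * R -> R) z : {for z, continuous f} -> 0 < f z ->
  \forall w \near z, f z / 2 <= f w.
Proof.
move=> cf f0; have h : 0 < f z / 2 by rewrite divr_gt0.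
have /cvgrPdist_lt/(_ _ h) : f w @[w --> z] --> f z by exact: cf.
by apply: filterS => w; rewrite ltr_norml => /andP[_]; lra.
Qed.

(** The vertical derivatives of [g] blow up at axis points that do not map to
    the axis. *)
Lemma axis_to_axis z0 : Om z0 -> z0.1 = 0 -> (g z0).1 = 0.
Proof.
move=> Oz0 z00; apply/eqP/negPn/negP => gz0.
have Sz0 : Sg z0 by split=> //; left.
have [M [m [M0 m0 _ lower]]] := near_singular_entries Sz0.
have cg1 := map_continuous1 Oz0; have cg2 := map_continuous2 Oz0.
have nR : \forall z \near z0, z.1 != 0 -> Rg z.
  have N1 : nbhs z0 Om by exact: open_nbhs_nbhs.
  have N2 : nbhs z0 [set w | (g w).1 != 0].
    exact: (@cvgr_neq0 _ _ _ (nbhs z0) _ g1 (g z0).1 cg1).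
  by apply: filterS (filterI N1 N2) => z [Oz gz] z1; apply/regular_setP.
have b1 := near_bounded cg1; have b2 := near_bounded cg2.
case: lower => lower.
- have cW : {for z0, continuous (fun z => wt (g z).1)}.
    by apply: (@continuous_comp _ _ _ g1 wt); [exact: cg1|exact: continuous_weight].
  have W0 : 0 < wt (g z0).1 by rewrite weight_gt0.
  apply: (@vertical_blow_up R alpha alpha0 g2 z0 _ (m * (wt (g z0).1 / 2)) z00).
  + by rewrite mulr_gt0// divr_gt0.
  + by apply: filterS b2 => z h _; exact: h.
  + apply: filterS (filterI nR (filterI lower (near_half cW W0))) => z [H1 [H2 H3]] z1.
    have Rz := H1 z1; have [[_ _ _ D] _] := regular_partials Rz.
    exists (p z * wt (g z).1 / wt z.1) => //.
    have wz0 : 0 < wt z.1 by rewrite weight_gt0.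
    have -> : wt z.1 * `|p z * wt (g z).1 / wt z.1| = `|p z| * wt (g z).1.
      rewrite !normrM normfV (gtr0_norm wz0) (ger0_norm (weight_ge0 _ _)) mulrC divfK// gt_eqF//.
    by apply: ler_pM => //; [exact: ltW|rewrite divr_ge0// ltW|exact: H2].
- apply: (@vertical_blow_up R alpha alpha0 g1 z0 _ m z00 m0).
  + by apply: filterS b1 => z h _; exact: h.
  + apply: filterS (filterI nR lower) => z [H1 H2] z1.
    have Rz := H1 z1; have [[_ D _ _] _] := regular_partials Rz.
    exists (- q z / wt z.1) => //.
    have wz0 : 0 < wt z.1 by rewrite weight_gt0.
    rewrite normrM normfV (gtr0_norm wz0) normrN mulrC divfK ?gt_eqF//.
    exact: H2.
Qed.


Hypothesis oOm' : open Om'.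

Lemma inverse_map : exists h : R * R -> R * R,
  (forall z, Om z -> Om' (g z) /\ h (g z) = z) /\
  (forall w, Om' w -> [/\ Om (h w), g (h w) = w & {for w, continuous h}]).
Proof.
case: hconf => -[[im _ sur] [h [gh _ ch]]] _ _ _; exists h; split.
  by move=> z Oz; split; [exact: im|apply: gh; rewrite inE].
move=> w Ow; have [z Oz gz] := sur w Ow; have hw : h w = z by rewrite -gz gh ?inE.
split; rewrite ?hw//.
by move: ch; rewrite continuous_open_subspace// => /(_ w); apply; rewrite inE.
Qed.

Lemma regular_near z : Rg z -> \forall w \near z, Rg w.
Proof. exact: open_regular_set. Qed.

Lemma regular_caratheodory z : Rg z -> exists A1 B1 A2 B2 : R * R -> R,
  [/\ A1 w @[w --> z] --> p z, B1 w @[w --> z] --> - q z / wt z.1,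
      A2 w @[w --> z] --> q z * wt (g z).1,
      B2 w @[w --> z] --> p z * wt (g z).1 / wt z.1 &
      \forall w \near z,
        (g w).1 - (g z).1 = A1 w * (w.1 - z.1) + B1 w * (w.2 - z.2) /\
        (g w).2 - (g z).2 = A2 w * (w.1 - z.1) + B2 w * (w.2 - z.2)].
Proof.
move=> Rz; have [_ [cp cq]] := regular_partials Rz; have nR := regular_near Rz.
have [Oz z0 gz0] := (regular_setP z).1 Rz.
have cV : {for z, continuous (fun z : R * R => (wt z.1)^-1)}.
  apply: cvgV; first by rewrite gt_eqF// weight_gt0.
  by apply: continuous_comp; [exact: cvg_fst|exact: continuous_weight].
have cW : {for z, continuous (fun z => wt (g z).1)}.
  by apply: (@continuous_comp _ _ _ g1 wt); [exact: map_continuous1|exact: continuous_weight].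
have [A1 [B1 [a1 b1 E1]]] : exists A B : R * R -> R, [/\ A w @[w --> z] --> p z,
    B w @[w --> z] --> - q z / wt z.1 &
    \forall w \near z, (g w).1 - (g z).1 = A w * (w.1 - z.1) + B w * (w.2 - z.2)].
  apply: (@caratheodory R g1 p (fun z => - q z / wt z.1)) => //.
  - by apply: filterS nR => w Rw; have [[D1 D2 _ _] _] := regular_partials Rw.
  - by apply: cvgM; [apply: cvgN; exact: cq|exact: cV].
have [A2 [B2 [a2 b2 E2]]] : exists A B : R * R -> R, [/\ A w @[w --> z] --> q z * wt (g z).1,
    B w @[w --> z] --> p z * wt (g z).1 / wt z.1 &
    \forall w \near z, (g w).2 - (g z).2 = A w * (w.1 - z.1) + B w * (w.2 - z.2)].
  apply: (@caratheodory R g2 (fun z => q z * wt (g z).1) (fun z => p z * wt (g z).1 / wt z.1)) => //.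
  - by apply: filterS nR => w Rw; have [[_ _ D1 D2] _] := regular_partials Rw.
  - by apply: cvgM; [exact: cq|exact: cW].
  - by apply: cvgM; [apply: cvgM; [exact: cp|exact: cW]|exact: cV].
exists A1, B1, A2, B2; split=> //.
exact: filterI E1 E2.
Qed.

(** Cramer's rule for the increments of [g] differentiates the inverse map. *)
Lemma inverse_vertical_derivative (h : R * R -> R * R) z :
  (forall z, Om z -> Om' (g z) /\ h (g z) = z) ->
  (forall w, Om' w -> [/\ Om (h w), g (h w) = w & {for w, continuous h}]) ->
  Rg z -> 0 < p z ^+ 2 + q z ^+ 2 ->
  is_derive (g z) (e2 : R * R) (fun w => (h w).1) (q z / (wt (g z).1 * (p z ^+ 2 + q z ^+ 2))) /\
  is_derive (g z) (e2 : R * R) (fun w => (h w).2)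
    (p z * wt z.1 / (wt (g z).1 * (p z ^+ 2 + q z ^+ 2))).
Proof.
move=> hK gK Rz n0; have [Oz z0 gz0] := (regular_setP z).1 Rz.
have [Ow hgz] := hK z Oz; have [_ _ ch] := gK _ Ow.
have [A1 [B1 [A2 [B2 [a1 b1 a2 b2 E]]]]] := regular_caratheodory Rz.
have X0 : wt z.1 != 0 by rewrite gt_eqF// weight_gt0.
have W0 : wt (g z).1 != 0 by rewrite gt_eqF// weight_gt0.
pose D w := A1 w * B2 w - A2 w * B1 w.
have cD : D w @[w --> z] --> wt (g z).1 * (p z ^+ 2 + q z ^+ 2) / wt z.1.
  have -> : wt (g z).1 * (p z ^+ 2 + q z ^+ 2) / wt z.1 =
    p z * (p z * wt (g z).1 / wt z.1) - q z * wt (g z).1 * (- q z / wt z.1) by field.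
  by apply: cvgB; apply: cvgM.
have D0 : wt (g z).1 * (p z ^+ 2 + q z ^+ 2) / wt z.1 != 0.
  by rewrite !mulf_neq0 ?invr_eq0// gt_eqF.
pose path (t : R) := t *: (e2 : R * R) + g z.
have cpath : path t @[t --> (0 : R)^'] --> g z.
  have cp : {for (0 : R), continuous path}.
    apply: (@cvgD _ _ _ (nbhs (0 : R)) _ (fun t : R => t *: (e2 : R * R)) (fun=> g z)); last exact: cvg_cst.
    by apply: (@cvgZ _ _ _ (nbhs (0 : R)) _ id (fun=> (e2 : R * R))); [exact: cvg_id|exact: cvg_cst].
  have {}cp : path t @[t --> (0 : R)] --> path 0 by exact: cp.
  have E0 : path 0 = g z by rewrite /path scale0r add0r.
  rewrite E0 in cp; exact: cvg_within_filter.
have chp : h (path t) @[t --> (0 : R)^'] --> z.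
  by rewrite -[X in _ --> X]hgz; apply: (cvg_comp _ _ cpath); exact: ch.
have nt : \forall t \near (0 : R)^', [/\ t != 0, Om' (path t), D (h (path t)) != 0 &
    (g (h (path t))).1 - (g z).1 = A1 (h (path t)) * ((h (path t)).1 - z.1) + B1 (h (path t)) * ((h (path t)).2 - z.2) /\
    (g (h (path t))).2 - (g z).2 = A2 (h (path t)) * ((h (path t)).1 - z.1) + B2 (h (path t)) * ((h (path t)).2 - z.2)].
  have N1 : \forall t \near (0 : R)^', Om' (path t).
    by apply: cpath; exact: open_nbhs_nbhs.
  have N2 : \forall t \near (0 : R)^', D (h (path t)) != 0.
    have Dn : \forall w \near z, D w != 0 by exact: (@cvgr_neq0 _ _ _ (nbhs z) _ D _ cD D0).
    exact: chp _ Dn.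
  have N3 := chp _ E.
  near=> t; split.
  - by near: t; exact: nbhs_dnbhs_neq.
  - by near: t.
  - by near: t.
  - by near: t.
have solve : \forall t \near (0 : R)^',
    - B1 (h (path t)) / D (h (path t)) = t^-1 *: ((h (path t)).1 - (h (g z)).1) /\
    A1 (h (path t)) / D (h (path t)) = t^-1 *: ((h (path t)).2 - (h (g z)).2).
  apply: filterS nt => t [t0 Ot Dt []]; have [_ -> _] := gK _ Ot; rewrite hgz.
  have -> : (path t).1 - (g z).1 = 0 by rewrite -[LHS]/(t * 0 + (g z).1 - (g z).1); ring.
  have -> : (path t).2 - (g z).2 = t by rewrite -[LHS]/(t * 1 + (g z).2 - (g z).2); ring.
  move: (h (path t)) Dt => w Dw; rewrite /GRing.scale /= => F1 F2.
  have k1 : (w.1 - z.1) * D w = - (t * B1 w).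
    have -> : (w.1 - z.1) * D w = (A1 w * (w.1 - z.1) + B1 w * (w.2 - z.2)) * B2 w
       - (A2 w * (w.1 - z.1) + B2 w * (w.2 - z.2)) * B1 w by rewrite /D; ring.
    by rewrite -F1 -F2; ring.
  have k2 : (w.2 - z.2) * D w = t * A1 w.
    have -> : (w.2 - z.2) * D w = (A2 w * (w.1 - z.1) + B2 w * (w.2 - z.2)) * A1 w
       - (A1 w * (w.1 - z.1) + B1 w * (w.2 - z.2)) * A2 w by rewrite /D; ring.
    by rewrite -F1 -F2; ring.
  split; apply: (mulIf Dw); rewrite divfK// -mulrA; [rewrite k1|rewrite k2].
    by rewrite mulrN mulKf.
  by rewrite mulKf.
split; apply/is_derive_cvgP.
- have S1 : \forall t \near (0 : R)^', - B1 (h (path t)) / D (h (path t)) = t^-1 *: ((h (path t)).1 - (h (g z)).1).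
    by apply: filterS solve => t [].
  apply: cvg_trans (near_eq_cvg S1) _.
  have -> : q z / (wt (g z).1 * (p z ^+ 2 + q z ^+ 2)) =
      - (- q z / wt z.1) / (wt (g z).1 * (p z ^+ 2 + q z ^+ 2) / wt z.1).
    by field; rewrite X0 W0 gt_eqF.
  apply: (cvg_comp _ _ chp (_ : - B1 w / D w @[w --> z] --> _)).
  by apply: cvgM; [exact: cvgN|exact: cvgV].
- have S1 : \forall t \near (0 : R)^', A1 (h (path t)) / D (h (path t)) = t^-1 *: ((h (path t)).2 - (h (g z)).2).
    by apply: filterS solve => t [].
  apply: cvg_trans (near_eq_cvg S1) _.
  have -> : p z * wt z.1 / (wt (g z).1 * (p z ^+ 2 + q z ^+ 2)) =
      p z / (wt (g z).1 * (p z ^+ 2 + q z ^+ 2) / wt z.1).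
    by field; rewrite X0 W0 gt_eqF.
  apply: (cvg_comp _ _ chp (_ : A1 w / D w @[w --> z] --> _)).
  by apply: cvgM => //; exact: cvgV.
Unshelve. all: by end_near. Qed.

(** The same blow-up for the inverse map: near a point that maps to the axis
    its vertical derivative, multiplied by the weight, stays away from 0. *)
Lemma axis_from_axis z0 : Om z0 -> (g z0).1 = 0 -> z0.1 = 0.
Proof.
move=> Oz0 gz00; apply/eqP/negPn/negP => z00.
have Sz0 : Sg z0 by split=> //; right.
have [M [m [M0 m0 upper lower]]] := near_singular_entries Sz0.
have [h [hK gK]] := inverse_map; have [Ow0 hw0] := hK _ Oz0; have [_ _ ch] := gK _ Ow0.
have chz : h w @[w --> g z0] --> z0 by rewrite -[X in _ --> X]hw0; exact: ch.
have nR : \forall w \near g z0, w.1 != 0 -> Om' w /\ Rg (h w).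
  have N1 : \forall w \near g z0, Om' w by exact: open_nbhs_nbhs.
  have N2 := chz _ (coordinate_near_neq0 z00).
  apply: filterS (filterI N1 N2) => w [Ow hw] w1; split=> //.
  by have [Oh gh _] := gK w Ow; apply/regular_setP; split=> //; rewrite gh.
have ch1 : {for g z0, continuous (fun w => (h w).1)}.
  by apply: (@continuous_comp _ _ _ h fst); [exact: ch|exact: cvg_fst].
have ch2 : {for g z0, continuous (fun w => (h w).2)}.
  by apply: (@continuous_comp _ _ _ h snd); [exact: ch|exact: cvg_snd].
have M20 : 0 < 2 * M ^+ 2 by rewrite mulr_gt0// exprn_gt0.
have sq_le (x y : R) : 0 <= y -> `|x| <= y -> x ^+ 2 <= y ^+ 2.
  by move=> y0 xy; rewrite -(real_normK (num_real x)) ler_pXn2r// nnegrE.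
have norm_bound z : `|p z| <= M /\ `|q z| <= M -> p z ^+ 2 + q z ^+ 2 <= 2 * M ^+ 2.
  by move=> [/(sq_le _ _ (ltW M0)) h1 /(sq_le _ _ (ltW M0)) h2]; lra.
have norm_pos z : m <= `|p z| \/ m <= `|q z| -> 0 < p z ^+ 2 + q z ^+ 2.
  have s (x : R) : m <= `|x| -> 0 < x ^+ 2.
    by move=> mx; rewrite exprn_even_gt0//= -normr_gt0 (lt_le_trans m0).
  by case=> /s; [move=> ?; rewrite ltr_pwDl// sqr_ge0|move=> ?; rewrite ltr_wpDl// sqr_ge0].
have key (x : R) z (W : R) : 0 < W -> 0 < p z ^+ 2 + q z ^+ 2 -> p z ^+ 2 + q z ^+ 2 <= 2 * M ^+ 2 ->
    `|x| / (2 * M ^+ 2) <= W * `|x / (W * (p z ^+ 2 + q z ^+ 2))|.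
  move=> W0 n0 nM; rewrite normrM normfV normrM (gtr0_norm W0) (gtr0_norm n0).
  have -> : W * (`|x| / (W * (p z ^+ 2 + q z ^+ 2))) = `|x| / (p z ^+ 2 + q z ^+ 2).
    by field; rewrite !gt_eqF.
  by rewrite ler_wpM2l// lef_pV2 ?posrE.
case: lower => lower.
- have X0 : 0 < wt z0.1 by rewrite weight_gt0.
  have cX : {for z0, continuous (fun z : R * R => wt z.1)}.
    by apply: continuous_comp; [exact: cvg_fst|exact: continuous_weight].
  apply: (@vertical_blow_up R alpha alpha0 (fun w => (h w).2) (g z0) _ (m * (wt z0.1 / 2) / (2 * M ^+ 2)) gz00).
  + by rewrite divr_gt0// mulr_gt0// divr_gt0.
  + by apply: filterS (near_bounded ch2) => w b _; exact: b.
  + apply: filterS (filterI nR (chz _ (filterI lower (filterI upper (near_half cX X0))))).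
    move=> w [H1 [H2 [H3 H4]]] w1; have [Ow Rw] := H1 w1; have [_ gw _] := gK w Ow.
    have n0 := norm_pos _ (or_introl (H2 Rw)).
    have [_ D] := inverse_vertical_derivative hK gK Rw n0; rewrite gw in D.
    eexists; first exact: D.
    apply: le_trans (key _ _ _ _ n0 (norm_bound _ (H3 Rw))); last by rewrite weight_gt0.
    rewrite ler_pM2r ?invr_gt0// normrM (ger0_norm (weight_ge0 _ _)).
    by apply: ler_pM => //; [exact: ltW|rewrite divr_ge0// ltW|exact: H2].
- apply: (@vertical_blow_up R alpha alpha0 (fun w => (h w).1) (g z0) _ (m / (2 * M ^+ 2)) gz00).
  + by rewrite divr_gt0.
  + by apply: filterS (near_bounded ch1) => w b _; exact: b.
  + apply: filterS (filterI nR (chz _ (filterI lower upper))).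
    move=> w [H1 [H2 H3]] w1; have [Ow Rw] := H1 w1; have [_ gw _] := gK w Ow.
    have n0 := norm_pos _ (or_intror (H2 Rw)).
    have [D _] := inverse_vertical_derivative hK gK Rw n0; rewrite gw in D.
    eexists; first exact: D.
    apply: le_trans (key _ _ _ _ n0 (norm_bound _ (H3 Rw))); last by rewrite weight_gt0.
    by rewrite ler_pM2r ?invr_gt0//; exact: H2.
Qed.

(** * Behaviour near the axis *)

Lemma offaxis_regular z : Om z -> z.1 != 0 -> Rg z.
Proof.
move=> Oz z0; apply/regular_setP; split=> //; apply/eqP => /(axis_from_axis Oz).
by move/eqP: z0.
Qed.

Lemma axis_singular z : Om z -> z.1 = 0 -> Sg z.
Proof. by move=> Oz z0; split=> //; left. Qed.

Lemma entries_bounded z0 : Om z0 -> exists2 M : R, 0 < M &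
  \forall z \near z0, Rg z -> `|p z| <= M /\ `|q z| <= M.
Proof.
move=> Oz0; have [z00|z00] := eqVneq z0.1 0.
  by have [M [m [M0 _ up _]]] := near_singular_entries (axis_singular Oz0 z00); exists M.
have [_ [cp cq]] := regular_partials (offaxis_regular Oz0 z00).
exists (`|p z0| + 1 + (`|q z0| + 1)); first by rewrite addr_gt0// ltr_wpDl.
apply: filterS (filterI (near_bounded cp) (near_bounded cq)) => z [h1 h2] _.
by have := normr_ge0 (p z0); have := normr_ge0 (q z0); split; lra.
Qed.

Lemma entries_nondegenerate z0 : Om z0 -> z0.1 = 0 -> exists2 m : R, 0 < m &
  \forall z \near z0, Rg z -> m <= `|p z| \/ m <= `|q z|.
Proof.
move=> Oz0 z00; have [M [m [_ m0 _ lower]]] := near_singular_entries (axis_singular Oz0 z00).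
by exists m => //; case: lower => lower; apply: filterS lower => z h /h; [left|right].
Qed.

(** The horizontal derivative [p] of [g1] is bounded, and [g1] vanishes on the
    axis. *)
Lemma axis_linear z0 : Om z0 -> z0.1 = 0 -> exists2 N : R, 0 < N &
  \forall z \near z0, `|(g z).1| <= N * `|z.1|.
Proof.
move=> Oz0 z00; have [M M0 nM] := entries_bounded Oz0; exists M => //.
have nO : \forall z \near z0, Om z by exact: open_nbhs_nbhs.
have [r r0 H] := near_ball (filterI nO nM).
apply: (ball_near r0) => z h1 h2; rewrite z00 subr0 in h1.
have B x : `|x| <= `|z.1| -> Om (x, z.2).
  move=> hx; have k1 : `|(x, z.2).1 - z0.1| < r by rewrite /= z00 subr0 (le_lt_trans hx).
  by have [] := H (x, z.2) k1 h2.
have f0 : (g (0, z.2)).1 = 0 by apply: axis_to_axis => //; apply: B; rewrite normr0.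
pose d x := if x == 0 then 0 else p (x, z.2).
have dM x : `|x| <= `|z.1| -> `|d x| <= M.
  move=> hx; rewrite /d; case: eqP => [_|/eqP x0]; first by rewrite normr0 ltW.
  have k1 : `|(x, z.2).1 - z0.1| < r by rewrite /= z00 subr0 (le_lt_trans hx).
  by have [_ h] := H (x, z.2) k1 h2; have [] := h (offaxis_regular (B x hx) x0).
have cI x : `|x| <= `|z.1| -> {for x, continuous (fun x => (g (x, z.2)).1)}.
  move=> hx; apply: (@continuous_comp _ _ _ (fun x => (x, z.2)) g1).
    exact: (cvg_pair cvg_id (cvg_cst z.2)).
  exact/map_continuous1/B.
have dI x : `|x| <= `|z.1| -> x != 0 -> is_derive x (1 : R) (fun x => (g (x, z.2)).1) (d x).
  move=> hx x0; have [[/is_derive_slice1 D _ _ _] _] := regular_partials (offaxis_regular (B x hx) x0).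
  by rewrite /d (negbTE x0).
have Ez : g z = g (z.1, z.2) by rewrite -surjective_pairing.
have [zp|/ltW zn] := leP 0 z.1.
  have cI' x : 0 <= x <= z.1 -> {for x, continuous (fun x => (g (x, z.2)).1)}.
    by move=> /andP[x1 x2]; apply: cI; rewrite !ger0_norm.
  have dI' x : 0 < x < z.1 -> is_derive x (1 : R) (fun x => (g (x, z.2)).1) (d x).
    move=> /andP[x1 x2]; have x1' := ltW x1.
    by apply: dI; [rewrite !ger0_norm// ltW|rewrite gt_eqF].
  have [c /andP[c1 c2] E] := increment_mean zp cI' dI'.
  rewrite Ez -[X in `|X|]subr0 -[X in _ - X]f0 E subr0 normrM ler_wpM2r// dM//.
  by rewrite !ger0_norm.
have cI' x : z.1 <= x <= 0 -> {for x, continuous (fun x => (g (x, z.2)).1)}.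
  by move=> /andP[x1 x2]; apply: cI; rewrite !ler0_norm// lerN2.
have dI' x : z.1 < x < 0 -> is_derive x (1 : R) (fun x => (g (x, z.2)).1) (d x).
  move=> /andP[x1 x2]; have x2' := ltW x2.
  by apply: dI; [rewrite !ler0_norm// lerN2 ltW|rewrite lt_eqF].
have [c /andP[c1 c2] E] := increment_mean zn cI' dI'.
rewrite Ez -normrN -[X in `|X|]add0r -[X in X - _]f0 E sub0r normrM normrN ler_wpM2r// dM//.
by rewrite !ler0_norm// lerN2.
Qed.

Definition locally_lipschitz (F : R * R -> R) z := exists2 r : R, 0 < r & exists L : R,
  forall w w', `|w.1 - z.1| < r -> `|w.2 - z.2| < r -> `|w'.1 - z.1| < r -> `|w'.2 - z.2| < r ->
  `|F w' - F w| <= L * (`|w'.1 - w.1| + `|w'.2 - w.2|).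

Lemma locally_lipschitz_of_bounds (f f1 f2 : R * R -> R) z (L : R) : 0 <= L ->
  (\forall w \near z, {for w, continuous f} /\ (w.1 != 0 ->
     [/\ is_derive w (e1 : R * R) f (f1 w), is_derive w (e2 : R * R) f (f2 w),
       `|f1 w| <= L & `|f2 w| <= L])) -> locally_lipschitz f z.
Proof.
move=> L0 /near_ball[r r0 H]; exists r => //; exists L.
exact: (lipschitz_off_axis L0 H).
Qed.

Let continuous_wt_first z : Om z -> {for z, continuous (fun z => wt (g z).1)}.
Proof.
by move=> Oz; apply: (@continuous_comp _ _ _ g1 wt); [exact: map_continuous1|exact: continuous_weight].
Qed.

Let continuous_inv_wt z : z.1 != 0 -> {for z, continuous (fun z : R * R => (wt z.1)^-1)}.
Proof.
move=> z0; apply: cvgV; first by rewrite gt_eqF// weight_gt0.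
by apply: continuous_comp; [exact: cvg_fst|exact: continuous_weight].
Qed.

(** The bound of [axis_linear] cancels the factor [1 / wt x] of the vertical
    derivative of the second component. *)
Lemma second_locally_lipschitz z0 : Om z0 -> locally_lipschitz g2 z0.
Proof.
move=> Oz0.
have nO : \forall z \near z0, Om z by exact: open_nbhs_nbhs.
suff [L L0 nL] : exists2 L : R, 0 <= L & \forall w \near z0, w.1 != 0 ->
    `|q w * wt (g w).1| <= L /\ `|p w * wt (g w).1 / wt w.1| <= L.
  apply: (locally_lipschitz_of_bounds L0).
  apply: filterS (filterI nO nL) => w [Ow hL]; split; first exact: map_continuous2.
  move=> w0; have [h1 h2] := hL w0.
  by have [[_ _ D1 D2] _] := regular_partials (offaxis_regular Ow w0); split; [exact: D1|exact: D2| |].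
have [z00|z00] := eqVneq z0.1 0; last first.
  have [_ [cp cq]] := regular_partials (offaxis_regular Oz0 z00).
  have cW := continuous_wt_first Oz0; have cV := continuous_inv_wt z00.
  have c1 : {for z0, continuous (fun w => q w * wt (g w).1)} by apply: cvgM; [exact: cq|exact: cW].
  have c2 : {for z0, continuous (fun w => p w * wt (g w).1 / wt w.1)}.
    by apply: cvgM; [apply: cvgM; [exact: cp|exact: cW]|exact: cV].
  exists (`|q z0 * wt (g z0).1| + 1 + (`|p z0 * wt (g z0).1 / wt z0.1| + 1)).
    by rewrite !addr_ge0.
  apply: filterS (filterI (near_bounded c1) (near_bounded c2)) => w [h1 h2] _.
  have := normr_ge0 (q z0 * wt (g z0).1); have := normr_ge0 (p z0 * wt (g z0).1 / wt z0.1).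
  by split; lra.
have [M M0 nM] := entries_bounded Oz0; have [N N0 nN] := axis_linear Oz0 z00.
exists (M * wt 1 + M * wt N); first by rewrite addr_ge0// mulr_ge0 ?(ltW M0)// weight_ge0.
have nB := near_bounded (map_continuous1 Oz0).
apply: filterS (filterI nO (filterI nM (filterI nN nB))) => w [Ow [hM [hN hB]]] w0.
have [hp hq] := hM (offaxis_regular Ow w0).
have g00 : (g z0).1 = 0 by exact: axis_to_axis.
have w1 : wt (g w).1 <= wt 1.
  by apply: weight_le => //; rewrite normr1; move: hB; rewrite g00 normr0 add0r.
have w2 : wt (g w).1 / wt w.1 <= wt N.
  rewrite ler_pdivrMr ?weight_gt0// -weightM//; apply: weight_le => //.
  by rewrite normrM (gtr0_norm N0).
have A1 : `|q w * wt (g w).1| <= M * wt 1.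
  by rewrite normrM (ger0_norm (weight_ge0 _ _)) ler_pM// weight_ge0.
have A2 : `|p w * wt (g w).1 / wt w.1| <= M * wt N.
  have d0 : 0 <= wt (g w).1 / wt w.1 by rewrite divr_ge0// weight_ge0.
  by rewrite -mulrA normrM (ger0_norm d0) ler_pM.
have : 0 <= M * wt 1 by rewrite mulr_ge0 ?(ltW M0)// weight_ge0.
have : 0 <= M * wt N by rewrite mulr_ge0 ?(ltW M0)// weight_ge0.
by split; lra.
Qed.

(** The vertical derivative of [g1] is unbounded near the axis, but there the
    truncation of [g1] vanishes. *)
Lemma truncated_first_locally_lipschitz (eta : R) z0 : 0 < eta -> Om z0 ->
  locally_lipschitz (fun w => truncate eta (g w).1) z0.
Proof.
move=> eta0 Oz0; have nO : \forall z \near z0, Om z by exact: open_nbhs_nbhs.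
have [z00|z00] := eqVneq z0.1 0.
  have /cvgrPdist_lt/(_ _ eta0)/near_ball[r r0 H] : (g w).1 @[w --> z0] --> (g z0).1.
    exact: map_continuous1.
  exists r => //; exists 0 => w w' h1 h2 h3 h4.
  have g00 : (g z0).1 = 0 by exact: axis_to_axis.
  have flat v : `|v.1 - z0.1| < r -> `|v.2 - z0.2| < r -> truncate eta (g v).1 = 0.
    by move=> k1 k2; apply: truncate_small; have := H v k1 k2; rewrite g00 sub0r normrN => /ltW.
  by rewrite !flat// subrr normr0 mul0r.
have Rz0 := offaxis_regular Oz0 z00; have [_ [cp cq]] := regular_partials Rz0.
have cV := continuous_inv_wt z00.
have c2 : {for z0, continuous (fun w => - q w / wt w.1)}.
  by apply: cvgM; [apply: cvgN; exact: cq|exact: cV].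
have [r r0 [L HL]] : locally_lipschitz g1 z0.
  apply: (@locally_lipschitz_of_bounds g1 p (fun w => - q w / wt w.1) z0
    (`|p z0| + 1 + (`|- q z0 / wt z0.1| + 1))); first by rewrite !addr_ge0.
  apply: filterS (filterI nO (filterI (near_bounded cp) (near_bounded c2))) => w [Ow [h1 h2]].
  split; first exact: map_continuous1.
  move=> w0; have [[D1 D2 _ _] _] := regular_partials (offaxis_regular Ow w0).
  have := normr_ge0 (p z0); have := normr_ge0 (- q z0 / wt z0.1).
  by split; [exact: D1|exact: D2|lra|lra].
exists r => //; exists L => w w' h1 h2 h3 h4.
by apply: le_trans (truncate_contraction _ _ (ltW eta0)) _; exact: HL.
Qed.

(** * Admissible curves and their images *)

Lemma chain_rule (gam : R -> R * R) t (x y : R) : Rg (gam t) ->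
  is_derive t (1 : R) (fun s => (gam s).1) x -> is_derive t (1 : R) (fun s => (gam s).2) y ->
  is_derive t (1 : R) (fun s => (g (gam s)).1) (p (gam t) * x + - q (gam t) / wt (gam t).1 * y) /\
  is_derive t (1 : R) (fun s => (g (gam s)).2)
    (q (gam t) * wt (g (gam t)).1 * x + p (gam t) * wt (g (gam t)).1 / wt (gam t).1 * y).
Proof.
move=> Rt d1 d2; have [A1 [B1 [A2 [B2 [a1 b1 a2 b2 E]]]]] := regular_caratheodory Rt.
have E1 : \forall w \near gam t, g1 w - g1 (gam t) = A1 w * (w.1 - (gam t).1) + B1 w * (w.2 - (gam t).2).
  by apply: filterS E => w [].
have E2 : \forall w \near gam t, g2 w - g2 (gam t) = A2 w * (w.1 - (gam t).1) + B2 w * (w.2 - (gam t).2).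
  by apply: filterS E => w [].
by split; [exact: (is_derive_along a1 b1 E1 d1 d2)|exact: (is_derive_along a2 b2 E2 d1 d2)].
Qed.

Lemma velocityE (u1 u2 : R) z : u1 *: fieldX z + u2 *: fieldY alpha z = (u1, u2 * wt z.1).
Proof.
rewrite -[LHS]/(u1 * 1 + u2 * 0, u1 * 0 + u2 * wt z.1).
by rewrite mulr1 !mulr0 addr0 add0r.
Qed.

Section Curve.
Variables (a b : R) (gam : R -> R * R).
Hypothesis ab : a <= b.
Hypothesis gamOm : forall t : R, t \in `[a, b] -> Om (gam t).
Hypothesis gamAC : absolutely_continuous a b gam.
Hypothesis gam1 : {ae @lebesgue_measure R, forall t : R, t \in `[a, b] -> (gam t).1 != 0}.

Let OmI t : a <= t <= b -> Om (gam t).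
Proof. by move=> h; apply: gamOm; rewrite in_itv. Qed.

Let AC1 : AC_chain a b (fun t => (gam t).1).
Proof. by have [] := absolutely_continuous_chain gamAC. Qed.

Let AC2 : AC_chain a b (fun t => (gam t).2).
Proof. by have [] := absolutely_continuous_chain gamAC. Qed.

Let cont1 : {within `[a, b], continuous (fun t => (gam t).1)}.
Proof. by have [v Pv] := AC_chain_primitive ab AC1; exact: is_primitive_continuous Pv. Qed.

Let cont2 : {within `[a, b], continuous (fun t => (gam t).2)}.
Proof. by have [v Pv] := AC_chain_primitive ab AC2; exact: is_primitive_continuous Pv. Qed.

Lemma uniform_along (P : R -> R * R -> Prop) :
  (forall C C' z, C <= C' -> P C z -> P C' z) ->
  (forall z, Om z -> exists C, \forall w \near z, P C w) ->
  exists C, forall t, a <= t <= b -> P C (gam t).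
Proof.
move=> mono loc.
have [||r r0 [C HC]] := @lebesgue_number R a b (fun C s _ => P C (gam s)).
- by move=> C C' s _ CC'; exact: mono.
- move=> t tab; have [C /near_ball[r r0 HC]] := loc _ (OmI tab).
  have tI : `[a, b]%classic t by rewrite /= in_itv.
  have [r1 r10 H1] := within_continuous_eps cont1 tI r0.
  have [r2 r20 H2] := within_continuous_eps cont2 tI r0.
  exists (Num.min r1 r2); first by rewrite lt_min r10.
  exists C => s t' sab _; rewrite lt_min => /andP[h1 h2] _.
  have sI : `[a, b]%classic s by rewrite /= in_itv.
  by apply: HC; rewrite distrC; [apply: H1|apply: H2] => //; rewrite distrC.
- by exists C => t tab; apply: (HC t t) => //; rewrite subrr normr0.
Qed.

Lemma entries_bounded_along : exists2 M : R, 0 <= M &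
  forall t, a <= t <= b -> Rg (gam t) -> `|p (gam t)| <= M /\ `|q (gam t)| <= M.
Proof.
have [||M HM] := @uniform_along (fun M z => Rg z -> `|p z| <= M /\ `|q z| <= M).
- by move=> C C' z CC' h /h[h1 h2]; split; exact: le_trans CC'.
- by move=> z /entries_bounded[M _ h]; exists M.
- exists `|M| => // t tab Rt; have [h1 h2] := HM t tab Rt.
  by split; exact: le_trans (ler_norm M).
Qed.

(** Off the axis the euclidean velocity controls the second coefficient; near
    the axis the conformal matrix is invertible with a uniform bound, so the
    image velocity does. *)
Lemma coefficient_bound : exists C : R, forall t, a <= t <= b -> Rg (gam t) -> forall x y : R,
  `|y| <= C * (`|p (gam t) * x - q (gam t) * y| + `|q (gam t) * x + p (gam t) * y| +
     `|y * wt (gam t).1|).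
Proof.
apply: (@uniform_along (fun C z => Rg z -> forall x y : R, `|y| <= C *
  (`|p z * x - q z * y| + `|q z * x + p z * y| + `|y * wt z.1|))).
  by move=> C C' z CC' h Rz x y; apply: le_trans (h Rz x y) _; rewrite ler_wpM2r// !addr_ge0.
move=> z0 Oz0; have [z00|z00] := eqVneq z0.1 0.
  have [M M0 nM] := entries_bounded Oz0; have [m m0 nm] := entries_nondegenerate Oz0 z00.
  exists (M / m ^+ 2); apply: filterS (filterI nM nm) => z [hM hm] Rz x y.
  have [h1 h2] := hM Rz; have h3 := hm Rz.
  set V1 := p z * x - q z * y; set V2 := q z * x + p z * y.
  have m20 : 0 < m ^+ 2 by rewrite exprn_gt0.
  rewrite mulrAC ler_pdivlMr//.
  have n0 : m ^+ 2 <= p z ^+ 2 + q z ^+ 2.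
    have sq (s : R) : m <= `|s| -> m ^+ 2 <= s ^+ 2.
      by move=> ms; rewrite -(real_normK (num_real s)) ler_pXn2r// nnegrE// ltW.
    by case: h3 => /sq h; have := sqr_ge0 (p z); have := sqr_ge0 (q z); lra.
  have E : y * (p z ^+ 2 + q z ^+ 2) = p z * V2 - q z * V1 by rewrite /V1 /V2; ring.
  have A : `|y| * (p z ^+ 2 + q z ^+ 2) <= M * (`|V1| + `|V2|).
    rewrite -[X in _ * X]ger0_norm ?addr_ge0 ?sqr_ge0// -normrM E.
    apply: le_trans (ler_normB _ _) _.
    rewrite (normrM (p z)) (normrM (q z)) mulrDr addrC.
    by apply: lerD; apply: ler_wpM2r.
  apply: (@le_trans _ _ (`|y| * (p z ^+ 2 + q z ^+ 2))); first by rewrite ler_wpM2l.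
  by apply: le_trans A _; rewrite ler_wpM2l ?(ltW M0)// lerDl.
have W0 : 0 < wt z0.1 by rewrite weight_gt0.
have cX : {for z0, continuous (fun z : R * R => wt z.1)}.
  by apply: continuous_comp; [exact: cvg_fst|exact: continuous_weight].
exists (2 / wt z0.1); apply: filterS (near_half cX W0) => z hz _ x y.
rewrite mulrAC ler_pdivlMr//.
have : `|y| * (wt z0.1 / 2) <= `|y * wt z.1|.
  by rewrite normrM (ger0_norm (weight_ge0 _ _)) ler_wpM2l.
have := normr_ge0 (p z * x - q z * y); have := normr_ge0 (q z * x + p z * y); lra.
Qed.

Let ae_regular : {ae @lebesgue_measure R, forall t, t \in `[a, b] -> Rg (gam t)}.
Proof. by apply: aeS gam1 => t H tab; apply: offaxis_regular; [exact: gamOm|exact: H]. Qed.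

Let mI : measurable (`[a, b]%classic : set (measurableTypeR R)). Proof. by []. Qed.

Lemma measurable_div_wt (v f : R -> R) : (@lebesgue_measure R).-integrable `[a, b] (EFin \o v) ->
  {within `[a, b], continuous f} -> measurable_fun `[a, b] (fun t => v t / wt (f t)).
Proof.
move=> iv cf; apply: measurable_funM; first exact: integrable_measurable iv.
rewrite (_ : (fun t => _) = (fun s => s `^ (- alpha)) \o (fun t => `|f t|)).
  apply: measurableT_comp; first exact: measurable_powR.
  apply: measurableT_comp => //; apply: subspace_continuous_measurable_fun => //.
by apply/funext => t /=; rewrite powRN.
Qed.

(** The second component of the image is absolutely continuous because [g2] is
    locally Lipschitz. For the first, the truncations of [g1] along the curve
    are absolutely continuous with derivatives bounded by an integrable function
    that does not depend on the level; letting the level tend to 0 bounds the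
    increments of [g1] itself. The chain rule, valid almost everywhere because
    the curve meets the axis in a null set, expresses the coefficients of the
    image by bounded combinations of those of the curve. *)
Lemma admissible_image : admissible alpha a b gam -> admissible alpha a b (g \o gam).
Proof.
move=> [_ [u1 [u2 [iu1 iu2 du]]]].
have [M M0 HM] := entries_bounded_along.
pose K t := M * (`|u1 t| + `|u2 t|).
have iK : (@lebesgue_measure R).-integrable `[a, b] (EFin \o K).
  apply: integrable_scale => //; apply: integrable_add => //; exact: (integrable_norm _).
have dgam : {ae @lebesgue_measure R, forall t, t \in `[a, b] -> Rg (gam t) /\
   (is_derive t (1 : R) (fun s => (g (gam s)).1) (p (gam t) * u1 t - q (gam t) * u2 t) /\
    is_derive t (1 : R) (fun s => (g (gam s)).2)
      (wt (g (gam t)).1 * (q (gam t) * u1 t + p (gam t) * u2 t)))}.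
  apply: aeS2 du ae_regular => t D H tab; have Rt := H tab; split=> //.
  have := D tab; rewrite velocityE => /is_derive_pairP[d1 d2].
  have [_ w0 _] := (regular_setP _).1 Rt; have wt0 : wt (gam t).1 != 0 by rewrite gt_eqF// weight_gt0.
  have [c1 c2] := chain_rule Rt d1 d2; split.
    by apply: is_derive_eq c1 _; field.
  by apply: is_derive_eq c2 _; field.
have bound (x y s s' : R) : `|s| <= M -> `|s'| <= M -> `|s * x| + `|s' * y| <= M * (`|x| + `|y|).
  by move=> h h'; rewrite !normrM mulrDr; apply: lerD; apply: ler_wpM2r.
pose f t := (g (gam t)).1.
have incr s t : a <= s -> s <= t -> t <= b -> `|f t - f s| <= \int[@lebesgue_measure R]_(x in `]s, t]) K x.
  move=> as_ st tb; apply/ler_addgt0Pr => e e0; pose eta := e / 2.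
  have eta0 : 0 < eta by rewrite divr_gt0.
  have ACT : AC_chain a b (fun t => truncate eta (f t)).
    apply: (AC_chain_along (F := fun w => truncate eta (g w).1)) => // t' t'ab.
    by have [r r0 [L HL]] := truncated_first_locally_lipschitz eta0 (OmI t'ab); exists r => //; exists L.
  have [k Pk] := AC_chain_primitive ab ACT.
  have kK : {ae @lebesgue_measure R, forall t, t \in `]a, b[ -> `|k t| <= K t}.
    apply: aeS2 (ae_derive_primitive Pk) dgam => t' D H t'ab.
    have t'I : t' \in `[a, b] by move: t'ab; rewrite !in_itv /= => /andP[/ltW -> /ltW ->].
    have [Rt [d1 _]] := H t'I; have [h1 h2] := HM t' t'I Rt.
    apply: (@le_trans _ _ `|p (gam t') * u1 t' - q (gam t') * u2 t'|).
      apply: (derivative_le (D t'ab) d1) => s'.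
      exact: truncate_contraction (ltW eta0).
    by apply: le_trans (ler_normB _ _) _; exact: bound.
  have sub : `]s, t]%classic `<=` `[a, b]%classic.
    by move=> x; rewrite /= !in_itv /= => /andP[h1 h2]; rewrite (le_trans as_ (ltW h1)) (le_trans h2 tb).
  have [ik Ek] := Pk; have ik' := integrable_sub_itv ik sub; have iK' := integrable_sub_itv iK sub.
  have T1 : `|truncate eta (f t) - truncate eta (f s)| <= \int[@lebesgue_measure R]_(x in `]s, t]) K x.
    rewrite Ek//; apply: le_trans (le_normr_Rintegral _ ik') _ => //.
    apply: le_Rintegral_ae => //; first exact: (integrable_norm ik').
    by apply: aeS (ae_itv_oo_cc kK) => x H /sub xab; apply: H.
  have T2 := truncate_close (f t) (ltW eta0); have T3 := truncate_close (f s) (ltW eta0).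
  have -> : f t - f s = (truncate eta (f t) - truncate eta (f s)) -
     (truncate eta (f t) - f t) + (truncate eta (f s) - f s) by ring.
  apply: le_trans (ler_normD _ _) _; have := ler_normB (truncate eta (f t) - truncate eta (f s))
     (truncate eta (f t) - f t); rewrite /eta in T2 T3 *; lra.
have [v Pv] := AC_chain_primitive ab (AC_chain_dominated iK incr).
have ACg2 : AC_chain a b (fun t => (g (gam t)).2).
  apply: (AC_chain_along (F := g2)) => // t tab.
  by have [r r0 [L HL]] := second_locally_lipschitz (OmI tab); exists r => //; exists L.
have [v' Pv'] := AC_chain_primitive ab ACg2.
have [iv _] := Pv; have [iv' _] := Pv'.
split; first exact: (primitive_absolutely_continuous (gam := g \o gam) Pv Pv').
have D : {ae @lebesgue_measure R, forall t, t \in `[a, b] -> [/\ Rg (gam t),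
    is_derive t (1 : R) (fun s => (g (gam s)).1) (v t), is_derive t (1 : R) (fun s => (g (gam s)).2) (v' t) &
    v' t = wt (f t) * (q (gam t) * u1 t + p (gam t) * u2 t)]}.
  apply: ae_itv_oo_cc; have A := aeS2 (fun t => @conj _ _) (ae_derive_primitive Pv) (ae_derive_primitive Pv').
  apply: aeS2 A dgam => t [H1 H2] H tab.
  have tI : t \in `[a, b] by move: tab; rewrite !in_itv /= => /andP[/ltW -> /ltW ->].
  have [Rt [_ d2]] := H tI; split=> //; [exact: H1|exact: H2|].
  by have [_ <-] := H2 tab; have [_ <-] := d2.
exists v, (fun t => v' t / wt (f t)); split=> //.
- apply: (@integrable_dominated_ae _ _ _ K) => //.
    apply: measurable_div_wt => //; exact: is_primitive_continuous Pv.
  apply: aeS D => t H tab; have [Rt _ _ ->] := H tab; have [h1 h2] := HM t tab Rt.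
  have [_ _ gw0] := (regular_setP _).1 Rt.
  rewrite mulrAC divff ?mul1r; last by rewrite gt_eqF// weight_gt0.
  by apply: le_trans (ler_normD _ _) _; exact: bound.
- apply: aeS D => t H tab; have [Rt d1 d2 _] := H tab; have [_ _ gw0] := (regular_setP _).1 Rt.
  rewrite velocityE divfK; last by rewrite gt_eqF// weight_gt0.
  by apply/is_derive_pairP.
Qed.

(** The derivatives of the curve exist almost everywhere and are integrable by
    absolute continuity; only the second coefficient needs a bound, which
    [coefficient_bound] gives. *)
Lemma admissible_preimage : admissible alpha a b (g \o gam) -> admissible alpha a b gam.
Proof.
move=> [_ [v1 [v2 [iv1 iv2 dv]]]]; split=> //.
have [w1 Pw1] := AC_chain_primitive ab AC1; have [w2 Pw2] := AC_chain_primitive ab AC2.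
have [iw1 _] := Pw1; have [iw2 _] := Pw2; have [C HC] := coefficient_bound.
have D : {ae @lebesgue_measure R, forall t, t \in `[a, b] -> [/\ (gam t).1 != 0,
    is_derive t (1 : R) (fun s => (gam s).1) (w1 t), is_derive t (1 : R) (fun s => (gam s).2) (w2 t) &
    `|w2 t / wt (gam t).1| <= C * (`|v1 t| + `|v2 t| + `|w2 t|)]}.
  apply: ae_itv_oo_cc; have A1 := aeS2 (fun t => @conj _ _) (ae_derive_primitive Pw1) (ae_derive_primitive Pw2).
  have A2 := aeS2 (fun t => @conj _ _) ae_regular dv.
  apply: aeS2 A1 A2 => t [H1 H2] [H3 H4] tab.
  have tI : t \in `[a, b] by move: tab; rewrite !in_itv /= => /andP[/ltW -> /ltW ->].
  have Rt := H3 tI; have [_ g0 gw0] := (regular_setP _).1 Rt.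
  have d1 := H1 tab; have d2 := H2 tab; split=> //.
  have wt0 : wt (gam t).1 != 0 by rewrite gt_eqF// weight_gt0.
  have wgt0 : wt (g (gam t)).1 != 0 by rewrite gt_eqF// weight_gt0.
  have [c1 c2] := chain_rule Rt d1 d2.
  have := H4 tI; rewrite velocityE => /is_derive_pairP[e1' e2'].
  have E1 : v1 t = p (gam t) * w1 t - q (gam t) * (w2 t / wt (gam t).1).
    by have [_ <-] := e1'; have [_ ->] := c1; field.
  have E2 : v2 t = q (gam t) * w1 t + p (gam t) * (w2 t / wt (gam t).1).
    apply: (mulIf wgt0); have [_ <-] := e2'; have [_ ->] := c2; field; exact: wt0.
  have := HC t tI Rt (w1 t) (w2 t / wt (gam t).1).
  by rewrite -E1 -E2 divfK.
exists w1, (fun t => w2 t / wt (gam t).1); split=> //.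
- apply: (@integrable_dominated_ae _ _ _ (fun t => C * (`|v1 t| + `|v2 t| + `|w2 t|))) => //.
  + exact: measurable_div_wt.
  + apply: integrable_scale => //; apply: integrable_add => //; last exact: (integrable_norm _).
    by apply: integrable_add => //; exact: (integrable_norm _).
  + by apply: aeS D => t H tab; have [] := H tab.
- apply: aeS D => t H tab; have [g0 d1 d2 _] := H tab.
  rewrite velocityE divfK; last by rewrite gt_eqF// weight_gt0.
  by apply/is_derive_pairP.
Qed.

End Curve.
End RegularSet.

Unset Implicit Arguments.

Theorem corollary4p2 (R : realType) (alpha : R) (halpha : 0 < alpha)
  (Om Om' : set (R * R)) (hOm : open Om) (hOm' : open Om')
  (g : R * R -> R * R)
  (hg : HW alpha (2 * (alpha + 1) / alpha) Om Om' g)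
  (hconf : conformal alpha Om Om' g)
  (hor : orientation_preserving alpha Om Om' g)
  (a b : R) (hab : a <= b) (gam : R -> R * R)
  (hgamOm : forall t : R, t \in `[a, b] -> Om (gam t))
  (hgamAC : absolutely_continuous a b gam)
  (hgam1 : {ae @lebesgue_measure R,
              forall t : R, t \in `[a, b] -> (gam t).1 != 0}) :
  admissible alpha a b gam <-> admissible alpha a b (g \o gam).
Proof.
split.
- exact: (admissible_image halpha hOm hg hconf hor hOm' hab hgamOm hgamAC hgam1).
- exact: (admissible_preimage halpha hOm hg hconf hor hOm' hab hgamOm hgamAC hgam1).
Qed.
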